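(* Let $n\ge 1$ and let $f:\mathbb{G}_n\to\mathbb{G}_n$ be a holomorphic mapping. Then $f$ is proper if and only if there exists a finite Blaschke product $B$ such that $$f\big(\pi_n(\lambda_1,\dots,\lambda_n)\big)=\pi_n\big(B(\lambda_1),\dots,B(\lambda_n)\big),\qquad \lambda_1,\dots,\lambda_n\in\mathbb{D}.$$ In particular, $f$ is an automorphism of $\mathbb{G}_n$ if and only if there exists an automorphism $h$ of the unit disc $\mathbb{D}$ such that $$f\big(\pi_n(\lambda_1,\dots,\lambda_n)\big)=\pi_n\big(h(\lambda_1),\dots,h(\lambda_n)\big),\qquad \lambda_1,\dots,\lambda_n\in\mathbb{D}.$$
   Context: $\mathbb{D}$ is the open unit disc in $\mathbb{C}$. The mapping $\pi_n=(\pi_{n,1},\dots,\pi_{n,n}):\mathbb{C}^n\to\mathbb{C}^n$ is the symmetrization map given by the elementary symmetric polynomials $\pi_{n,k}(\lambda_1,\dots,\lambda_n)=\sum_{1\le j_1<\dots<j_k\le n}\lambda_{j_1}\cdots\lambda_{j_k}$, $k=1,\dots,n$. The symmetrized $n$-disc is the domain $\mathbb{G}_n=\pi_n(\mathbb{D}^n)\subset\mathbb{C}^n$. A finite Blaschke product is a function $B(\lambda)=c\prod_{j=1}^N\frac{\lambda-a_j}{1-\bar a_j\lambda}$ with $N\ge1$, $|c|=1$, $a_1,\dots,a_N\in\mathbb{D}$. An automorphism is a biholomorphic self-map. *)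

(* Defs.v *)
(* MathComp-Analysis, with C taken to be R[i] over R : realType. *)
From mathcomp Require Import all_boot all_order all_algebra.
From mathcomp.real_closed Require Export complex.
From mathcomp Require Import boolp classical_sets functions reals topology.
From mathcomp Require Import normedtype landau derive.

Set Implicit Arguments.
Unset Strict Implicit.
Unset Printing Implicit Defensive.

Import Order.TTheory GRing.Theory Num.Theory.
Import numFieldNormedType.Exports.

Local Open Scope classical_set_scope.
Local Open Scope ring_scope.

Section Holomorphic.
Variable R : realType.
Local Notation C := R[i].
Implicit Types V W : normedModType C.

(* A map between sets U and U' is represented by a total function, of which
   only the values on U matter.  The scalar field is C, so [differentiable]
   is Frechet differentiability with a C-linear differential; this is
   holomorphy when U is open. *)
Definition holomorphic_on V W (U : set V) (f : V -> W) :=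
  forall z, U z -> differentiable f z.

Definition proper_map V W (U : set V) (U' : set W) (f : V -> W) :=
  forall K : set W, K `<=` U' -> compact K -> compact (U `&` f @^-1` K).

Definition automorphism V (U : set V) (f : V -> V) :=
  [/\ set_fun U U f, holomorphic_on U f &
      exists g : V -> V,
        [/\ set_fun U U g, holomorphic_on U g,
            forall z, U z -> g (f z) = z & forall z, U z -> f (g z) = z]].

(* The carrier is written C^o so that C is a normed module over itself. *)
Definition unit_disc : set C^o := [set z : C^o | `|z| < 1].

Definition finite_blaschke (B : C -> C) :=
  exists (N : nat) (c : C) (a : 'I_N -> C),
    [/\ (0 < N)%N, `|c| = 1, forall j, unit_disc (a j) &
        forall z, unit_disc z ->
          B z = c * \prod_(j < N) ((z - a j) / (1 - (a j)^* * z))].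

(* The coordinate of index k < n is the elementary symmetric polynomial of
   degree k + 1. *)
Definition symmetrization n (l : 'rV[C]_n) : 'rV[C]_n :=
  \row_(k < n) \sum_(A : {set 'I_n} | #|A| == k.+1) \prod_(j in A) l 0 j.

Definition polydisc n : set 'rV[C]_n := [set l | forall j, unit_disc (l 0 j)].

Definition symmetrized_disc n : set 'rV[C]_n :=
  @symmetrization n @` @polydisc n.

End Holomorphic.

Arguments unit_disc : clear implicits.
Arguments polydisc : clear implicits.
Arguments symmetrized_disc : clear implicits.

(* Main.v *)
(* For l in the polydisc let P_l be the monic polynomial whose roots are
   symmetrized to f(pi_n(l)), and v(l) the vector of its n + 1 coefficients.
   Properness says that the largest root modulus of P_l tends to 1 when l tends
   to the boundary of the polydisc.

   If |tau| = 1, then 1 - n P_l(tau) / (tau P_l'(tau)) maps the polydisc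
   holomorphically to the disc, and it is close to 1 when P_l has a root close to
   tau.  By Harnack's inequality, closeness to 1 propagates when the coordinates
   other than l_k vary in a compact set.  Hence, as |l_k| -> 1, all the v(l) with
   the same l_k become orthogonal to a single moment vector
   (tau^n, .., tau, 1).  On the other hand P_l(tau) != 0 for l in the polydisc,
   so that, by the maximum principle applied to a determinant, fixing one more
   coordinate of l strictly decreases the dimension of the span of the v(l).  As
   this dimension is at most n + 1 when no coordinate is fixed and at least 1 when
   all of them are, it is exactly n + 1 - k when k coordinates are fixed.

   In particular the v(l) with l_1 = t span a hyperplane.  Its normal vector is
   given by maximal minors a_0(t), .., a_n(t), holomorphic in t, and the relations
   a_i a_{j+1} = a_{i+1} a_j hold since they hold in the limit |t| -> 1.  So
   B(t) = a_{n-1}(t) / a_n(t) is a root of P_l for every l with l_1 = t.  By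
   symmetry B(l_j) is a root of P_l for all j, and these are all the roots when
   they are distinct, which is generic because B is not constant. *)

Require Import Defs.
From mathcomp Require Import all_boot all_order all_algebra.
From mathcomp Require Import perm.
From mathcomp Require Import ring lra zify.
From mathcomp Require Import boolp classical_sets functions reals topology.
From mathcomp Require Import normedtype landau derive.
From mathcomp Require Import ereal sequences realfun exp trigo.
From mathcomp Require Import measure lebesgue_measure lebesgue_integral ftc.

Set Implicit Arguments.
Unset Strict Implicit.
Unset Printing Implicit Defensive.

Import Order.TTheory GRing.Theory Num.Theory.
Import numFieldNormedType.Exports.

Local Open Scope classical_set_scope.
Local Open Scope complex_scope.
Local Open Scope ring_scope.

(** No boundary values are taken: each limit as |t| -> 1 is an estimate on an annulus r < |t| < 1,
    fed to the maximum principle. The direction tau of a boundary root depends on t in an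
    uncontrolled way, and this shapes the argument: lower bounds have to be uniform in tau, and tau
    is eliminated before holomorphy in t is used, once through a determinant and once through the
    quadratic relations between minors. Several variables enter mostly through restriction to
    complex lines. The test function comes from q = tau P'(tau) / P(tau), the sum of tau / (tau -
    root). For roots in the disc each term has real part above 1/2, so Re q > n/2, that is |1 - n/q|
    < 1; a root near tau makes q large. For automorphisms the obstacle is the branch locus of the
    symmetrization, where roots coincide: there the inverse map cannot be shown holomorphic by
    solving for the roots. It is written as an explicit rational map instead, which is possible
    because the automorphisms of the disc are Moebius maps up to rotation. *)

Local Notation nm := ComplexField.Normc.normc.
Local Notation Re := complex.Re.
Local Notation Im := complex.Im.

(** * Holomorphic functions on the unit disc *)

Section Modulus.
Variable R : realType.
Local Notation C := R[i].
Implicit Types z w : C.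

(** [nm] is the modulus with values in R. Estimates are moved there because the order of C is only
    partial. *)
Lemma nmE z : `|z| = (nm z)%:C.
Proof. by []. Qed.

Lemma nm_ge0 z : 0 <= nm z.
Proof. by rewrite -ler0c -nmE normr_ge0. Qed.

Lemma nm0 : nm (0 : C) = 0.
Proof. exact: ComplexField.Normc.normc0. Qed.

Lemma nm1 : nm (1 : C) = 1.
Proof. exact: ComplexField.Normc.normc1. Qed.

Lemma nm0_eq0 z : (nm z == 0) = (z == 0).
Proof.
apply/eqP/eqP => [|->]; [exact: ComplexField.Normc.eq0_normc | exact: nm0].
Qed.

Lemma nm_gt0 z : (0 < nm z) = (z != 0).
Proof. by rewrite lt0r nm0_eq0 nm_ge0 andbT. Qed.

Lemma nmM z w : nm (z * w) = nm z * nm w.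
Proof. exact: ComplexField.Normc.normcM. Qed.

Lemma nmV z : nm z^-1 = (nm z)^-1.
Proof. exact: ComplexField.Normc.normcV. Qed.

Lemma nm_div z w : nm (z / w) = nm z / nm w.
Proof. by rewrite nmM nmV. Qed.

Lemma nmX z n : nm (z ^+ n) = nm z ^+ n.
Proof. by elim: n => [|n IH]; rewrite ?nm1 // !exprS nmM IH. Qed.

Lemma nm_real (x : R) : nm x%:C = `|x|.
Proof. by rewrite /= expr0n addr0 sqrtr_sqr. Qed.

Lemma nmN z : nm (- z) = nm z.
Proof. by apply: complexI; rewrite -!nmE normrN. Qed.

Lemma nmB z w : nm (z - w) = nm (w - z).
Proof. by rewrite -nmN opprB. Qed.

Lemma nmJ z : nm z^* = nm z.
Proof. by apply: complexI; rewrite -!nmE normcJ. Qed.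

Lemma nmD z w : nm (z + w) <= nm z + nm w.
Proof. by rewrite -lecR rmorphD -!nmE ler_normD. Qed.

Lemma nmBD z w : nm (z - w) <= nm z + nm w.
Proof. by rewrite -(nmN w) nmD. Qed.

Lemma nm_sub_ge z w : nm z - nm w <= nm (z - w).
Proof. by rewrite lerBlDr (le_trans _ (nmD _ _)) // subrK. Qed.

Lemma mulcJ z : z * z^* = (nm z ^+ 2)%:C.
Proof. by rewrite -sqr_normc nmE rmorphXn. Qed.

Lemma nm_sqr z : nm z ^+ 2 = Re z ^+ 2 + Im z ^+ 2.
Proof. by case: z => a b /=; rewrite sqr_sqrtr // addr_ge0 ?sqr_ge0. Qed.

Lemma Re_le_nm z : Re z <= nm z.
Proof.
apply: le_trans (ler_norm _) _; rewrite -lecR -nmE; exact: normc_ge_Re.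
Qed.

Lemma nm_le z : nm z <= `|Re z| + `|Im z|.
Proof.
rewrite {1}[z]complexE; apply: le_trans (nmD _ _) _.
by rewrite nmM !nm_real /= expr0n expr1n /= add0r sqrtr1 mul1r.
Qed.

Lemma Re_abs_le z : `|Re z| <= nm z.
Proof. rewrite -lecR -nmE; exact: normc_ge_Re. Qed.

Lemma Im_abs_le z : `|Im z| <= nm z.
Proof.
rewrite -(ler_pXn2r (n := 2)) ?nnegrE ?nm_ge0 // nm_sqr real_normK ?num_real //.
by rewrite lerDr sqr_ge0.
Qed.

Lemma Re_mul z w : Re (z * w) = Re z * Re w - Im z * Im w.
Proof. by case: z w => [a b] [c d]. Qed.

Lemma Im_mul z w : Im (z * w) = Re z * Im w + Im z * Re w.
Proof. by case: z w => [a b] [c d]. Qed.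

Lemma Re_add z w : Re (z + w) = Re z + Re w.
Proof. by case: z w => [a b] [c d]. Qed.

Lemma Im_add z w : Im (z + w) = Im z + Im w.
Proof. by case: z w => [a b] [c d]. Qed.

Lemma Re_opp z : Re (- z) = - Re z.
Proof. by case: z. Qed.

Lemma Im_opp z : Im (- z) = - Im z.
Proof. by case: z. Qed.

Lemma Re_conj z : Re z^* = Re z.
Proof. by case: z. Qed.

Lemma Im_conj z : Im z^* = - Im z.
Proof. by case: z. Qed.

Lemma realCB (x y : R) : (x - y)%:C = x%:C - y%:C :> C.
Proof. exact: (rmorphB (real_complex R)). Qed.

Lemma realCM (x y : R) : (x * y)%:C = x%:C * y%:C :> C.
Proof. exact: (rmorphM (real_complex R)). Qed.

Lemma conj1 : (1 : C)^* = 1.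
Proof. exact: conjc1. Qed.

Lemma conjM z w : (z * w)^* = z^* * w^*.
Proof. exact: (rmorphM (@conjc R)). Qed.

Lemma conjB z w : (z - w)^* = z^* - w^*.
Proof. exact: (rmorphB (@conjc R)). Qed.

Lemma conj_real (x : R) : (x%:C)^* = x%:C :> C.
Proof. exact: conjc_real. Qed.

Lemma conj_eq0 z : (z^* == 0) = (z == 0).
Proof. exact: conjc_eq0. Qed.

Lemma conj_K z : z^*^* = z.
Proof. exact: conjcK. Qed.

Lemma conjV z : (z^-1)^* = (z^*)^-1.
Proof. exact: conjc_inv. Qed.

Lemma nm_sum (I : Type) (r : seq I) (P : pred I) (F : I -> C) :
  nm (\sum_(i <- r | P i) F i) <= \sum_(i <- r | P i) nm (F i).
Proof.
elim/big_rec2: _ => [|i x y _ h]; first by rewrite nm0.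
by apply: le_trans (nmD _ _) _; rewrite lerD2l.
Qed.

Lemma nm_prod (I : Type) (r : seq I) (P : pred I) (F : I -> C) :
  nm (\prod_(i <- r | P i) F i) = \prod_(i <- r | P i) nm (F i).
Proof. exact: (big_morph (@ComplexField.Normc.normc R) nmM nm1). Qed.

End Modulus.

(** * Complex-valued functions of a real variable *)

Section RealVariable.
Variable R : realType.
Local Notation C := R[i].

(** Componentwise, so that the mean value theorem and the fundamental theorem of calculus for real
    functions apply. *)
Definition cder (F : R -> C) (t : R) (l : C) :=
  is_derive t 1 (fun s => Re (F s)) (Re l) /\
  is_derive t 1 (fun s => Im (F s)) (Im l).

Lemma cder_lin (F G : R -> C) (a b : C) t l m :
  cder F t l -> cder G t m ->
  cder (fun s => a * F s + b * G s) t (a * l + b * m).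
Proof.
move=> [Fr Fi] [Gr Gi]; split.
- under eq_fun do rewrite Re_add !Re_mul.
  rewrite Re_add !Re_mul; apply: is_derive_eq => /=.
  by rewrite /GRing.scale /=; ring.
- under eq_fun do rewrite Im_add !Im_mul.
  rewrite Im_add !Im_mul; apply: is_derive_eq => /=.
  by rewrite /GRing.scale /=; ring.
Qed.

Lemma cder_conj (F : R -> C) t l : cder F t l -> cder (fun s => (F s)^*) t l^*.
Proof.
move=> [Fr Fi]; split.
  by under eq_fun do rewrite Re_conj; rewrite Re_conj.
by under eq_fun do rewrite Im_conj; rewrite Im_conj; apply: is_derive_eq.
Qed.

(** The mean value theorem fails for complex values. It is applied to the real function Re (conj D
    F), where D is the total increment of F; its increment is |D|^2, and dividing by |D| gives the
    bound. *)
Lemma mean_value_ineq (F f : R -> C) (a b M : R) : a <= b ->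
  (forall t, a <= t <= b -> cder F t (f t)) ->
  (forall t, a <= t <= b -> nm (f t) <= M) ->
  nm (F b - F a) <= M * (b - a).
Proof.
move=> ab dF fM; set D := F b - F a.
have M0 : 0 <= M by apply: le_trans (nm_ge0 (f a)) (fM a _); rewrite lexx.
have [->|D0] := eqVneq D 0; first by rewrite nm0 mulr_ge0 // subr_ge0.
pose h t := Re (D^* * F t).
have dh t : a <= t <= b -> is_derive t 1 h (Re (D^* * f t)).
  move=> /dF dFt; have [+ _] := cder_lin D^* 0 dFt dFt.
  rewrite mul0r addr0; congr is_derive; apply/funext => s.
  by rewrite /h mul0r addr0.
have [c cab hE] : exists2 c, c \in `[a, b] & h b - h a = Re (D^* * f c) * (b - a).
  apply: (MVT_segment ab) => [t /itvP tab|].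
    by apply: dh; rewrite !tab.
  apply: derivable_within_continuous => t /itvP tab.
  by have := dh t; rewrite !tab => /(_ isT) [].
have {hE} hE : nm D ^+ 2 = Re (D^* * f c) * (b - a).
  rewrite -hE /h -[LHS]/(Re (nm D ^+ 2)%:C) -mulcJ mulrC {2}/D mulrBr.
  by rewrite Re_add Re_opp.
have D0' : 0 < nm D by rewrite nm_gt0.
rewrite -(ler_pM2l D0') -expr2 hE mulrA ler_wpM2r ?subr_ge0 //.
apply: le_trans (Re_le_nm _) _; rewrite nmM nmJ ler_wpM2l ?nm_ge0 //.
by apply: fM; move/itvP: cab => cab; rewrite !cab.
Qed.

(** Clamping the argument to [a, b] extends [f] continuously to the line. Integrating from a - 1
    makes every point of [a, b], ends included, interior to the interval of integration. *)
Lemma primitive_real (f : R -> R) (a b : R) :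
  (forall x, a <= x <= b -> {for x, continuous f}) ->
  exists F : R -> R, forall x, a <= x <= b -> is_derive x 1 F (f x).
Proof.
move=> cf; pose g x := f (Num.max a (Num.min b x)).
have [ba|ab] := ltP b a.
  exists f => x /andP[ax xb]; have := le_lt_trans (le_trans ax xb) ba.
  by rewrite ltxx.
have cg : continuous g.
  move=> x; apply: continuous_comp; last first.
    by apply: cf; rewrite le_max lexx /= ge_max ab ge_min lexx.
  apply: (@continuous_max R R (cst a) (fun x => Num.min b x)); first exact: cst_continuous.
  by apply: (@continuous_min R R (cst b) id) => //; exact: cst_continuous.
exists (fun x => \int[lebesgue_measure]_(t in [set` `[a - 1, x]]) g t)%R.
move=> x /andP[ax xb].
have ig : lebesgue_measure.-integrable [set` `[a - 1, b + 1]] (EFin \o g).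
  apply: continuous_compact_integrable; first exact: segment_compact.
  by apply: continuous_subspaceT.
have xb1 : x < b + 1 by rewrite ltr_pwDr.
have ax1 : a - 1 < x by rewrite (lt_le_trans _ ax) // ltrBlDr ltr_pwDr.
have [d1 d2] := continuous_FTC1_closed xb1 ig ax1 (@cg x).
apply: DeriveDef; first exact: d1.
by rewrite -derive1E d2 /g (min_idPr xb) (max_idPr ax).
Qed.

Lemma primitive_complex (f : R -> C) (a b : R) :
  (forall x, a <= x <= b -> {for x, continuous (fun t => Re (f t))}) ->
  (forall x, a <= x <= b -> {for x, continuous (fun t => Im (f t))}) ->
  exists F : R -> C, forall x, a <= x <= b -> cder F x (f x).
Proof.
move=> /primitive_real [F dF] /primitive_real [G dG].
by exists (fun x => F x +i* G x) => x xab; split; [apply: dF|apply: dG].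
Qed.

End RealVariable.

(* Inductive wrappers, so that failing unifications do not explore the canonical
   structures on R[i]^o. *)
Variant holo (R : realType) (F : R[i] -> R[i]) (z : R[i]) : Prop :=
  Holo of differentiable (F : R[i]^o -> R[i]^o) (z : R[i]^o).

Variant cont (R : realType) (F : R[i] -> R[i]) (z : R[i]) : Prop :=
  Cont of {for (z : R[i]^o), continuous (F : R[i]^o -> R[i]^o)}.

Lemma holoE (R : realType) (F : R[i] -> R[i]) (z : R[i]) :
  holo F z <-> differentiable (F : R[i]^o -> R[i]^o) (z : R[i]^o).
Proof. by split=> [[]|]. Qed.

Lemma contE (R : realType) (F : R[i] -> R[i]) (z : R[i]) :
  cont F z <-> {for (z : R[i]^o), continuous (F : R[i]^o -> R[i]^o)}.
Proof. by split=> [[]|]. Qed.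

(** * Epsilon-delta forms of differentiability and continuity *)

Section EpsilonDelta.

Lemma is_derive_le (K : numFieldType) (f : K -> K) (x l : K) :
  is_derive x 1 f l -> forall e : K, 0 < e -> exists2 d : K, 0 < d &
  forall y, `|y - x| < d -> `|f y - f x - l * (y - x)| <= e * `|y - x|.
Proof.
move=> [df dE] e e0.
have := df; rewrite /derivable => /cvg_ex[l' hl].
have ll' : l' = l by rewrite -dE /derive; apply/esym/cvg_lim.
move: hl; rewrite {}ll' => /cvgrPdist_lt/(_ e e0).
rewrite /dnbhs near_withinE => /nbhs_ballP[d /= d0 Hd]; exists d => // y yd.
have [->|yx] := eqVneq y x; first by rewrite !subrr mulr0 subr0 normr0 mulr0.
have yx0 : y - x != 0 by rewrite subr_eq0.
have := Hd (y - x); rewrite /ball /= sub0r normrN => /(_ yd yx0).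
rewrite -(ltr_pM2r (x := `|y - x|)) ?normr_gt0 // => /ltW.
rewrite -normrM mulrBl /GRing.scale /= mulr1 subrK mulrAC mulVf // mul1r.
by rewrite distrC.
Qed.

Lemma le_is_derive (K : numFieldType) (f : K -> K) (x l : K) :
  (forall e : K, 0 < e -> exists2 d : K, 0 < d &
    forall y, `|y - x| < d -> `|f y - f x - l * (y - x)| <= e * `|y - x|) ->
  is_derive x 1 f l.
Proof.
move=> H.
have cv : (fun h => h^-1 *: ((f \o shift x) (h *: 1) - f x)) @ 0^' --> l.
  apply/cvgrPdist_le => e e0; have [d d0 Hd] := H e e0.
  rewrite /dnbhs near_withinE; apply/nbhs_ballP; exists d => //= h.
  rewrite /ball /= sub0r normrN /GRing.scale /= mulr1 => hd h0.
  have := Hd (h + x); rewrite addrK => /(_ hd).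
  rewrite -ler_pdivrMr ?normr_gt0 // -normfV -normrM mulrBl mulfK //.
  by rewrite distrC [_ / h]mulrC.
by apply: DeriveDef; [apply/cvg_ex; exists l | rewrite /derive; apply/cvg_lim].
Qed.

Variable R : realType.
Local Notation C := R[i].

Lemma pos_complexP (d : C) : 0 < d -> d = (Re d)%:C /\ 0 < Re d.
Proof.
rewrite ltcE /= => /andP[/eqP Id Rd]; split => //.
by case: d Id {Rd} => a b /= ->.
Qed.

Definition cdiff (F : C -> C) (z l : C) := forall e : R, 0 < e ->
  exists2 d : R, 0 < d & forall w, nm (w - z) < d ->
    nm (F w - F z - l * (w - z)) <= e * nm (w - z).

Lemma cdiffP (F : C -> C) (z : C) :
  holo F z <-> exists l, cdiff F z l.
Proof.
split=> [/holoE/derivable1_diffP/derivableP /is_derive_le H|[l H]].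
  exists ('D_1 (F : C^o -> C^o) (z : C^o)) => e e0; have [|d d0 Hd] := H e%:C; first by rewrite ltcR.
  have [dE d0'] := pos_complexP d0.
  exists (Re d) => // w wd; rewrite -lecR rmorphM /= -!nmE; apply: Hd.
  by rewrite dE nmE ltcR.
apply/holoE/derivable1_diffP; suff [] : is_derive (z : C^o) 1 (F : C^o -> C^o) l by [].
apply: le_is_derive => e /pos_complexP[-> e0]; have [d d0 Hd] := H _ e0.
exists d%:C; first by rewrite ltcR.
by move=> y; rewrite !nmE ltcR -rmorphM lecR; apply: Hd.
Qed.

Lemma ccontP (F : C -> C) (z : C) :
  cont F z <-> forall e : R, 0 < e ->
  exists2 d : R, 0 < d & forall w, nm (w - z) < d -> nm (F w - F z) < e.
Proof.
split=> [/contE/cvgrPdist_lt H e e0|H].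
  have /nbhs_ballP[d /= /pos_complexP[dE d0] Hd] : \forall w \near (z : C^o), `|F z - F w| < e%:C.
    by apply: H; rewrite ltcR.
  exists (Re d) => // w wd; rewrite nmB -ltcR -nmE; apply: Hd.
  by rewrite /ball /= dE nmE nmB ltcR.
apply/contE; rewrite /prop_for /continuous_at.
apply/(@cvgrPdist_lt _ C^o _ (nbhs (z : C^o))).
move=> e /pos_complexP[-> e0]; have [d d0 Hd] := H _ e0.
apply/nbhs_ballP; exists d%:C; first by rewrite /= ltcR.
by move=> w; rewrite /ball /= !nmE !ltcR nmB [nm (F z - _)]nmB; apply: Hd.
Qed.

Lemma cder_line (F : C -> C) (z0 u l : C) (s : R) :
  cdiff F (z0 + s%:C * u) l -> cder (fun t => F (z0 + t%:C * u)) s (l * u).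
Proof.
move=> H.
have {}H (e : R) : 0 < e -> exists2 d : R, 0 < d & forall t, `|t - s| < d ->
    nm (F (z0 + t%:C * u) - F (z0 + s%:C * u) - l * u * (t - s)%:C) <= e * `|t - s|.
  move=> e0; have u0 : 0 < nm u + 1 by rewrite ltr_wpDl ?nm_ge0.
  have [|d d0 Hd] := H (e / (nm u + 1)); first by rewrite divr_gt0.
  exists (d / (nm u + 1)); first by rewrite divr_gt0.
  move=> t ts; have E : z0 + t%:C * u - (z0 + s%:C * u) = (t - s)%:C * u.
    by rewrite rmorphB /=; ring.
  have := Hd (z0 + t%:C * u); rewrite E nmM nm_real.
  have le1 : `|t - s| * nm u <= `|t - s| * (nm u + 1).
    by rewrite ler_wpM2l // lerDl.
  have lt1 : `|t - s| * nm u < d by apply: le_lt_trans le1 _; rewrite -ltr_pdivlMr.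
  move=> /(_ lt1).
  rewrite [(t - s)%:C * u]mulrC [X in nm (_ - X) <= _]mulrA.
  move=> /le_trans; apply.
  by rewrite mulrAC ler_pdivrMr // -mulrA ler_wpM2l // ltW.
have RM (a : C) (b : R) : Re (a * b%:C) = Re a * b by rewrite Re_mul /= mulr0 subr0.
have IM (a : C) (b : R) : Im (a * b%:C) = Im a * b by rewrite Im_mul /= mulr0 add0r.
split; apply: le_is_derive => e /H[d d0 Hd]; exists d => // t /Hd.
  by apply: le_trans; rewrite -RM -!Re_opp -!Re_add Re_abs_le.
by apply: le_trans; rewrite -IM -!Im_opp -!Im_add Im_abs_le.
Qed.

End EpsilonDelta.

(** * The complex exponential *)

Section ComplexExponential.
Variable R : realType.
Local Notation C := R[i].

Definition cexp (z : C) : C :=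
  (expR (Re z) * cos (Im z)) +i* (expR (Re z) * sin (Im z)).

Lemma cexpD z w : cexp (z + w) = cexp z * cexp w.
Proof.
apply/eqP; rewrite eq_complex Re_mul Im_mul /= Re_add Im_add expRD cosD sinD.
by apply/andP; split; apply/eqP; ring.
Qed.

Lemma nm_cexp z : nm (cexp z) = expR (Re z).
Proof.
rewrite /= !exprMn -mulrDr cos2Dsin2 mulr1 sqrtr_sqr ger0_norm //. Qed.

Lemma cexp_cdiff z : cdiff cexp z (cexp z).
Proof.
(* The functional equation reduces differentiability to the point 0. *)
suff H0 (e : R) : 0 < e -> exists2 d : R, 0 < d & forall h, nm h < d ->
    nm (cexp h - 1 - h) <= e * nm h.
  move=> e e0; have c0 : 0 < nm (cexp z) by rewrite nm_cexp expR_gt0.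
  have [|d d0 Hd] := H0 (e / nm (cexp z)); first by rewrite divr_gt0.
  exists d => // w /Hd.
  rewrite mulrAC ler_pdivlMr // mulrC -nmM !mulrBr mulr1 -cexpD.
  by rewrite [z + _]addrC subrK -mulrBr.
move=> e0.
(* With e^x <= 3 near 0, the real and imaginary errors are at most 6/12 and 5/12 of e |h|. *)
have e4 : 0 < e / 4 by rewrite divr_gt0.
have e12 : 0 < e / 12 by rewrite divr_gt0.
have [d1 d10 H1] := is_derive_le (is_derive_expR (0 : R)) e4.
have [d2 d20 H2] := is_derive_le (is_derive_cos (0 : R)) e12.
have [d3 d30 H3] := is_derive_le (is_derive_sin (0 : R)) e12.
have [d4 d40 H4] := is_derive_le (is_derive_expR (0 : R)) ltr01.
rewrite expR0 in H1 H4; rewrite cos0 sin0 in H2 H3.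
exists (Num.min (Num.min d1 d2) (Num.min (Num.min d3 d4) (Num.min 1 (e / 12)))).
  by rewrite !lt_min ?d10 ?d20 ?d30 ?d40 ltr01 e12.
move=> h; rewrite !lt_min -!andbA => /and5P[hd1 hd2 hd3 hd4 /andP[h1 he]].
have xh := Re_abs_le h; have yh := Im_abs_le h.
case: h => x y in hd1 hd2 hd3 hd4 h1 he xh yh *; set n := nm _ in hd1 hd2 hd3 hd4 h1 he xh yh *.
rewrite /= in xh yh.
have {H1} := H1 x; rewrite subr0 (le_lt_trans xh hd1) => /(_ isT).
have {H4} := H4 x; rewrite subr0 (le_lt_trans xh hd4) => /(_ isT).
have {H2} := H2 y; rewrite subr0 (le_lt_trans yh hd2) => /(_ isT).
have {H3} := H3 y; rewrite subr0 (le_lt_trans yh hd3) => /(_ isT).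
rewrite !subr0 !oppr0 !mul0r !subr0 !mul1r => s1 c1 x2 x1.
have n0 : 0 <= n by exact: nm_ge0.
have ex0 := expR_ge0 x.
have ex3 : expR x <= 3.
  have : expR x - 1 - x <= `|x| by apply: le_trans (ler_norm _) x2.
  have : x <= `|x| := ler_norm x.
  lra.
apply: le_trans (nm_le _) _; rewrite Re_add Im_add Re_add Im_add !Re_opp !Im_opp /=.
have -> : expR x * cos y - 1 - x = (expR x - 1 - x) + expR x * (cos y - 1) by ring.
have -> : expR x * sin y - 0 - y = (expR x - 1 - x) * y + x * y + expR x * (sin y - y) by ring.
have A1 : `|expR x - 1 - x + expR x * (cos y - 1)| <= e / 4 * n + 3 * (e / 12 * n).
  apply: le_trans (ler_normD _ _) _; apply: lerD.
    by apply: le_trans x1 _; rewrite ler_wpM2l // ltW.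
  rewrite normrM (ger0_norm ex0); apply: ler_pM => //.
  by apply: le_trans c1 _; rewrite ler_wpM2l // ltW.
have A2 : `|(expR x - 1 - x) * y + x * y + expR x * (sin y - y)|
    <= 1 * n * (e / 12) + n * (e / 12) + 3 * (e / 12 * n).
  apply: le_trans (ler_normD _ _) _; apply: lerD; last first.
    rewrite normrM (ger0_norm ex0); apply: ler_pM => //.
    by apply: le_trans s1 _; rewrite ler_wpM2l // ltW.
  have ye : `|y| <= e / 12 by rewrite (le_trans yh) // ltW.
  apply: le_trans (ler_normD _ _) _; apply: lerD; rewrite normrM; apply: ler_pM => //.
  by apply: le_trans x2 _; rewrite mul1r.
have en : 0 <= e * n by rewrite mulr_ge0 // ltW.
apply: le_trans (lerD A1 A2) _; lra.
Qed.

End ComplexExponential.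


Section HoloCalculus.
Variable R : realType.
Local Notation C := R[i].
Implicit Types (f g : C -> C) (z : C).

Lemma holo_cont f z : holo f z -> cont f z.
Proof. by move=> /holoE/differentiable_continuous/contE. Qed.

Lemma holo_cst (c : C) z : holo (fun=> c) z.
Proof. by apply/holoE; exact: (@differentiable_cst _ C^o C^o). Qed.

Lemma holo_id z : holo (fun w => w) z.
Proof.
apply/cdiffP; exists 1 => e e0; exists 1 => // w _.
by rewrite mul1r subrr nm0 mulr_ge0 ?nm_ge0 // ltW.
Qed.

Lemma holoD f g z : holo f z -> holo g z -> holo (fun w => f w + g w) z.
Proof. by move=> /holoE h1 /holoE h2; apply/holoE; apply: differentiableD h1 h2. Qed.

Lemma holoB f g z : holo f z -> holo g z -> holo (fun w => f w - g w) z.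
Proof. by move=> /holoE h1 /holoE h2; apply/holoE; apply: differentiableB h1 h2. Qed.

Lemma holoM f g z : holo f z -> holo g z -> holo (fun w => f w * g w) z.
Proof. by move=> /holoE h1 /holoE h2; apply/holoE; apply: differentiableM h1 h2. Qed.

Lemma holoV f z : holo f z -> f z != 0 -> holo (fun w => (f w)^-1) z.
Proof. by move=> /holoE h1 h2; apply/holoE; apply: differentiableV h1 h2. Qed.

Lemma holo_comp f g z : holo f z -> holo g (f z) -> holo (fun w => g (f w)) z.
Proof. by move=> /holoE h1 /holoE h2; apply/holoE; apply: differentiable_comp h1 h2. Qed.

Lemma contM f g z : cont f z -> cont g z -> cont (fun w => f w * g w) z.
Proof. by move=> /contE h1 /contE h2; apply/contE; apply: continuousM h1 h2. Qed.

Lemma contV f z : cont f z -> f z != 0 -> cont (fun w => (f w)^-1) z.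
Proof. by move=> /contE h1 h2; apply/contE; apply: continuousV h2 h1. Qed.

Lemma contB f g z : cont f z -> cont g z -> cont (fun w => f w - g w) z.
Proof. by move=> /contE h1 /contE h2; apply/contE; apply: continuousB h1 h2. Qed.

Lemma cont_comp f g z : cont f z -> cont g (f z) -> cont (fun w => g (f w)) z.
Proof. by move=> /contE h1 /contE h2; apply/contE; apply: continuous_comp h1 h2. Qed.

End HoloCalculus.

(** * Goursat's theorem on rectangles *)

Section Goursat.
Variable R : realType.
Local Notation C := R[i].

Record rect := Rect { rxl : R; rxr : R; ryl : R; ryr : R }.

Definition wf_rect (q : rect) := rxl q <= rxr q /\ ryl q <= ryr q.

Definition sub_rect (q' q : rect) :=
  [/\ rxl q <= rxl q', rxr q' <= rxr q, ryl q <= ryl q' & ryr q' <= ryr q].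

Variable g : C -> C.
Variable q0 : rect.
Hypothesis wf0 : wf_rect q0.
Hypothesis dg : forall x y, rxl q0 <= x <= rxr q0 -> ryl q0 <= y <= ryr q0 ->
  exists l, cdiff g (x +i* y) l.
(** Antiderivatives along horizontal lines and, with the factor i of dz = i dy, along vertical
    lines; their increments stand for the integrals over the sides. *)
Variables H V : R -> R -> C.
Hypothesis dH : forall y, ryl q0 <= y <= ryr q0 ->
  forall x, rxl q0 <= x <= rxr q0 -> cder (H y) x (g (x +i* y)).
Hypothesis dV : forall x, rxl q0 <= x <= rxr q0 ->
  forall y, ryl q0 <= y <= ryr q0 -> cder (V x) y (g (x +i* y) * 'i%C).

Definition boundary_integral (q : rect) : C :=
  (H (ryl q) (rxr q) - H (ryl q) (rxl q)) - (H (ryr q) (rxr q) - H (ryr q) (rxl q))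
  + (V (rxr q) (ryr q) - V (rxr q) (ryl q)) - (V (rxl q) (ryr q) - V (rxl q) (ryl q)).

Local Notation I := boundary_integral.

(** Near the point, [g] is affine up to e times the distance. The affine part has the primitive [A]
    and contributes 0 around the rectangle; the remainder is at most e s on sides of total length 2
    s, where s is width plus height. *)
Lemma boundary_integral_local (p1 p2 : R) (e : R) :
  rxl q0 <= p1 <= rxr q0 -> ryl q0 <= p2 <= ryr q0 -> 0 < e ->
  exists2 d : R, 0 < d & forall q, wf_rect q -> sub_rect q q0 ->
    rxl q <= p1 <= rxr q -> ryl q <= p2 <= ryr q ->
    (rxr q - rxl q) + (ryr q - ryl q) < d ->
    nm (I q) <= 2 * e * ((rxr q - rxl q) + (ryr q - ryl q)) ^+ 2.
Proof.
move=> hp1 hp2 e0; have [l hl] := dg hp1 hp2.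
set p : C := p1 +i* p2 in hl.
have [d d0 Hd] := hl e e0; exists d => // q [wx wy] [s1 s2 s3 s4].
case/andP=> q1 q2 /andP[q3 q4]; set s := _ + _ => sd.
pose A (w : C) := g p * (w - p) + l / 2 * (w - p) ^+ 2.
have dA w : cdiff A w (g p + l * (w - p)).
  move=> e1 e10; have n0 : 0 < nm (l / 2) + 1 by rewrite ltr_wpDl ?nm_ge0.
  exists (e1 / (nm (l / 2) + 1)) => [|w' hw']; first by rewrite divr_gt0.
  have -> : A w' - A w - (g p + l * (w - p)) * (w' - w)
      = (l / 2) * (w' - w) * (w' - w).
    by rewrite /A; field.
  rewrite !nmM; rewrite ler_wpM2r ?nm_ge0 // -nmM.
  rewrite ltr_pdivlMr // in hw'; apply: le_trans _ (ltW hw').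
  by rewrite nmM mulrC ler_wpM2l ?nm_ge0 // lerDl.
have rem x y : rxl q <= x <= rxr q -> ryl q <= y <= ryr q ->
    nm (g (x +i* y) - (g p + l * (x +i* y - p))) <= e * s.
  move=> /andP[x1 x2] /andP[y1 y2].
  have ws : nm (x +i* y - p) <= s.
    apply: le_trans (nm_le _) _; rewrite Re_add Im_add Re_opp Im_opp /=.
    by apply: lerD; rewrite ler_norml; apply/andP; split; lra.
  have := Hd (x +i* y) (le_lt_trans ws sd); rewrite opprD addrA => /le_trans; apply.
  by rewrite ler_wpM2l // ltW.
have incH y : ryl q <= y <= ryr q ->
    nm ((H y (rxr q) - A (rxr q +i* y)) - (H y (rxl q) - A (rxl q +i* y)))
      <= e * s * (rxr q - rxl q).
  move=> hy; have /andP[y1 y2] := hy.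
  apply: (@mean_value_ineq _ (fun x => H y x - A (x +i* y))
    (fun x => g (x +i* y) - (g p + l * (x +i* y - p)))) => // [x /andP[x1 x2]|x hx]; last exact: rem.
  have hx : rxl q0 <= x <= rxr q0 by apply/andP; split; lra.
  have hy' : ryl q0 <= y <= ryr q0 by apply/andP; split; lra.
  have E (t : R) : (0 +i* y) + t%:C * 1 = t +i* y :> C.
    by apply/eqP; rewrite eq_complex /= !mulr0 !mul0r mulr1 subr0 !addr0 add0r !eqxx.
  have := @cder_line _ A (0 +i* y) 1 _ x (dA _).
  under eq_fun do rewrite E; rewrite E mulr1 => h2.
  have := cder_lin 1 (-1) (dH hy' hx) h2.
  by under eq_fun do rewrite mul1r mulN1r; rewrite mul1r mulN1r.
have incV x : rxl q <= x <= rxr q ->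
    nm ((V x (ryr q) - A (x +i* ryr q)) - (V x (ryl q) - A (x +i* ryl q)))
      <= e * s * (ryr q - ryl q).
  move=> hx; have /andP[x1 x2] := hx.
  apply: (@mean_value_ineq _ (fun y => V x y - A (x +i* y))
    (fun y => (g (x +i* y) - (g p + l * (x +i* y - p))) * 'i%C)) => // [y /andP[y1 y2]|y hy]; last first.
    by rewrite nmM [nm 'i%C]/= expr0n expr1n add0r sqrtr1 mulr1; exact: rem.
  have hy : ryl q0 <= y <= ryr q0 by apply/andP; split; lra.
  have hx' : rxl q0 <= x <= rxr q0 by apply/andP; split; lra.
  have E (t : R) : (x +i* 0) + t%:C * 'i%C = x +i* t :> C.
    by apply/eqP; rewrite eq_complex /= !mulr0 !mul0r mulr1 subr0 !addr0 add0r !eqxx.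
  have := @cder_line _ A (x +i* 0) 'i%C _ y (dA _).
  under eq_fun do rewrite E; rewrite E => h2.
  have := cder_lin 1 (-1) (dV hx' hy) h2.
  by under eq_fun do rewrite mul1r mulN1r; rewrite mul1r mulN1r -mulrBl.
have h1 := incH (ryl q); have h2 := incH (ryr q).
have h3 := incV (rxl q); have h4 := incV (rxr q).
rewrite !lexx ?wx ?wy in h1 h2 h3 h4.
have {}h1 := h1 isT; have {}h2 := h2 isT; have {}h3 := h3 isT; have {}h4 := h4 isT.
set a := nm _ in h1; set b := nm _ in h2; set c := nm _ in h3; set f := nm _ in h4.
have : nm (I q) <= a + b + f + c.
  apply: le_trans (lerD (lerD (nmBD _ _) (lexx _)) (lexx _)).
  apply: le_trans (lerD (nmD _ _) (lexx _)).
  apply: le_trans (nmBD _ _).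
  rewrite le_eqVlt; apply/orP; left; apply/eqP; congr nm; rewrite /I; ring.
move=> /le_trans; apply.
rewrite (_ : 2 * e * s ^+ 2 =
  2 * (e * s * (rxr q - rxl q)) + 2 * (e * s * (ryr q - ryl q))); first by lra.
by rewrite /s; ring.
Qed.

(** The boundary integrals of the four quarters add up to that of [q], so one of them carries at
    least a quarter of it. Well-formedness stands under the existential so that [choice] yields a
    total function to iterate. *)
Lemma bisect_rect (q : rect) : exists q' : rect, wf_rect q ->
  [/\ wf_rect q', sub_rect q' q, rxr q' - rxl q' = (rxr q - rxl q) / 2,
      ryr q' - ryl q' = (ryr q - ryl q) / 2 & nm (I q) <= 4 * nm (I q')].
Proof.
case: q => x x' y y'; set q := Rect _ _ _ _.
pose m := (x + x') / 2; pose n := (y + y') / 2.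
have tot : nm (I q) <= nm (I (Rect x m y n)) + nm (I (Rect m x' y n))
    + nm (I (Rect x m n y')) + nm (I (Rect m x' n y')).
  apply: le_trans (lerD (lerD (nmD _ _) (lexx _)) (lexx _)).
  apply: le_trans (lerD (nmD _ _) (lexx _)).
  apply: le_trans (nmD _ _).
  by rewrite le_eqVlt; apply/orP; left; apply/eqP; congr nm; rewrite /I /=; ring.
have : [\/ nm (I q) <= 4 * nm (I (Rect x m y n)), nm (I q) <= 4 * nm (I (Rect m x' y n)),
           nm (I q) <= 4 * nm (I (Rect x m n y')) | nm (I q) <= 4 * nm (I (Rect m x' n y'))].
  have [h1|h1] := leP (nm (I q)) (4 * nm (I (Rect x m y n))); first exact: Or41.
  have [h2|h2] := leP (nm (I q)) (4 * nm (I (Rect m x' y n))); first exact: Or42.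
  have [h3|h3] := leP (nm (I q)) (4 * nm (I (Rect x m n y'))); first exact: Or43.
  by apply: Or44; lra.
by move=> [] h; [exists (Rect x m y n) | exists (Rect m x' y n)
  | exists (Rect x m n y') | exists (Rect m x' n y')] => -[/= xx yy];
  split => //=; rewrite /wf_rect /sub_rect /=; try split; rewrite /m /n; lra.
Qed.

Lemma nested_intervals (a b : nat -> R) :
  (forall n, a n <= a n.+1) -> (forall n, b n.+1 <= b n) -> (forall n, a n <= b n) ->
  exists p, forall n, a n <= p <= b n.
Proof.
move=> aI bD ab.
have aM : {homo a : m n / (m <= n)%N >-> m <= n}.
  by apply: homo_leq => //; exact: le_trans.
have bM : {homo b : m n / (m <= n)%N >-> n <= m}.
  by apply: homo_leq => // x y z h1 h2; exact: le_trans h2 h1.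
have abmn m n : a m <= b n.
  apply: le_trans (aM m (maxn m n) _) _; rewrite ?leq_maxl //.
  by apply: le_trans (ab _) (bM n _ _); rewrite leq_maxr.
have ubn n : ubound (range a) (b n) by move=> _ [m _ <-].
exists (sup (range a)) => n; apply/andP; split; last first.
  by apply: ge_sup; [exists (a 0), 0 | exact: ubn].
by apply: ub_le_sup; [exists (b 0); exact: ubn | exists n].
Qed.

Lemma expn2_unbounded (x : R) : exists n : nat, x < 2 ^+ n.
Proof.
exists (Num.truncn `|x|).+1; apply: le_lt_trans (ler_norm x) _.
apply: lt_le_trans (truncnS_gt _) _.
by rewrite -natrX ler_nat ltnW // ltn_expl.
Qed.

Lemma goursat : boundary_integral q0 = 0.
Proof.
apply/eqP; rewrite -nm0_eq0 eq_le nm_ge0 andbT leNgt; apply/negP => c0.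
have [next Hnext] := choice bisect_rect.
pose q n := iter n next q0.
have wq n : wf_rect (q n) by elim: n => // n /Hnext[].
have qS n : [/\ sub_rect (q n.+1) (q n),
  rxr (q n.+1) - rxl (q n.+1) = (rxr (q n) - rxl (q n)) / 2,
  ryr (q n.+1) - ryl (q n.+1) = (ryr (q n) - ryl (q n)) / 2 &
  nm (I (q n)) <= 4 * nm (I (q n.+1))] by have [] := Hnext _ (wq n).
have [p1 hp1] : exists p, forall n, rxl (q n) <= p <= rxr (q n).
  by apply: nested_intervals => n; [case: (qS n) => -[]|case: (qS n) => -[]|case: (wq n)].
have [p2 hp2] : exists p, forall n, ryl (q n) <= p <= ryr (q n).
  by apply: nested_intervals => n; [case: (qS n) => -[]|case: (qS n) => -[]|case: (wq n)].
pose s := (rxr q0 - rxl q0) + (ryr q0 - ryl q0).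
have sq n : (rxr (q n) - rxl (q n)) + (ryr (q n) - ryl (q n)) = s / 2 ^+ n.
  elim: n => [|n IH]; first by rewrite expr0 divr1.
  case: (qS n) => _ -> -> _; rewrite -mulrDl IH exprS.
  by field; rewrite expf_neq0.
have Iq n : nm (I q0) <= 4 ^+ n * nm (I (q n)).
  elim: n => [|n IH]; first by rewrite expr0 mul1r.
  apply: le_trans IH _; rewrite exprSr -mulrA ler_wpM2l ?exprn_ge0 //.
  by case: (qS n).
have sub0 n : sub_rect (q n) q0.
  elim: n => [|n [h1 h2 h3 h4]]; first by split.
  by case: (qS n) => -[k1 k2 k3 k4] _ _ _; split; [exact: le_trans k1|
    exact: le_trans h2|exact: le_trans k3|exact: le_trans h4].
have s0 : 0 <= s by case: wf0 => ? ?; rewrite addr_ge0 // subr_ge0.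
have s10 : 0 < s ^+ 2 + 1 by rewrite ltr_wpDl // sqr_ge0.
(* This makes 2 e s^2 smaller than |I q0|; the summand 1 covers a degenerate rectangle, s = 0. *)
pose e := nm (I q0) / 4 / (s ^+ 2 + 1).
have e0 : 0 < e by rewrite !divr_gt0.
have [d d0 Hd] := boundary_integral_local (hp1 0) (hp2 0) e0.
have [n hn] := expn2_unbounded (s / d).
have n0 : 0 < 2 ^+ n :> R by rewrite exprn_gt0.
have := Hd (q n) (wq n) (sub0 n) (hp1 n) (hp2 n); rewrite sq.
rewrite ltr_pdivrMr // mulrC -ltr_pdivrMr // => /(_ hn) hI.
have := Iq n; rewrite leNgt => /negP; apply.
have n40 : 0 < 4 ^+ n :> R by rewrite exprn_gt0.
rewrite -ltr_pdivlMl //; apply: le_lt_trans hI _.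
rewrite expr_div_n -exprM mulnC exprM (_ : 2 ^+ 2 = 4 :> R); last by rewrite -natrX.
rewrite mulrA [X in X < _]mulrC ltr_pM2l ?invr_gt0 //.
rewrite /e (_ : 2 * _ * _ = nm (I q0) * (s ^+ 2 / (2 * (s ^+ 2 + 1)))); last by field; rewrite gt_eqF.
rewrite gtr_pMr // ltr_pdivrMr; lra.
Qed.

End Goursat.

(** * Mean values over circles *)

Section CircleMean.
Variable R : realType.
Local Notation C := R[i].
Implicit Types (f g : R -> C) (F : C -> C) (r t : R).

Lemma increment_unique f (F G : R -> C) (a b : R) : a <= b ->
  (forall t, a <= t <= b -> cder F t (f t)) ->
  (forall t, a <= t <= b -> cder G t (f t)) ->
  F b - F a = G b - G a.
Proof.
move=> ab dF dG; apply/eqP; rewrite -subr_eq0 -nm0_eq0 eq_le nm_ge0 andbT.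
have d0 t : a <= t <= b -> cder (fun s => 1 * F s + -1 * G s) t 0.
  by move=> tab; have := cder_lin 1 (-1) (dF t tab) (dG t tab); rewrite mul1r mulN1r subrr.
have z0 (t : R) : a <= t <= b -> nm (0 : C) <= 0 by rewrite nm0.
have := mean_value_ineq ab d0 z0; rewrite mul0r; congr (nm _ <= 0); ring.
Qed.

(** The mean over [0, 2 pi], with the increment of a primitive in place of an integral, so that
    [mean_value_ineq] bounds it directly. *)
Definition is_mean f (m : C) := exists F : R -> C,
  (forall t, 0 <= t <= pi *+ 2 -> cder F t (f t)) /\
  F (pi *+ 2) - F 0 = (pi *+ 2)%:C * m.

Let twopi_gt0 : 0 < pi *+ 2 :> R.
Proof. by rewrite mulrn_wgt0 ?pi_gt0. Qed.

Let twopi_neq0 : (pi *+ 2)%:C != 0 :> C.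
Proof. by rewrite eq_complex /= eqxx andbT gt_eqF. Qed.

Lemma is_mean_exists f :
  (forall t, {for t, continuous (fun s => Re (f s))}) ->
  (forall t, {for t, continuous (fun s => Im (f s))}) -> exists m, is_mean f m.
Proof.
move=> cr ci; have [|| F dF] := @primitive_complex _ f 0 (pi *+ 2); [by move=> t _|by move=> t _|].
exists ((F (pi *+ 2) - F 0) / (pi *+ 2)%:C), F; split => //.
by rewrite mulrC divfK.
Qed.

Lemma is_mean_lin f g (a b m n : C) : is_mean f m -> is_mean g n ->
  is_mean (fun t => a * f t + b * g t) (a * m + b * n).
Proof.
move=> [F [dF EF]] [G [dG EG]]; exists (fun t => a * F t + b * G t); split.
  by move=> t tab; apply: cder_lin; [apply: dF | apply: dG].
rewrite mulrDr [_ * (a * m)]mulrCA -EF [_ * (b * n)]mulrCA -EG; ring.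
Qed.

Lemma is_mean_conj f (m : C) : is_mean f m -> is_mean (fun t => (f t)^*) m^*.
Proof.
move=> [F [dF EF]]; exists (fun t => (F t)^*); split.
  by move=> t tab; apply: cder_conj; apply: dF.
by rewrite -conjB EF conjM conj_real.
Qed.

Lemma is_mean_ext f g (m : C) : f =1 g -> is_mean f m -> is_mean g m.
Proof. by move=> /funext ->. Qed.

Lemma is_mean_cst (c : C) : is_mean (fun=> c) c.
Proof.
have d0 t : cder (fun=> 0 : C) t 0 by split; exact: is_derive_cst.
have dt t : cder (fun s => s%:C : C) t 1 by split; [exact: is_derive_id|exact: is_derive_cst].
exists (fun t => c * t%:C + 0 * 0); split => [t _|].
  by have := cder_lin c 0 (dt t) (d0 t); rewrite mul0r addr0 mulr1.
by rewrite !mul0r !addr0 mulr0 subr0 mulrC.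
Qed.

Lemma is_mean_le f (m : C) (M : R) :
  is_mean f m -> (forall t, 0 <= t <= pi *+ 2 -> nm (f t) <= M) -> nm m <= M.
Proof.
move=> [F [dF EF]] fM; have := mean_value_ineq (ltW twopi_gt0) dF fM.
by rewrite EF nmM nm_real subr0 ger0_norm ?(ltW twopi_gt0) // mulrC ler_pM2r.
Qed.

Definition cis t : C := cos t +i* sin t.

Lemma nm_cis t : nm (cis t) = 1.
Proof. by rewrite /= cos2Dsin2 sqrtr1. Qed.

Lemma nm_circle r t : 0 <= r -> nm (r%:C * cis t) = r.
Proof. by move=> r0; rewrite nmM nm_cis mulr1 nm_real ger0_norm. Qed.

Lemma cexp_polar x t : cexp (x +i* t) = (expR x)%:C * cis t.
Proof. by apply/eqP; rewrite eq_complex /= !mul0r subr0 addr0 !eqxx. Qed.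

Lemma cis_near (t0 e : R) : 0 < e -> \forall t \near t0, nm (cis t - cis t0) < e.
Proof.
move=> e0; have e20 : 0 < e / 2 by rewrite divr_gt0.
have := @continuous_cos R t0 => /cvgrPdist_lt/(_ _ e20) h1.
have := @continuous_sin R t0 => /cvgrPdist_lt/(_ _ e20) h2.
near=> t; apply: le_lt_trans (nm_le _) _.
rewrite Re_add Im_add Re_opp Im_opp /= [ltRHS]splitr distrC [X in _ + X]distrC.
by apply: ltrD; near: t.
Unshelve. all: by end_near. Qed.

Lemma continuous_circle F r t :
  cont F (r%:C * cis t) ->
  {for t, continuous (fun s => Re (F (r%:C * cis s)))} /\
  {for t, continuous (fun s => Im (F (r%:C * cis s)))}.
Proof.
move=> /ccontP H.
suff K (e : R) : 0 < e -> \forall s \near t, nm (F (r%:C * cis t) - F (r%:C * cis s)) < e.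
  split; apply/cvgrPdist_lt => e /K; apply: filterS => s; apply: le_lt_trans.
    by rewrite -Re_opp -Re_add Re_abs_le.
  by rewrite -Im_opp -Im_add Im_abs_le.
move=> /H[d d0 Hd]; have r0 : 0 < `|r| + 1 by rewrite ltr_wpDl.
near=> s; rewrite nmB; apply: Hd; rewrite -mulrBr nmM nm_real.
apply: (@le_lt_trans _ _ ((`|r| + 1) * nm (cis s - cis t))).
  by rewrite ler_wpM2r ?nm_ge0 // lerDl.
rewrite mulrC -ltr_pdivlMr //; near: s; apply: cis_near.
by rewrite divr_gt0.
Unshelve. all: by end_near. Qed.

Lemma circle_mean_exists F r :
  (forall t, cont F (r%:C * cis t)) ->
  exists m, is_mean (fun t => F (r%:C * cis t)) m.
Proof.
by move=> cF; apply: is_mean_exists => t; have [] := continuous_circle (cF t).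
Qed.

(* Goursat's theorem for F o exp on the rectangle [ln r1, ln r2] x [0, 2 pi],
   whose two horizontal sides cancel by periodicity. *)
Lemma circle_mean_annulus F r1 r2 (m1 m2 : C) : 0 < r1 -> r1 <= r2 ->
  (forall z : C, r1 <= nm z <= r2 -> holo F z) ->
  is_mean (fun t => F (r1%:C * cis t)) m1 ->
  is_mean (fun t => F (r2%:C * cis t)) m2 -> m1 = m2.
Proof.
move=> r10 r12 dF mean1 mean2; have r20 := lt_le_trans r10 r12.
pose g w := F (cexp w).
pose q0 := Rect (ln r1) (ln r2) 0 (pi *+ 2).
have ln12 : ln r1 <= ln r2 by rewrite ler_ln ?posrE.
have wf0 : wf_rect q0 by split => //=; exact: ltW.
have dg x y : ln r1 <= x <= ln r2 -> exists l, cdiff g (x +i* y) l.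
  move=> /andP[x1 x2]; apply/cdiffP; apply: (@holo_comp _ (@cexp R) F).
    by apply/cdiffP; eexists; exact: cexp_cdiff.
  apply: dF; rewrite nm_cexp /=; apply/andP; split.
    by rewrite -(lnK r10) ler_expR.
  by rewrite -(lnK r20) ler_expR.
have line (gm : R -> C) (z0 u c : C) s l : (forall t : R, z0 + t%:C * u = gm t) ->
    cdiff g (gm s) l ->
    {for s, continuous (fun t : R => Re (g (gm t) * c))} /\
    {for s, continuous (fun t : R => Im (g (gm t) * c))}.
  move=> /funext <- /cder_line h; have [h1 h2] := cder_lin c 0 h h.
  have E (t : R) : g (z0 + t%:C * u) * c = c * g (z0 + t%:C * u) + 0 * g (z0 + t%:C * u).
    by rewrite mul0r addr0 mulrC.
  split; apply: differentiable_continuous; apply/derivable1_diffP; under eq_fun do rewrite E.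
    by case: h1.
  by case: h2.
have Eh (t y : R) : (0 +i* y) + t%:C * 1 = t +i* y :> C.
  by apply/eqP; rewrite eq_complex /= !mulr0 !mul0r mulr1 subr0 !addr0 add0r !eqxx.
have Ev (t x : R) : (x +i* 0) + t%:C * 'i%C = x +i* t :> C.
  by apply/eqP; rewrite eq_complex /= !mulr0 !mul0r mulr1 subr0 !addr0 add0r !eqxx.
have [H dH] : exists H : R -> R -> C, forall y x, ln r1 <= x <= ln r2 ->
    cder (H y) x (g (x +i* y)).
  suff : forall y : R, exists h : R -> C, forall x, ln r1 <= x <= ln r2 -> cder h x (g (x +i* y)).
    by move=> /choice[h hh]; exists h.
  move=> y; have [x hx|x hx|h dh] := @primitive_complex _ (fun x => g (x +i* y) * 1) (ln r1) (ln r2).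
  - by have [l hl] := dg x y hx; have [] := line _ _ _ 1 _ _ (Eh ^~ y) hl.
  - by have [l hl] := dg x y hx; have [] := line _ _ _ 1 _ _ (Eh ^~ y) hl.
  by exists h => x hx; rewrite -[g _]mulr1; exact: dh.
have [V dV] : exists V : R -> R -> C, forall x, ln r1 <= x <= ln r2 ->
    forall y, 0 <= y <= pi *+ 2 -> cder (V x) y (g (x +i* y) * 'i%C).
  suff : forall x : R, exists h : R -> C, ln r1 <= x <= ln r2 ->
      forall y, 0 <= y <= pi *+ 2 -> cder h y (g (x +i* y) * 'i%C) by move=> /choice[h hh]; exists h.
  move=> x.
  have [hx|hx] := boolP (ln r1 <= x <= ln r2); last by exists (fun=> 0).
  have [y hy|y hy|h dh] := @primitive_complex _ (fun y => g (x +i* y) * 'i%C) 0 (pi *+ 2).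
  - by have [l hl] := dg x y hx; have [] := line _ _ _ 'i%C _ _ (Ev ^~ x) hl.
  - by have [l hl] := dg x y hx; have [] := line _ _ _ 'i%C _ _ (Ev ^~ x) hl.
  by exists h.
have := @goursat _ g q0 wf0 (fun x y hx hy => dg x y hx) H V (fun y _ => dH y) dV.
rewrite /boundary_integral /=.
have -> : H (pi *+ 2) (ln r2) - H (pi *+ 2) (ln r1) = H 0 (ln r2) - H 0 (ln r1).
  apply: (increment_unique ln12 (dH _)) => t ht.
  have -> : g (t +i* (pi *+ 2)) = g (t +i* 0).
    by rewrite /g !cexp_polar /cis cos0 sin0 cos2pi sin2pi.
  exact: dH.
have VE x r m : 0 < r -> x = ln r -> ln r1 <= x <= ln r2 ->
    is_mean (fun t => F (r%:C * cis t)) m ->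
    V x (pi *+ 2) - V x 0 = (pi *+ 2)%:C * m * 'i%C.
  move=> r0 xr hx [G [dG <-]].
  rewrite (@increment_unique (fun y => g (x +i* y) * 'i%C) _
    (fun t => 'i%C * G t + 0 * G t) 0 (pi *+ 2) (ltW twopi_gt0) (dV _ hx)); first by ring.
  move=> t ht.
  have -> : g (x +i* t) * 'i%C = 'i%C * F (r%:C * cis t) + 0 * F (r%:C * cis t).
    by rewrite mul0r addr0 mulrC /g cexp_polar xr lnK.
  by apply: cder_lin; exact: dG.
rewrite (VE (ln r1) r1 m1) ?lexx ?ln12 // (VE (ln r2) r2 m2) ?lexx ?ln12 // subrr add0r.
rewrite -mulrBl -mulrBr => /eqP; rewrite !mulf_eq0 (negbTE twopi_neq0) /=.
have -> : ('i%C == 0 :> C) = false by rewrite eq_complex /= oner_eq0 andbF.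
by rewrite orbF subr_eq0 => /eqP->.
Qed.

(** Compactness of [0, 2 pi] makes continuity along the circle uniform. This is what makes circle
    means continuous in the radius. *)
Lemma circle_uniform_near F (r e : R) : 0 <= r -> 0 < e ->
  (forall t, cont F (r%:C * cis t)) ->
  \forall s \near r, forall t, 0 <= t <= pi *+ 2 ->
    nm (F (s%:C * cis t) - F (r%:C * cis t)) <= e.
Proof.
move=> r0 e0 cF.
have := @segment_compact _ 0 (pi *+ 2 : R); rewrite compact_near_coveringP => K.
have {}K := K R (nbhs r) (fun s t => nm (F (s%:C * cis t) - F (r%:C * cis t)) <= e) _.
have FF : Filter (nbhs r) by apply: nbhs_filter.
apply: filterS (K FF _) => [s + t tI|t _]; first by apply; rewrite /= in_itv.
have e20 : 0 < e / 2 by rewrite divr_gt0.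
have [d d0 Hd] := (ccontP _ _).1 (cF t) _ e20.
have d20 : 0 < d / 2 by rewrite divr_gt0.
have r10 : 0 < r + 1 by rewrite ltr_wpDl.
have c0 : 0 < d / 2 / (r + 1) by rewrite divr_gt0.
exists ([set t' | nm (cis t' - cis t) < d / 2 / (r + 1)], [set s : R | `|r - s| < d / 2]).
  split => /=; first exact: cis_near.
  by apply/nbhs_ballP; exists (d / 2).
move=> [t' s] [/= ht' hs].
have h1 : r * nm (cis t' - cis t) < d / 2.
  rewrite ltr_pdivlMr // mulrC in ht'; apply: le_lt_trans ht'.
  by rewrite ler_wpM2r ?nm_ge0 // lerDl.
have h2 : nm (F (r%:C * cis t') - F (r%:C * cis t)) < e / 2.
  by apply: Hd; rewrite -mulrBr nmM nm_real ger0_norm // (lt_trans h1) //; lra.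
have h3 : nm (F (s%:C * cis t') - F (r%:C * cis t)) < e / 2.
  apply: Hd; rewrite [X in nm X](_ : _ =
    (s - r)%:C * cis t' + r%:C * (cis t' - cis t)); last first.
    by rewrite rmorphB /=; ring.
  apply: le_lt_trans (nmD _ _) _; rewrite [ltRHS]splitr; apply: ltrD; rewrite nmM nm_real.
    by rewrite nm_cis mulr1 distrC.
  by rewrite ger0_norm.
rewrite [X in nm X](_ : _ = (F (s%:C * cis t') - F (r%:C * cis t))
  - (F (r%:C * cis t') - F (r%:C * cis t))); last by ring.
by apply: le_trans (nmBD _ _) _; rewrite [leRHS]splitr; apply: lerD; exact: ltW.
Qed.

End CircleMean.

(** * Mean value property and removable singularities *)

Section RemovableSingularity.
Variable R : realType.
Local Notation C := R[i].
Implicit Types (F G : C -> C) (z w a : C).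

Lemma cont_near_eq F G z (d : R) : 0 < d ->
  (forall w, nm (w - z) < d -> F w = G w) -> cont F z -> cont G z.
Proof.
move=> d0 FG /ccontP cF; apply/ccontP => e /cF[d' d'0 Hd].
exists (Num.min d d'); first by rewrite lt_min d0.
move=> w; rewrite lt_min => /andP[h1 h2].
by rewrite -!FG ?subrr ?nm0 //; apply: Hd.
Qed.

Lemma holo_near_eq F G z (d : R) : 0 < d ->
  (forall w, nm (w - z) < d -> F w = G w) -> holo F z -> holo G z.
Proof.
move=> d0 FG /cdiffP[l cF]; apply/cdiffP; exists l => e /cF[d' d'0 Hd].
exists (Num.min d d'); first by rewrite lt_min d0.
move=> w; rewrite lt_min => /andP[h1 h2].
by rewrite -!FG ?subrr ?nm0 //; apply: Hd.
Qed.

Definition diff_quot F w (l : C) z := if z == w then l else (F z - F w) / (z - w).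

Lemma diff_quot_cont_at F w l : cdiff F w l -> cont (diff_quot F w l) w.
Proof.
move=> dF; apply/ccontP => e e0; have e20 : 0 < e / 2 by rewrite divr_gt0.
have [d d0 Hd] := dF _ e20; exists d => // z zd.
rewrite /diff_quot eqxx; have [_|zw] := eqVneq z w; first by rewrite subrr nm0.
have zw0 : z - w != 0 by rewrite subr_eq0.
have n0 : 0 < nm (z - w) by rewrite nm_gt0.
rewrite -(ltr_pM2r n0) -nmM mulrBl divfK //; apply: le_lt_trans (Hd z zd) _.
by rewrite ltr_pM2r //; lra.
Qed.

Lemma diff_quot_near F w l z : z != w ->
  forall z', nm (z' - z) < nm (z - w) -> (F z' - F w) / (z' - w) = diff_quot F w l z'.
Proof.
move=> zw z' hz'; rewrite /diff_quot; have [E|//] := eqVneq z' w.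
by rewrite E nmB ltxx in hz'.
Qed.

Lemma diff_quot_cont F w l z : z != w -> cont F z -> cont (diff_quot F w l) z.
Proof.
move=> zw cF; have zw0 : z - w != 0 by rewrite subr_eq0.
apply: (@cont_near_eq (fun z' => (F z' - F w) / (z' - w)) _ z _ _ (@diff_quot_near F w l z zw)).
  by rewrite nm_gt0.
apply: contM; first by apply: contB => //; apply/holo_cont/holo_cst.
by apply: contV; [apply/holo_cont; exact: holoB (holo_id _) (holo_cst _ _)|exact: zw0].
Qed.

Lemma diff_quot_holo F w l z : z != w -> holo F z -> holo (diff_quot F w l) z.
Proof.
move=> zw cF; have zw0 : z - w != 0 by rewrite subr_eq0.
apply: (@holo_near_eq (fun z' => (F z' - F w) / (z' - w)) _ z _ _ (@diff_quot_near F w l z zw)).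
  by rewrite nm_gt0.
apply: holoM; first by apply: holoB cF (holo_cst _ _).
by apply: holoV; [exact: holoB (holo_id _) (holo_cst _ _)|exact: zw0].
Qed.

Lemma le_eps_eq0 z : (forall e : R, 0 < e -> nm z <= e) -> z = 0.
Proof.
move=> H; apply/eqP; rewrite -nm0_eq0 eq_le nm_ge0 andbT leNgt; apply/negP => z0.
have := H (nm z / 2); rewrite divr_gt0 // => /(_ isT); lra.
Qed.

Lemma is_mean_sub (f g : R -> C) (m n : C) : is_mean f m -> is_mean g n ->
  is_mean (fun t => f t - g t) (m - n).
Proof.
move=> hf hg; have := is_mean_lin 1 (-1) hf hg; rewrite mul1r mulN1r.
by apply: is_mean_ext => t; rewrite mul1r mulN1r.
Qed.

(* The mean over |z| = r does not see the exceptional circle |z| = rho, since it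
   depends continuously on r. *)
Lemma circle_mean F (rho r : R) :
  (forall z, nm z < 1 -> cont F z) ->
  (forall z, 0 < nm z < 1 -> nm z != rho -> holo F z) ->
  0 < r < 1 -> is_mean (fun t => F (r%:C * cis t)) (F 0).
Proof.
move=> cF hF r01.
have : forall s : R, exists m, 0 < s < 1 -> is_mean (fun t => F (s%:C * cis t)) m.
  move=> s; have [s01|s01] := boolP (0 < s < 1); last by exists 0.
  have [|m hm] := @circle_mean_exists _ F s; last by exists m.
  by move=> t; apply: cF; rewrite nm_circle; case/andP: s01 => // /ltW.
move=> /choice[m hm].
have cst r1 r2 : 0 < r1 -> r1 <= r2 -> r2 < 1 ->
    (forall s, r1 <= s <= r2 -> s != rho) -> m r1 = m r2.
  move=> h1 h2 h3 h4; have h5 := le_lt_trans h2 h3; have h6 := lt_le_trans h1 h2.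
  apply: (@circle_mean_annulus _ F r1 r2) => //; [|by apply: hm; rewrite h1|by apply: hm; rewrite h6].
  move=> z zr; have /andP[z1 z2] := zr; apply: hF; last exact: h4.
  by rewrite (lt_le_trans h1 z1) (le_lt_trans z2 h3).
have near0 (e : R) : 0 < e -> exists2 d, 0 < d & forall s, 0 < s < 1 -> s < d -> nm (m s - F 0) <= e.
  move=> e0; have c0 : cont F 0 by apply: cF; rewrite nm0.
  have [d d0 Hd] := (ccontP _ _).1 c0 e e0; exists d => // s s01 sd.
  apply: is_mean_le (is_mean_sub (hm s s01) (is_mean_cst (F 0))) _ => t _.
  by apply/ltW/Hd; rewrite subr0 nm_circle //; case/andP: s01 => /ltW.
have nearr (s e : R) : 0 < s < 1 -> 0 < e ->
    exists2 d, 0 < d & forall s', 0 < s' < 1 -> `|s - s'| < d -> nm (m s' - m s) <= e.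
  move=> s01 e0; have /andP[s0 s1] := s01.
  have := @circle_uniform_near _ F s e (ltW s0) e0 => /(_ _).
  have K t : cont F (s%:C * cis t) by apply: cF; rewrite nm_circle // ltW.
  move=> /(_ K)/nbhs_ballP[d /= d0 Hd]; exists d => // s' s'01 ss'.
  apply: is_mean_le (is_mean_sub (hm s' s'01) (hm s s01)) _ => t ht.
  exact: Hd.
have small s : 0 < s < 1 -> s < rho \/ rho <= 0 -> m s = F 0.
  move=> /andP[s0 s1] hs; apply/subr0_eq/le_eps_eq0 => e /near0[d d0 Hd].
  pose s' := Num.min s (d / 2).
  have s'0 : 0 < s' by rewrite lt_min s0 divr_gt0.
  have s's : s' <= s by rewrite ge_min lexx.
  rewrite -(cst s' s) //; last first.
    move=> x /andP[x1 x2]; case: hs => [hs|hs]; first by rewrite lt_eqF // (le_lt_trans x2).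
    by rewrite gt_eqF // (le_lt_trans hs) // (lt_le_trans s'0).
  apply: Hd; first by rewrite s'0 (le_lt_trans s's).
  by apply: (@le_lt_trans _ _ (d / 2)); [rewrite ge_min lexx orbT|lra].
have /andP[r0 r1] := r01.
suff <- : m r = F 0 by apply: hm.
have [/orP hs|] := boolP ((r < rho) || (rho <= 0)); first exact: small.
rewrite negb_or -leNgt -ltNge => /andP[rr r'0].
have rho01 : 0 < rho < 1 by rewrite r'0 (le_lt_trans rr).
have mrho : m rho = F 0.
  apply/subr0_eq/le_eps_eq0 => e e0; have [d d0 Hd] := nearr _ _ rho01 e0.
  pose s := Num.max (rho / 2) (rho - d / 2).
  have s1 : s < rho by rewrite gt_max; apply/andP; split; lra.
  have s0 : 0 < s by rewrite lt_max divr_gt0.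
  have s01 : 0 < s < 1 by rewrite s0 (lt_le_trans s1) // ltW //; case/andP: rho01.
  rewrite -(small s s01); last by left.
  rewrite nmB; apply: Hd => //; rewrite gtr0_norm ?subr_gt0 //.
  have : rho - d / 2 <= s by rewrite le_max lexx orbT.
  lra.
have [->//|rrho] := eqVneq r rho.
have rgt : rho < r by rewrite lt_neqAle eq_sym rrho.
apply/subr0_eq/le_eps_eq0 => e e0; have [d d0 Hd] := nearr _ _ rho01 e0.
pose s := Num.min r (rho + d / 2).
have s1 : rho < s by rewrite lt_min rgt /=; lra.
have sr : s <= r by rewrite ge_min lexx.
rewrite -(cst s r) // ?(lt_trans r'0) //; last first.
  by move=> x /andP[x1 x2]; rewrite gt_eqF // (lt_le_trans s1).
rewrite -mrho; apply: Hd; first by rewrite (lt_trans r'0) //= (le_lt_trans sr).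
rewrite distrC gtr0_norm ?subr_gt0 //.
have : s <= rho + d / 2 by rewrite ge_min lexx orbT.
lra.
Qed.

Lemma circle_bounded F (r : R) : (forall t, cont F (r%:C * cis t)) ->
  exists M, forall t, 0 <= t <= pi *+ 2 -> nm (F (r%:C * cis t)) <= M.
Proof.
move=> cF; pose h t := Re (F (r%:C * cis t)) ^+ 2 + Im (F (r%:C * cis t)) ^+ 2.
have ch : continuous h.
  move=> t; have [h1 h2] := continuous_circle (cF t).
  exact: continuousD (continuousM h1 h1) (continuousM h2 h2).
have pi0 : 0 <= pi *+ 2 :> R by rewrite mulrn_wge0 // pi_ge0.
have [c _ Hc] := EVT_max pi0 (continuous_subspaceT ch).
exists (nm (F (r%:C * cis c))) => t ht.
rewrite -(ler_pXn2r (n := 2)) ?nnegrE ?nm_ge0 // !nm_sqr; apply: Hc.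
by rewrite in_itv.
Qed.

(* By the Cauchy formula, F(w) - F(0) is the mean of F(z) w / (z - w) over a
   circle |z| = r, so the derivative at 0 is the mean of F(z) / z. *)
Lemma removable0 F : (forall z, nm z < 1 -> cont F z) ->
  (forall z, 0 < nm z < 1 -> holo F z) -> holo F 0.
Proof.
move=> cF hF; pose r : R := 1 / 2.
have r0 : 0 < r by rewrite /r; lra.
have r01 : 0 < r < 1 by rewrite r0 /r; lra.
have nmc t : nm (r%:C * cis t) = r by rewrite nm_circle // ltW.
have cFc t : cont F (r%:C * cis t) by apply: cF; rewrite nmc; case/andP: r01.
have zN0 t : r%:C * cis t != 0 :> C by rewrite -nm_gt0 nmc.
have [M HM] := circle_bounded cFc.
have M0 : 0 <= M.
  by apply: le_trans (nm_ge0 _) (HM 0 _); rewrite lexx mulrn_wge0 // pi_ge0.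
have [c hc] : exists c, is_mean (fun t => F (r%:C * cis t) / (r%:C * cis t)) c.
  apply: (@circle_mean_exists _ (fun z => F z / z)) => t; apply: contM => //.
  by apply: contV => //; apply/holo_cont/holo_id.
have mF := circle_mean (rho := 2) cF (fun z hz _ => hF z hz) r01.
have key w : 0 < nm w < 1 / 4 -> nm (F w - F 0 - c * (w - 0)) <= 8 * M * nm w ^+ 2.
  move=> /andP[w0 w4]; have wr : nm w < r by rewrite /r; lra.
  have zw t : r%:C * cis t != w.
    by apply/eqP => E; move: wr; rewrite -E nmc ltxx.
  have zw0 t : r%:C * cis t - w != 0 by rewrite subr_eq0.
  have [l hl] : exists l, cdiff F w l by apply/cdiffP; apply: hF; rewrite w0; lra.
  (* At w this function is only known to be continuous, which is why [circle_mean] allows an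
     exceptional circle, here |z| = |w|. *)
  pose G z := diff_quot F w l z * z.
  have m1 : is_mean (fun t => G (r%:C * cis t)) 0.
    have -> : 0 = G 0 by rewrite /G mulr0.
    apply: (@circle_mean G (nm w)) => // z.
      move=> z1; apply: contM; last by apply/holo_cont/holo_id.
      have [->|zw1] := eqVneq z w; first exact: diff_quot_cont_at.
      by apply: diff_quot_cont => //; apply: cF.
    move=> z1 zw1; apply: holoM; last exact: holo_id.
    by apply: diff_quot_holo; [apply: contra_neq zw1 => ->|apply: hF].
  (* On |z| = r one has conj z = r^2 / z, so w / (z - w) is the conjugate of the holomorphic
     function [K], which vanishes at 0. *)
  have m2 : is_mean (fun t => w / (r%:C * cis t - w)) 0.
    pose K z := w^* * z / ((r ^+ 2)%:C - w^* * z).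
    have hK z : nm z < 1 -> holo K z.
      move=> z1; apply: holoM; first by apply: holoM; [exact: holo_cst|exact: holo_id].
      apply: holoV.
        exact: holoB (holo_cst _ _) (holoM (holo_cst _ _) (holo_id _)).
      rewrite subr_eq0; apply/eqP => E.
      have : nm (r ^+ 2)%:C < 1 / 4.
        rewrite E nmM nmJ; apply: le_lt_trans w4; rewrite ler_piMr ?nm_ge0 //; exact: ltW.
      by rewrite nm_real ger0_norm ?sqr_ge0 // /r; lra.
    have K0 : K 0 = 0 by rewrite /K mulr0 mul0r.
    have cK z : nm z < 1 -> cont K z by move=> z1; apply/holo_cont/hK.
    have hK' z : 0 < nm z < 1 -> nm z != 2 -> holo K z by move=> /andP[_ z1] _; exact: hK.
    have := is_mean_conj (circle_mean cK hK' r01); rewrite K0 rmorph0.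
    apply: is_mean_ext => t.
    rewrite /K; set z := r%:C * cis t.
    have zz : (r ^+ 2)%:C = z * z^* by rewrite mulcJ nmc.
    have zwc : z^* - w^* != 0 by rewrite -rmorphB conj_eq0 zw0.
    have zn0 : z != 0 by exact: zN0.
    clearbody z; rewrite zz (_ : _ / _ = (w / (z - w))^*) ?conj_K //.
    rewrite conjM conjV conjB; field.
    by rewrite zwc [z * _]mulrC -mulrBl mulf_neq0.
  have m3 := is_mean_lin 1 (F w) (is_mean_lin 1 (F w) m1 m2) (is_mean_cst 1).
  have m4 := is_mean_lin 1 (- w) (is_mean_sub m3 mF) hc.
  have := is_mean_le (M := 8 * M * nm w ^+ 2) m4.
  rewrite !mulr0 addr0 mulr0 add0r mulr1 mul1r subr0 mulNr [w * c]mulrC; apply => t ht.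
  rewrite /G /diff_quot (negbTE (zw t)).
  have zn0 := zN0 t; have zw0' := zw0 t; have hM := HM t ht; have nz := nmc t.
  set z := r%:C * cis t in zn0 zw0' hM nz *; clearbody z.
  (* The constant 8 comes from |z| = 1/2 and |z - w| >= 1/4. *)
  rewrite (_ : _ + _ = F z * (w ^+ 2 / (z * (z - w)))); last first.
    by field; rewrite zn0 zw0'.
  have hzw := nm_sub_ge z w; rewrite nz in hzw.
  have p0 : 0 < nm (z - w) by rewrite nm_gt0.
  rewrite nmM nm_div nmX nmM nz (_ : 8 * M * nm w ^+ 2 = M * (nm w ^+ 2 * 8)); last by ring.
  apply: ler_pM; rewrite ?nm_ge0 ?divr_ge0 ?exprn_ge0 ?nm_ge0 //.
    by rewrite mulr_ge0 // ltW.
  rewrite ler_wpM2l ?exprn_ge0 ?nm_ge0 // -[8]invrK lef_pV2 ?posrE ?invr_gt0 ?mulr_gt0 //.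
  rewrite /r in hzw *; lra.
apply/cdiffP; exists c => e e0.
have M80 : 0 < 8 * M + 1 by rewrite ltr_wpDl // mulr_ge0.
exists (Num.min (1 / 4) (e / (8 * M + 1))); first by rewrite lt_min divr_gt0 //= divr_gt0.
move=> w; rewrite subr0 lt_min => /andP[h1 h2].
have [->|w0] := eqVneq w 0; first by rewrite !subrr mulr0 subr0 nm0 mulr0.
have wp : 0 < nm w by rewrite nm_gt0.
have := key w; rewrite wp h1 => /(_ isT); rewrite subr0 => /le_trans; apply.
rewrite expr2 mulrA ler_wpM2r ?nm_ge0 // mulrC.
rewrite ltr_pdivlMr // in h2; apply: le_trans _ (ltW h2).
by rewrite ler_wpM2l ?nm_ge0 // lerDl.
Qed.

End RemovableSingularity.

(** * Moebius maps, maximum principle, Schwarz's lemma and Harnack's inequality *)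

Section Moebius.
Variable R : realType.
Local Notation C := R[i].
Implicit Types (F G : C -> C) (z w a : C).

Definition mob a z : C := (z - a) / (1 - a^* * z).

Lemma mob_den_gt a z : nm z < 1 -> 1 - nm a <= nm (1 - a^* * z).
Proof.
move=> z1; apply: le_trans (nm_sub_ge _ _); rewrite nm1 nmM nmJ.
by rewrite lerD2l lerN2 ler_piMr ?nm_ge0 // ltW.
Qed.

Lemma mob_den a z : nm a < 1 -> nm z < 1 -> 1 - a^* * z != 0.
Proof.
move=> a1 z1; rewrite -nm_gt0; apply: lt_le_trans (mob_den_gt a z1).
by rewrite subr_gt0.
Qed.

Lemma mob_den_sqr a z : nm (1 - a^* * z) ^+ 2 - nm (z - a) ^+ 2
  = (1 - nm a ^+ 2) * (1 - nm z ^+ 2).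
Proof.
apply: complexI; rewrite realCM !realCB.
rewrite -[(nm (_ - _) ^+ 2)%:C]mulcJ -[(nm (z - a) ^+ 2)%:C]mulcJ.
rewrite -[(nm a ^+ 2)%:C]mulcJ -[(nm z ^+ 2)%:C]mulcJ.
rewrite ![(_ - _)^*]conjB conjM conj_K conj1.
rewrite -[1%:C]/(1 : C); ring.
Qed.

Lemma mob_sqr a z : nm a < 1 -> nm z < 1 ->
  1 - nm (mob a z) ^+ 2 = (1 - nm a ^+ 2) * (1 - nm z ^+ 2) / nm (1 - a^* * z) ^+ 2.
Proof.
move=> a1 z1; rewrite -mob_den_sqr /mob nm_div expr_div_n mulrBl mulfV //.
by rewrite expf_neq0 // nm0_eq0 mob_den.
Qed.

Lemma mob_lt1 a z : nm a < 1 -> nm z < 1 -> nm (mob a z) < 1.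
Proof.
move=> a1 z1; rewrite -(ltr_pXn2r (n := 2)) ?nnegrE ?nm_ge0 // expr1n.
rewrite -subr_gt0 mob_sqr // divr_gt0 ?exprn_gt0 ?nm_gt0 ?mob_den //.
by rewrite mulr_gt0 // subr_gt0 expr_lt1 ?nm_ge0.
Qed.

Lemma mobaa a : mob a a = 0.
Proof. by rewrite /mob subrr mul0r. Qed.

Lemma moba0 a : mob a 0 = - a.
Proof. by rewrite /mob mulr0 subr0 divr1 sub0r. Qed.

Lemma mob0z z : mob 0 z = z.
Proof. by rewrite /mob rmorph0 mul0r !subr0 divr1. Qed.

Lemma mobK a z : nm a < 1 -> nm z < 1 -> mob (- a) (mob a z) = z.
Proof.
move=> a1 z1; have d0 := mob_den a1 z1.
have aa : 1 - a^* * a != 0 by exact: mob_den.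
have dE : 1 - (- a)^* * mob a z = (1 - a^* * a) / (1 - a^* * z).
  by rewrite /mob rmorphN; field.
have nE : mob a z - - a = z * (1 - a^* * a) / (1 - a^* * z) by rewrite /mob; field.
by rewrite {1}/mob dE nE; field; rewrite aa d0.
Qed.

Lemma mobKV a z : nm a < 1 -> nm z < 1 -> mob a (mob (- a) z) = z.
Proof. by move=> a1 z1; rewrite -{1}[a]opprK mobK // nmN. Qed.

Lemma mob_holo a z : nm a < 1 -> nm z < 1 -> holo (mob a) z.
Proof.
move=> a1 z1; apply: holoM; first exact: holoB (holo_id _) (holo_cst _ _).
apply: holoV; last exact: mob_den.
by apply: holoB (holo_cst _ _) _; apply: holoM (holo_cst _ _) (holo_id _).
Qed.

Lemma mob_eq0 a z : nm a < 1 -> nm z < 1 -> (mob a z == 0) = (z == a).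
Proof.
by move=> a1 z1; rewrite mulf_eq0 invr_eq0 (negbTE (mob_den a1 z1)) orbF subr_eq0.
Qed.

Lemma mob_near1 a (e : R) : nm a < 1 -> 0 < e ->
  exists2 r : R, 0 <= r < 1 & forall z, r < nm z < 1 -> 1 - e < nm (mob a z).
Proof.
move=> a1 e0; have p0 : 0 < 1 - nm a by rewrite subr_gt0.
(* Chosen so that 1 - |z|^2 < 2 d forces (1 - |z|^2) / (1 - |a|)^2 < e, and by [mob_sqr] this
   quotient bounds 1 - |mob a z|^2. *)
pose d := e * (1 - nm a) ^+ 2 / 2.
have d0 : 0 < d by rewrite divr_gt0 // mulr_gt0 // exprn_gt0.
exists (Num.max 0 (1 - d)); first by rewrite le_max lexx gt_max ltr01 /= gtrBl.
move=> z; rewrite gt_max -andbA => /and3P[z0 zd z1].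
have f1 := mob_lt1 a1 z1; have f0 := nm_ge0 (mob a z).
have h : 1 - nm (mob a z) ^+ 2 <= (1 - nm z ^+ 2) / (1 - nm a) ^+ 2.
  rewrite mob_sqr //; apply: ler_pM => //.
  - by rewrite mulr_ge0 // subr_ge0 expr_le1 ?nm_ge0 // ltW.
  - by rewrite invr_ge0 sqr_ge0.
  - rewrite ler_piMl ?subr_ge0 ?expr_le1 ?nm_ge0 ?(ltW z1) //.
    by rewrite gerBl sqr_ge0.
  rewrite lef_pV2 ?posrE ?exprn_gt0 ?nm_gt0 ?mob_den //.
  by rewrite ler_pXn2r ?nnegrE ?nm_ge0 ?(ltW p0) // mob_den_gt.
have h2 : 1 - nm z ^+ 2 < 2 * d.
  have : (1 - nm z) * (1 + nm z) < d * 2 by apply: ltr_pM; lra.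
  lra.
have h3 : (1 - nm z ^+ 2) / (1 - nm a) ^+ 2 < e.
  by rewrite ltr_pdivrMr ?exprn_gt0 //; rewrite /d in h2; lra.
have : nm (mob a z) ^+ 2 <= nm (mob a z) by rewrite expr2 ler_piMr // ltW.
lra.
Qed.

(** Here z is fixed and the bound is uniform in [a]: each zero of a function in |a| <= r costs a
    factor c < 1 in its modulus at z, which limits the number of zeros. *)
Lemma mob_away1 (r : R) z : r < 1 -> nm z < 1 ->
  exists2 c : R, 0 <= c < 1 & forall a, nm a <= r -> nm (mob a z) <= c.
Proof.
move=> r1 z1; have [r0|r0] := ltP r 0.
  by exists 0; [rewrite lexx ltr01|move=> a ar; have := nm_ge0 a; rewrite leNgt (le_lt_trans ar)].
(* Since |1 - conj a z| <= 2, [mob_sqr] gives |mob a z|^2 <= 1 - d, and 1 - d <= (1 - d/2)^2. *)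
pose d := (1 - r ^+ 2) * (1 - nm z ^+ 2) / 4.
have z2 : 0 < 1 - nm z ^+ 2 by rewrite subr_gt0 expr_lt1 ?nm_ge0.
have r2 : 0 < 1 - r ^+ 2 by rewrite subr_gt0 expr_lt1.
have d0 : 0 < d by rewrite divr_gt0 // mulr_gt0.
have r2' := sqr_ge0 r; have z2' := sqr_ge0 (nm z).
have d1 : d <= 1.
  have : (1 - r ^+ 2) * (1 - nm z ^+ 2) <= 1 * 1 by apply: ler_pM; lra.
  rewrite /d; lra.
exists (1 - d / 2) => [|a ar]; first by apply/andP; split; lra.
have a1 := le_lt_trans ar r1.
have a2 : nm a ^+ 2 <= r ^+ 2 by rewrite ler_pXn2r ?nnegrE ?nm_ge0.
have d2 : nm (1 - a^* * z) ^+ 2 <= 4.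
  rewrite (_ : 4 = 2 ^+ 2); last by ring.
  rewrite ler_pXn2r ?nnegrE ?nm_ge0 //.
  apply: le_trans (nmBD _ _) _; rewrite nm1 nmM nmJ.
  have : nm a * nm z <= 1 * 1 by apply: ler_pM; rewrite ?nm_ge0 // ltW.
  lra.
have : d <= 1 - nm (mob a z) ^+ 2.
  rewrite mob_sqr // /d; apply: ler_pM; rewrite ?invr_ge0 //.
  - by rewrite mulr_ge0 // ltW.
  - by apply: ler_pM; lra.
  by rewrite lef_pV2 ?posrE ?exprn_gt0 ?nm_gt0 ?mob_den.
move=> h; rewrite -(ler_pXn2r (n := 2)) ?nnegrE ?nm_ge0 //; last by lra.
have : 0 <= (d / 2) ^+ 2 := sqr_ge0 _.
have -> : (1 - d / 2) ^+ 2 = 1 - d + (d / 2) ^+ 2 by field.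
lra.
Qed.

(** A Moebius map of the disc moves the point [a] to 0, where [removable0] applies. *)
Lemma removable F a : nm a < 1 -> (forall z, nm z < 1 -> cont F z) ->
  (forall z, nm z < 1 -> z != a -> holo F z) -> holo F a.
Proof.
move=> a1 cF hF; have na1 : nm (- a) < 1 by rewrite nmN.
have E0 : mob (- a) 0 = a by rewrite moba0 opprK.
have h0 : holo (fun z => F (mob (- a) z)) 0.
  apply: removable0 => z.
    move=> z1; apply: cont_comp; first exact/holo_cont/mob_holo.
    exact/cF/mob_lt1.
  move=> /andP[z0 z1]; apply: holo_comp; first exact: mob_holo.
  apply: hF; first exact: mob_lt1.
  apply: contraTneq z0 => E; rewrite -(mobKV a1 z1) E mobaa nm0 ltxx //.
apply: (@holo_near_eq _ (fun z => F (mob (- a) (mob a z))) F a (1 - nm a)).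
- by rewrite subr_gt0.
- move=> w wa; rewrite mobK //.
  have := nm_sub_ge w a; lra.
apply: (@holo_comp _ (mob a) (fun z => F (mob (- a) z))); first exact: mob_holo.
by rewrite mobaa.
Qed.

Lemma inv_le_near1 (e : R) : 0 < e ->
  exists2 d : R, 0 < d < 1 & forall x, 1 - d < x -> x^-1 <= 1 + e.
Proof.
move=> e0; have e1 : 0 < 1 + e by rewrite addr_gt0.
have de : e / (1 + e) < 1 by rewrite ltr_pdivrMr // mul1r ltrDr.
exists (e / (1 + e)) => [|x]; first by rewrite de divr_gt0.
have -> : 1 - e / (1 + e) = (1 + e)^-1 by field; rewrite gt_eqF.
move=> hx; have x0 : 0 < x by apply: lt_trans hx; rewrite invr_gt0.
by rewrite -[leRHS]invrK lef_pV2 ?posrE ?invr_gt0 // ltW.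
Qed.

Definition disc_holo F := forall z, nm z < 1 -> holo F z.

(** Boundary behaviour is stated on an annulus inside the disc, since the functions need not extend
    to the circle. *)
Definition near_circle (P : C -> Prop) :=
  exists2 r : R, 0 <= r < 1 & forall z, r < nm z < 1 -> P z.

Lemma near_circle_and (P Q : C -> Prop) :
  near_circle P -> near_circle Q -> near_circle (fun z => P z /\ Q z).
Proof.
move=> [r /andP[r0 r1] Hr] [s /andP[s0 s1] Hs].
exists (Num.max r s); first by rewrite le_max r0 gt_max r1.
by move=> z; rewrite gt_max -andbA => /and3P[h1 h2 h3]; split; [apply: Hr|apply: Hs]; rewrite ?h1 ?h2.
Qed.

Lemma near_circle_mono (P Q : C -> Prop) : (forall z, nm z < 1 -> P z -> Q z) ->
  near_circle P -> near_circle Q.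
Proof.
by move=> PQ [r r01 H]; exists r => // z hz; have /andP[_ z1] := hz; apply: PQ => //; apply: H.
Qed.

(** F(a) is the mean of F composed with [mob (- a)] over |z| = t, and t is so close to 1 that this
    circle is mapped into the annulus where |F| <= B + e. *)
Lemma max_disc F (B : R) : disc_holo F ->
  (forall e : R, 0 < e -> near_circle (fun z => nm (F z) <= B + e)) ->
  forall z, nm z < 1 -> nm (F z) <= B.
Proof.
move=> hF hB a a1; rewrite leNgt; apply/negP => FB.
pose e := (nm (F a) - B) / 2.
have e0 : 0 < e by rewrite divr_gt0 // subr_gt0.
have [r /andP[r0 r1] Hr] := hB _ e0.
have na1 : nm (- a) < 1 by rewrite nmN.
have r10 : 0 < 1 - r by rewrite subr_gt0.
have [s /andP[s0 s1] Hs] := mob_near1 na1 r10.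
pose t := (s + 1) / 2.
have t01 : 0 < t < 1 by rewrite /t; apply/andP; split; lra.
have hK z : nm z < 1 -> holo (fun z => F (mob (- a) z)) z.
  by move=> z1; apply: holo_comp; [exact: mob_holo|apply: hF; exact: mob_lt1].
have cK z : nm z < 1 -> cont (fun z => F (mob (- a) z)) z by move=> /hK/holo_cont.
have hK' z : 0 < nm z < 1 -> nm z != 2 -> holo (fun z => F (mob (- a) z)) z.
  by move=> /andP[_ z1] _; exact: hK.
have := circle_mean cK hK' t01; rewrite moba0 opprK => hm.
have : nm (F a) <= B + e.
  apply: is_mean_le hm _ => u _.
  have nt : nm (t%:C * cis u) = t by rewrite nm_circle //; case/andP: t01 => /ltW.
  have t1 : t < 1 by case/andP: t01.
  apply: Hr; rewrite mob_lt1 ?nt // andbT.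
  by have := Hs (t%:C * cis u); rewrite nt t1 andbT subKr; apply; rewrite /t; lra.
rewrite /e; lra.
Qed.

Lemma small_boundary_eq0 F : disc_holo F ->
  (forall e : R, 0 < e -> near_circle (fun z => nm (F z) <= e)) ->
  forall z, nm z < 1 -> F z = 0.
Proof.
move=> hF h z z1; apply/eqP; rewrite -nm0_eq0 eq_le nm_ge0 andbT.
apply: (@max_disc F 0) => // e e0.
by apply: near_circle_mono (h e e0) => ?; rewrite add0r.
Qed.

(** The difference quotient at [a] is continuous there, hence holomorphic by [removable]; the factor
    1 - conj a z turns z - a into [mob a z]. *)
Lemma divide_zero G a : nm a < 1 -> disc_holo G -> G a = 0 ->
  exists2 H, disc_holo H & forall z, nm z < 1 -> G z = mob a z * H z.
Proof.
move=> a1 hG Ga; have [l hl] := (cdiffP _ _).1 (hG a a1).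
pose H z := diff_quot G a l z * (1 - a^* * z).
have hden z : holo (fun z => 1 - a^* * z) z.
  by apply: holoB (holo_cst _ _) _; apply: holoM (holo_cst _ _) (holo_id _).
have hHa z : nm z < 1 -> z != a -> holo H z.
  by move=> z1 za; apply: holoM (hden z); apply: diff_quot_holo => //; apply: hG.
exists H => z z1.
  have [->|] := eqVneq z a; last exact: hHa.
  apply: removable => // w w1; have [->|wa] := eqVneq w a; last exact/holo_cont/hHa.
  by apply: contM; [exact: diff_quot_cont_at|exact/holo_cont/hden].
rewrite /H /diff_quot /mob; have [->|za] := eqVneq z a; first by rewrite Ga subrr !mul0r.
have d0 := mob_den a1 z1; have za0 : z - a != 0 by rewrite subr_eq0.
by rewrite Ga subr0; field; rewrite za0 d0.
Qed.

(** |mob a z| tends to 1 at the circle, so the quotient is at most 1 + e there for every e > 0, and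
    the maximum principle applies. *)
Lemma schwarz_divide G a : nm a < 1 -> disc_holo G ->
  (forall z, nm z < 1 -> nm (G z) <= 1) -> G a = 0 ->
  exists H, [/\ disc_holo H, forall z, nm z < 1 -> nm (H z) <= 1 &
    forall z, nm z < 1 -> G z = mob a z * H z].
Proof.
move=> a1 hG G1 Ga; have [H hH GH] := divide_zero a1 hG Ga.
exists H; split => //; apply: max_disc => // e e0.
have [d /andP[d0 d1] Hd] := inv_le_near1 e0.
have [r r01 Hr] := mob_near1 a1 d0; exists r => // z zr; have /andP[_ z1] := zr.
have m0 : 0 < nm (mob a z) by apply: lt_trans (Hr z zr); rewrite subr_gt0.
have := G1 z z1; rewrite GH // nmM mulrC -ler_pdivlMr // div1r => /le_trans; apply.
exact/Hd/Hr.
Qed.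

Lemma schwarz_pick G a : nm a < 1 -> disc_holo G ->
  (forall z, nm z < 1 -> nm (G z) <= 1) -> G a = 0 ->
  forall z, nm z < 1 -> nm (G z) <= nm (mob a z).
Proof.
move=> a1 hG G1 Ga z z1; have [H [_ H1 ->]] := schwarz_divide a1 hG G1 Ga => //.
by rewrite nmM ler_piMr ?nm_ge0 // H1.
Qed.

(** With a = G(0) and w = G(z), the Schwarz-Pick bound for [mob a] composed with G reads |w - a| <=
    |z| |1 - conj a w|. The triangle inequality then compares 1 - w with 1 - a. *)
Lemma harnack G : disc_holo G -> (forall z, nm z < 1 -> nm (G z) < 1) ->
  forall z, nm z < 1 ->
  (1 - nm z) * nm (1 - G z) <= (1 + nm z) * nm (1 - G 0).
Proof.
move=> hG G1 z z1; set a := G 0; set w := G z.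
have n01 : nm (0 : C) < 1 by rewrite nm0.
have a1 : nm a < 1 by exact: G1.
have w1 : nm w < 1 by exact: G1.
have hmG : disc_holo (fun z => mob a (G z)).
  by move=> u u1; apply: holo_comp; [exact: hG|apply: mob_holo => //; exact: G1].
have hm1 u : nm u < 1 -> nm (mob a (G u)) <= 1.
  by move=> u1; apply/ltW/mob_lt1 => //; exact: G1.
have := schwarz_pick n01 hmG hm1 (mobaa a) z1.
rewrite mob0z -/w /mob nm_div ler_pdivrMr ?nm_gt0 ?mob_den // => h.
have h1 : nm (1 - a^* * w) <= nm (1 - a) + nm (1 - w).
  rewrite (_ : 1 - a^* * w = (1 - a)^* + a^* * (1 - w)); last first.
    by rewrite conjB conj1; ring.
  apply: le_trans (nmD _ _) _; rewrite nmJ lerD2l nmM nmJ.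
  by rewrite ler_piMl ?nm_ge0 // ltW.
have h2 : nm (1 - w) <= nm (1 - a) + nm (w - a).
  by rewrite (_ : 1 - w = (1 - a) - (w - a)); [exact: nmBD|ring].
have h3 : nm z * nm (1 - a^* * w) <= nm z * (nm (1 - a) + nm (1 - w)).
  by rewrite ler_wpM2l ?nm_ge0.
lra.
Qed.

End Moebius.

(** * Zeros, Blaschke products and automorphisms of the disc *)

Section Zeros.
Variable R : realType.
Local Notation C := R[i].
Implicit Types (F G H B : C -> C) (z w a : C).

Lemma geometric_small (c x : R) : 0 <= c < 1 -> 0 < x -> exists n, c ^+ n < x.
Proof.
move=> /andP[c0 c1] x0; have := @cvg_expr R c; rewrite ger0_norm // => /(_ c1).
move=> /cvgrPdist_lt/(_ x x0)[n _ Hn]; exists n.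
by have := Hn n (leqnn n); rewrite /= sub0r normrN ger0_norm // exprn_ge0.
Qed.

Lemma zeros_bound (s : seq C) G : uniq s -> (forall a, a \in s -> nm a < 1) ->
  disc_holo G -> (forall z, nm z < 1 -> nm (G z) <= 1) ->
  (forall a, a \in s -> G a = 0) ->
  forall z, nm z < 1 -> nm (G z) <= \prod_(a <- s) nm (mob a z).
Proof.
elim: s G => [|a s IH] G; first by move=> _ _ _ G1 _ z z1; rewrite big_nil G1.
rewrite cons_uniq => /andP[as_ us] s1 hG G1 Gs z z1.
have a1 : nm a < 1 by apply: s1; rewrite mem_head.
have [H [hH H1 GH]] := schwarz_divide a1 hG G1 (Gs a (mem_head _ _)).
rewrite big_cons GH // nmM ler_wpM2l ?nm_ge0 //; apply: IH => // b bs.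
  by apply: s1; rewrite inE bs orbT.
have b1 : nm b < 1 by apply: s1; rewrite inE bs orbT.
have := Gs b; rewrite inE bs orbT GH // => /(_ isT)/eqP.
rewrite mulf_eq0 mob_eq0 // => /orP[/eqP ba|/eqP //].
by move: as_; rewrite -ba bs.
Qed.

Lemma prod_mob_le (s : seq C) (c : R) z : (forall a, a \in s -> nm (mob a z) <= c) ->
  \prod_(a <- s) nm (mob a z) <= c ^+ size s.
Proof.
elim: s => [|a s IH] sc; first by rewrite big_nil expr0.
rewrite big_cons exprS; apply: ler_pM; rewrite ?nm_ge0 ?sc ?mem_head //.
  by apply: prodr_ge0 => b _; exact: nm_ge0.
by apply: IH => b bs; apply: sc; rewrite inE bs orbT.
Qed.

(** A quantitative form of the identity theorem: n zeros in |a| <= r give |G(z)| <= c^n, with the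
    same c < 1 for every n. *)
Lemma infinitely_many_zeros (r : R) (p : nat -> C) G : r < 1 -> injective p ->
  (forall k, nm (p k) <= r) -> (forall k, G (p k) = 0) ->
  disc_holo G -> (forall z, nm z < 1 -> nm (G z) <= 1) ->
  forall z, nm z < 1 -> G z = 0.
Proof.
move=> r1 pI pr Gp hG G1 z z1.
have [c c01 Hc] := mob_away1 r1 z1.
apply/eqP; rewrite -nm0_eq0 eq_le nm_ge0 andbT leNgt; apply/negP => /(geometric_small c01)[n].
apply/negP; rewrite -leNgt.
have us : uniq (map p (iota 0 n)) by rewrite map_inj_uniq ?iota_uniq.
apply: le_trans (zeros_bound us _ hG G1 _ z1) _.
- by move=> a /mapP[k _ ->]; exact: le_lt_trans (pr k) r1.
- by move=> a /mapP[k _ ->].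
rewrite -[X in _ ^+ X](size_iota 0) -[X in _ ^+ X](size_map p).
by apply: prod_mob_le => a /mapP[k _ ->]; exact: Hc.
Qed.

Lemma isolated_value (E : seq C) (b : C) :
  exists2 d : R, 0 < d & forall x, x \in E -> nm (x - b) < d -> x = b.
Proof.
elim: E => [|y E [d d0 Hd]]; first by exists 1.
have [->|yb] := eqVneq y b.
  by exists d => // x; rewrite inE => /orP[/eqP->//|]; exact: Hd.
exists (Num.min d (nm (y - b))); first by rewrite lt_min d0 nm_gt0 subr_eq0.
move=> x; rewrite inE lt_min => /orP[/eqP->|xE] /andP[h1 h2]; last exact: Hd.
by rewrite ltxx in h2.
Qed.

(** If B took only values of the finite list E near [a], continuity would force B = B(a) near [a],
    and B - B(a) would have infinitely many zeros in a smaller disc. *)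
Lemma avoid_values B a (e : R) (E : seq C) : disc_holo B ->
  (forall z, nm z < 1 -> nm (B z) <= 1) ->
  ~ (exists b, forall z, nm z < 1 -> B z = b) -> nm a < 1 -> 0 < e ->
  exists w, [/\ nm (w - a) < e, nm w < 1 & B w \notin E].
Proof.
move=> hB B1 nc a1 e0; apply: contrapT => nex; apply: nc; exists (B a).
have [d d0 Hd] := isolated_value E (B a).
have [d' d'0 Hd'] := (ccontP _ _).1 (holo_cont (hB a a1)) d d0.
pose r := (1 + nm a) / 2.
pose u := Num.min (Num.min e d') ((1 - nm a) / 2).
have u0 : 0 < u by rewrite !lt_min e0 d'0 divr_gt0 // subr_gt0.
have [ue ud' ua] : [/\ u <= e, u <= d' & u <= (1 - nm a) / 2].
  by split; rewrite !ge_min lexx ?orbT.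
have near w : nm (w - a) < u -> nm w <= r /\ B w = B a.
  move=> wu; have wr : nm w <= r by have := nm_sub_ge w a; rewrite /r; lra.
  split=> //; apply: Hd; last by apply: Hd'; exact: lt_le_trans ud'.
  apply: contrapT => /negP wE; apply: nex; exists w; split => //.
    exact: lt_le_trans ue.
  by apply: le_lt_trans wr _; rewrite /r; lra.
(* Any injective sequence within distance u of [a] would do; the shift by 2 keeps the distance
   strictly below u. *)
pose p (k : nat) : C := a + (u / k.+2%:R)%:C.
have pu k : nm (p k - a) < u.
  rewrite /p addrC addKr nm_real ger0_norm ?divr_ge0 ?(ltW u0) //.
  by rewrite ltr_pdivrMr // ltr_pMr // ltr1n.
have pI : injective p.
  move=> k l /addrI/complexI/(mulfI (lt0r_neq0 u0))/invr_inj/eqP.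
  by rewrite eqr_nat => /eqP[].
(* Halved, because [infinitely_many_zeros] is about functions bounded by 1. *)
pose G z := (B z - B a) / 2%:R.
have h2 : nm (2%:R : C) = 2 by rewrite -(rmorph_nat (real_complex R)) nm_real ger0_norm.
move=> z z1; have : G z = 0.
  apply: (@infinitely_many_zeros r p) => //.
  - by rewrite /r; lra.
  - by move=> k; have [] := near _ (pu k).
  - by move=> k; have [_ E'] := near _ (pu k); rewrite /G E' subrr mul0r.
  - by move=> w w1; apply: holoM (holo_cst _ _); apply: holoB (holo_cst _ _); exact: hB.
  move=> w w1; rewrite nm_div h2 ler_pdivrMr // mul1r.
  by apply: le_trans (nmBD _ _) _; have := B1 w w1; have := B1 a a1; lra.
move=> /eqP; rewrite mulf_eq0 invr_eq0 pnatr_eq0 orbF subr_eq0 => /eqP //.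
Qed.

(** After a rotation g(0) = 1. Harnack's inequality needs values inside the open disc, so it is
    applied to s g with s < 1, and its right-hand side vanishes as s -> 1. *)
Lemma unimodular_constant H : disc_holo H -> (forall z, nm z < 1 -> nm (H z) = 1) ->
  forall z, nm z < 1 -> H z = H 0.
Proof.
move=> hH H1 z z1.
have n01 : nm (0 : C) < 1 by rewrite nm0.
pose g z := (H 0)^* * H z.
have g1 w : nm w < 1 -> nm (g w) = 1 by move=> w1; rewrite nmM nmJ !H1 ?mulr1.
have g0 : g 0 = 1 by rewrite /g mulrC mulcJ H1 // expr1n.
have key (s : R) : 0 < s < 1 -> (1 - nm z) * nm (1 - s%:C * g z) <= (1 + nm z) * (1 - s).
  move=> /andP[s0 s1].
  have -> : 1 - s = nm (1 - s%:C * g 0).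
    by rewrite g0 mulr1 -[1 : C]/(1%:C) -realCB nm_real ger0_norm ?subr_ge0 // ltW.
  apply: (@harnack _ (fun z => s%:C * g z)) => // w w1.
    by apply: holoM (holo_cst _ _) _; apply: holoM (holo_cst _ _) (hH w w1).
  by rewrite nmM g1 // mulr1 nm_real ger0_norm // ltW.
have : 1 - g z = 0.
  apply: le_eps_eq0 => e e0; have p0 : 0 < 1 - nm z by rewrite subr_gt0.
  pose d := Num.min (1 / 2) (e * (1 - nm z) / 2).
  have d0 : 0 < d by rewrite lt_min divr_gt0 //= divr_gt0 // mulr_gt0.
  have d1 : d <= 1 / 2 by rewrite ge_min lexx.
  have d2 : d <= e * (1 - nm z) / 2 by rewrite ge_min lexx orbT.
  have := key (1 - d); rewrite subKr => /(_ _)K.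
  have {}K : (1 - nm z) * nm (1 - (1 - d)%:C * g z) <= (1 + nm z) * d.
    by apply: K; apply/andP; split; lra.
  have h : nm (1 - g z) <= nm (1 - (1 - d)%:C * g z) + d.
    have -> : 1 - g z = (1 - (1 - d)%:C * g z) - d%:C * g z.
      by rewrite realCB -[1%:C]/(1 : C); ring.
    apply: le_trans (nmBD _ _) _; rewrite lerD2l nmM g1 // mulr1 nm_real ger0_norm //.
    exact: ltW.
  rewrite -(ler_pM2l p0).
  have h' : (1 - nm z) * nm (1 - g z) <= (1 - nm z) * (nm (1 - (1 - d)%:C * g z) + d).
    by rewrite ler_wpM2l // ltW.
  lra.
move=> /subr0_eq gz; have := congr1 (fun x => H 0 * x) gz.
by rewrite mulr1 /g mulrA mulcJ H1 // expr1n -[1%:C]/(1 : C) mul1r.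
Qed.

(** The maximum principle for 1/H gives |H| >= 1. *)
Lemma nonvanishing_constant H : disc_holo H -> (forall z, nm z < 1 -> nm (H z) <= 1) ->
  (forall z, nm z < 1 -> H z != 0) ->
  (forall e : R, 0 < e -> near_circle (fun z => 1 - e < nm (H z))) ->
  nm (H 0) = 1 /\ forall z, nm z < 1 -> H z = H 0.
Proof.
move=> hH H1 H0 Hb; suff h z : nm z < 1 -> nm (H z) = 1.
  by split; [apply: h; rewrite nm0|exact: unimodular_constant].
move=> z1; apply/eqP; rewrite eq_le H1 //=.
have : nm (H z)^-1 <= 1.
  apply: (@max_disc _ (fun z => (H z)^-1)) => // [w w1|e e0].
    by apply: holoV; [exact: hH|exact: H0].
  have [d /andP[d0 _] Hd] := inv_le_near1 e0.
  by apply: near_circle_mono (Hb _ d0) => w w1 hw; rewrite nmV; exact: Hd.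
by rewrite nmV invf_le1 // nm_gt0 H0.
Qed.

Lemma proper_disc_blaschke B : disc_holo B -> (forall z, nm z < 1 -> nm (B z) < 1) ->
  (forall e : R, 0 < e -> near_circle (fun z => 1 - e < nm (B z))) ->
  exists (s : seq C) (c : C), [/\ (0 < size s)%N, nm c = 1,
    forall a, a \in s -> nm a < 1 &
    forall z, nm z < 1 -> B z = c * \prod_(a <- s) mob a z].
Proof.
move=> hB B1 Bb.
have [r /andP[r0 r1] Hr] := Bb (1 / 2) ltac:(lra).
have zero_le a : nm a < 1 -> B a = 0 -> nm a <= r.
  move=> a1 Ba; rewrite leNgt; apply/negP => ra.
  by have := Hr a; rewrite ra a1 Ba nm0 => /(_ isT); lra.
pose fact (s : seq C) H := [/\ (forall a, a \in s -> nm a <= r), disc_holo H,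
  (forall z, nm z < 1 -> nm (H z) <= 1) &
  forall z, nm z < 1 -> B z = (\prod_(a <- s) mob a z) * H z].
(* Either dividing out zeros ends, or n of them can be divided out. All zeros lie in |a| <= r, so
   for large n the second case contradicts B(z0) != 0 at a point with r < |z0| < 1. *)
have step n : (exists s H, fact s H /\ forall z, nm z < 1 -> H z != 0) \/
    (exists s H, fact s H /\ size s = n).
  elim: n => [|n [IH|[s [H [[sr hH H1 BH] sn]]]]]; [right|by left|].
    exists [::], B; split => //; split => // [z z1|z z1]; first exact/ltW/B1.
    by rewrite big_nil mul1r.
  have [nz|/existsNP[a /not_implyP[a1 /negP/negPn/eqP Ha]]] :=
    pselect (forall z, nm z < 1 -> H z != 0); [left|right]; first by exists s, H.
  have [H' [hH' H'1 HH']] := schwarz_divide a1 hH H1 Ha.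
  exists (a :: s), H'; split; last by rewrite /= sn.
  split => // [b|z z1].
    rewrite inE => /orP[/eqP->|]; last exact: sr.
    by apply: zero_le => //; rewrite BH // Ha mulr0.
  by rewrite big_cons BH // HH' // mulrA [_ * mob a z]mulrC.
pose z0 : C := ((r + 1) / 2)%:C.
have nz0 : nm z0 = (r + 1) / 2 by rewrite nm_real ger0_norm //; lra.
have z01 : nm z0 < 1 by rewrite nz0; lra.
have Bz0 : 0 < nm (B z0).
  rewrite nm_gt0; apply/eqP => /(zero_le _ z01); rewrite nz0; lra.
have [c c01 Hc] := mob_away1 r1 z01.
have [n Hn] := geometric_small c01 Bz0.
have [[s [H [[sr hH H1 BH] H0]]]|[s [H [[sr hH H1 BH] sn]]]] := step n; last first.
  move: Hn; rewrite ltNge BH // nmM => /negP[]; rewrite -sn.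
  apply: le_trans (prod_mob_le _); last by move=> a /sr; exact: Hc.
  by rewrite nm_prod ler_piMr ?H1 // prodr_ge0 // => a _; exact: nm_ge0.
have s1 a : a \in s -> nm a < 1 by move=> /sr ar; exact: le_lt_trans r1.
have prod_le1 z : nm z < 1 -> nm (\prod_(a <- s) mob a z) <= 1.
  move=> z1; rewrite -[leRHS](expr1n _ (size s)).
  rewrite nm_prod.
  by apply: prod_mob_le => a /s1 a1; apply/ltW/mob_lt1.
have [|h0 hc] := nonvanishing_constant hH H1 H0.
  move=> e e0; apply: near_circle_mono (Bb e e0) => z z1; rewrite BH // => /lt_le_trans; apply.
  by rewrite nmM ler_piMl ?nm_ge0 ?prod_le1.
exists s, (H 0); split => // [|z z1]; last by rewrite BH // hc // mulrC.
(* Without zeros B would be a constant of modulus 1, against |B| < 1. *)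
rewrite lt0n size_eq0; apply/eqP => s0.
have n01 : nm (0 : C) < 1 by rewrite nm0.
by have := B1 0 n01; rewrite BH // s0 big_nil mul1r h0 ltxx.
Qed.

(** Write h = mob a H with a = g(0) and |H| <= 1. The Schwarz-Pick bound for [mob a] composed with g
    gives |mob a| <= |h|, so |H| = 1 off [a], and at [a] by continuity; hence H is constant. *)
Lemma disc_automorphism_mob (h g : C -> C) : disc_holo h -> disc_holo g ->
  (forall z, nm z < 1 -> nm (h z) < 1) -> (forall z, nm z < 1 -> nm (g z) < 1) ->
  (forall z, nm z < 1 -> g (h z) = z) -> (forall z, nm z < 1 -> h (g z) = z) ->
  exists c a, [/\ nm c = 1, nm a < 1 & forall z, nm z < 1 -> h z = c * mob a z].
Proof.
move=> hh hg h1 g1 gh hgK.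
have n01 : nm (0 : C) < 1 by rewrite nm0.
pose a := g 0; have a1 : nm a < 1 by exact: g1.
have h1' z : nm z < 1 -> nm (h z) <= 1 by move=> /h1/ltW.
have [H [hH H1 HE]] := schwarz_divide a1 hh h1' (hgK 0 n01).
have le z : nm z < 1 -> nm (mob a z) <= nm (h z).
  move=> z1; have hm : disc_holo (fun w => mob a (g w)).
    by move=> w w1; apply: holo_comp; [exact: hg|apply: mob_holo => //; exact: g1].
  have m1 w : nm w < 1 -> nm (mob a (g w)) <= 1.
    by move=> w1; apply/ltW/mob_lt1 => //; exact: g1.
  by have := schwarz_pick n01 hm m1 (mobaa a) (h1 _ z1); rewrite gh // mob0z.
have H1' z : nm z < 1 -> z != a -> nm (H z) = 1.
  move=> z1 za; apply/eqP; rewrite eq_le H1 //=.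
  have := le z z1; rewrite HE // nmM.
  have m0 : 0 < nm (mob a z) by rewrite nm_gt0 mob_eq0.
  by rewrite -{1}[nm (mob a z)]mulr1 ler_pM2l.
have Ha : nm (H a) = 1.
  apply/eqP; rewrite eq_le H1 //= leNgt; apply/negP => Ha.
  have p0 : 0 < 1 - nm (H a) by rewrite subr_gt0.
  have [d d0 Hd] := (ccontP _ _).1 (holo_cont (hH a a1)) _ p0.
  pose t := Num.min (d / 2) ((1 - nm a) / 2).
  have t0 : 0 < t by rewrite lt_min !divr_gt0 // subr_gt0.
  have [td ta] : t <= d / 2 /\ t <= (1 - nm a) / 2 by split; rewrite ge_min lexx ?orbT.
  have wa : a + t%:C - a = t%:C by rewrite addrC addKr.
  have nt : nm t%:C = t by rewrite nm_real ger0_norm // ltW.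
  have w1 : nm (a + t%:C) < 1 by apply: le_lt_trans (nmD _ _) _; rewrite nt; lra.
  have := Hd (a + t%:C); rewrite wa nt => /(_ _)K.
  have {}K : nm (H (a + t%:C) - H a) < 1 - nm (H a) by apply: K; lra.
  have := nm_sub_ge (H (a + t%:C)) (H a); rewrite H1' //; first by lra.
  by rewrite -subr_eq0 wa -nm_gt0 nt.
have H1'' z : nm z < 1 -> nm (H z) = 1 by have [->|za z1] := eqVneq z a => //; exact: H1'.
exists (H 0), a; split => // [|z z1]; first exact: H1''.
by rewrite HE // (unimodular_constant hH H1'' z1) mulrC.
Qed.

End Zeros.

(** * Symmetrization and roots of polynomials *)

Section ElementarySymmetric.

Definition elsym (K : pzSemiRingType) n (k : nat) (l : 'I_n -> K) : K :=
  \sum_(A : {set 'I_n} | #|A| == k) \prod_(j in A) l j.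

(** The homogeneous form of Vieta's formulas. The ring is arbitrary and both [a] and [b] are free,
    because it is used for values, for polynomials, and for Moebius numerators and denominators. *)
Lemma prod_linear_elsym (K : comNzRingType) n (l : 'I_n -> K) (a b : K) :
  \prod_(j < n) (a - b * l j) =
  \sum_(k < n.+1) (-1) ^+ k * elsym k l * b ^+ k * a ^+ (n - k).
Proof.
under eq_bigr do rewrite addrC.
rewrite bigA_distr (partition_big (fun A : {set 'I_n} => inord #|A| : 'I_n.+1) xpredT) //=.
apply: eq_bigr => k _; rewrite /elsym mulr_sumr !mulr_suml.
have cardA (A : {set 'I_n}) : (#|A| < n.+1)%N by rewrite ltnS -[n in (_ <= n)%N]card_ord max_card.
apply: eq_big => A; first by rewrite -(inj_eq val_inj) /= inordK.
move=> /eqP<-; rewrite inordK // big_if /= prodrN big_split /= prodr_const.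
have cA : #|[pred j | j \notin A]| = (n - #|A|)%N.
  have : (#|A| + #|[pred j | j \notin A]|)%N = n.
    by rewrite -[RHS]card_ord -(cardC A); congr (_ + _)%N; apply: eq_card => j; rewrite !inE.
  by lia.
rewrite (_ : \prod_(i | i \notin A) a = a ^+ (n - #|A|)); last first.
  by rewrite -cA -prodr_const; apply: eq_bigl => j; rewrite inE.
ring.
Qed.

Lemma elsym0 (K : pzSemiRingType) n (l : 'I_n -> K) : elsym 0 l = 1.
Proof.
rewrite /elsym (big_pred1 finset.set0) ?finset.big_set0 // => A; exact: cards_eq0.
Qed.

Lemma elsym_perm (K : comPzSemiRingType) n k (l : 'I_n -> K) (f : 'I_n -> 'I_n) :
  injective f -> elsym k (fun j => l (f j)) = elsym k l.
Proof.
move=> fI; rewrite /elsym.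
have fA : injective (fun A : {set 'I_n} => f @: A) by exact: imset_inj.
rewrite [RHS](reindex_inj fA) /=; apply: eq_big => A.
  by rewrite card_imset.
by move=> _; rewrite big_imset // => i j _ _; exact: fI.
Qed.

Lemma deriv_prod_XsubC (K : fieldType) (I : Type) (r : seq I) (l : I -> K) x :
  (forall j, x != l j) ->
  (\prod_(j <- r) ('X - (l j)%:P))^`().[x] =
  \prod_(j <- r) (x - l j) * \sum_(j <- r) (x - l j)^-1.
Proof.
move=> xl; elim: r => [|j r IH]; first by rewrite !big_nil derivC hornerC mulr0.
rewrite !big_cons derivM derivXsubC mul1r hornerD hornerM !hornerXsubC IH.
have -> : (\prod_(i <- r) ('X - (l i)%:P)).[x] = \prod_(i <- r) (x - l i).
  by rewrite horner_prod; apply: eq_bigr => i _; rewrite hornerXsubC.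
rewrite mulrDr mulrAC mulfV ?subr_eq0 // mul1r; congr (_ + _).
by rewrite mulrA.
Qed.

End ElementarySymmetric.

(** * Points of the symmetrized disc as monic polynomials *)

Section SymmetrizedPoints.
Variable R : realType.
Variable n : nat.
Local Notation C := R[i].
Implicit Types (s l : 'rV[C]_n) (t x : C).

Lemma symmetrizationE l (k : 'I_n) : symmetrization l 0 k = elsym k.+1 (l 0).
Proof. by rewrite mxE. Qed.

(* The coefficients of the monic polynomial whose roots are symmetrized to s,
   highest degree first. *)
Definition root_coefs s : 'rV[C]_n.+1 :=
  \row_k (if unlift ord0 k is Some i then (-1) ^+ k * s 0 i else 1).

Definition root_poly s : {poly C} :=
  \sum_(k < n.+1) (root_coefs s 0 k)%:P * 'X^(n - k).

Definition root_eval s t : C := \sum_(k < n.+1) root_coefs s 0 k * t ^+ (n - k).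

(** This is t p'(t) rather than p'(t), a combination of the same coefficients with the same
    exponents as p(t). *)
Definition root_deriv s t : C :=
  \sum_(k < n.+1) root_coefs s 0 k * (t ^+ (n - k) *+ (n - k)).

Lemma root_coefs0 s : root_coefs s 0 ord0 = 1.
Proof. by rewrite mxE unlift_none. Qed.

Lemma root_coefsS s (i : 'I_n) : root_coefs s 0 (lift ord0 i) = (-1) ^+ i.+1 * s 0 i.
Proof. by rewrite mxE liftK. Qed.

Lemma root_coefs_symm l (k : 'I_n.+1) :
  root_coefs (symmetrization l) 0 k = (-1) ^+ k * elsym k (l 0).
Proof.
have [i ->|->] := unliftP ord0 k; last by rewrite root_coefs0 expr0 elsym0 mulr1.
by rewrite root_coefsS symmetrizationE.
Qed.

Lemma root_eval_symm l t : root_eval (symmetrization l) t = \prod_(j < n) (t - l 0 j).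
Proof.
under eq_bigr => j _ do rewrite -[l 0 j]mul1r.
rewrite prod_linear_elsym; apply: eq_bigr => k _.
by rewrite root_coefs_symm expr1n mulr1.
Qed.

Lemma root_poly_symm l : root_poly (symmetrization l) = \prod_(j < n) ('X - (l 0 j)%:P).
Proof.
under [RHS]eq_bigr => j _ do rewrite -[(l 0 j)%:P]mul1r.
rewrite prod_linear_elsym; apply: eq_bigr => k _.
rewrite root_coefs_symm expr1n mulr1; congr (_ * _).
rewrite rmorphM rmorphXn rmorphN1; congr (_ * _).
rewrite rmorph_sum; apply: eq_bigr => A _.
by rewrite rmorph_prod.
Qed.

Lemma root_derivE s t : root_deriv s t = (root_poly s)^`().[t] * t.
Proof.
rewrite /root_poly raddf_sum horner_sum mulr_suml; apply: eq_bigr => k _.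
rewrite /= derivM derivC mul0r add0r hornerM hornerC -mulrA derivXn hornerMn hornerXn.
case: (n - k)%N => [|m]; first by rewrite !mulr0n mul0r.
by rewrite exprSr -mulrnAl.
Qed.

Lemma root_deriv_symm l t : (forall j, t != l 0 j) ->
  root_deriv (symmetrization l) t =
  root_eval (symmetrization l) t * \sum_(j < n) t / (t - l 0 j).
Proof.
move=> tl; rewrite root_derivE root_poly_symm deriv_prod_XsubC // root_eval_symm.
by rewrite -mulrA; congr (_ * _); rewrite mulr_suml; apply: eq_bigr => j _; rewrite mulrC.
Qed.

Lemma root_eval_eq0 l t : root_eval (symmetrization l) t = 0 -> exists j, l 0 j = t.
Proof.
rewrite root_eval_symm => /eqP/prodf_eq0[j _]; rewrite subr_eq0 => /eqP->.
by exists j.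
Qed.

Lemma root_eval_root l j : root_eval (symmetrization l) (l 0 j) = 0.
Proof. by rewrite root_eval_symm (bigD1 j) //= subrr mul0r. Qed.

Lemma symmetrization_perm l (f : 'I_n -> 'I_n) : injective f ->
  symmetrization (\row_j l 0 (f j)) = symmetrization l.
Proof.
move=> fI; apply/rowP => k; rewrite !symmetrizationE.
rewrite -(elsym_perm _ (l 0) fI) /elsym; apply: eq_bigr => A _; apply: eq_bigr => j _.
by rewrite mxE.
Qed.

Lemma polydiscE l : polydisc R n l <-> forall j, nm (l 0 j) < 1.
Proof. by split=> h j; have := h j; rewrite /unit_disc /= nmE -[1 : C]/(1%:C) ltcR. Qed.

Lemma symmetrization_polydisc l l' : polydisc R n l ->
  symmetrization l = symmetrization l' -> polydisc R n l'.
Proof.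
move=> lD E j; have := root_eval_root l' j; rewrite -E => /root_eval_eq0[i <-].
exact: lD.
Qed.

(** An injective choice among n roots is a permutation of them, so n distinct roots exhaust the root
    vector. *)
Lemma symmetrization_distinct l (b : 'I_n -> C) : injective b ->
  (forall j, root_eval (symmetrization l) (b j) = 0) ->
  symmetrization l = symmetrization (\row_j b j).
Proof.
move=> bI hb.
have /choice[f hf] : forall j, exists i, l 0 i = b j by move=> j; exact: root_eval_eq0.
have fI : injective f by move=> i j E; apply: bI; rewrite -!hf E.
rewrite -(symmetrization_perm l fI); congr symmetrization.
by apply/rowP => j; rewrite !mxE hf.
Qed.

(** The inversion x -> 1 / (1 - x) takes the disc to the half-plane Re > 1/2. *)
Lemma Re_inv1B x : nm x < 1 -> 1 / 2 < Re (1 - x)^-1.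
Proof.
move=> x1; have n0 : 0 < nm (1 - x) ^+ 2.
  by rewrite exprn_gt0 // nm_gt0 subr_eq0; apply: contraTneq x1 => <-; rewrite nm1 ltxx.
have E : Re (1 - x)^-1 = Re (1 - x) / nm (1 - x) ^+ 2.
  by rewrite nm_sqr; case: (1 - x).
rewrite E ltr_pdivlMr // nm_sqr Re_add Im_add Re_opp Im_opp /= add0r sqrrN.
have : nm x ^+ 2 < 1 by rewrite expr_lt1 ?nm_ge0.
by rewrite nm_sqr; lra.
Qed.

Lemma torus_quot (t x : C) : nm t = 1 -> t / (t - x) = (1 - x * t^*)^-1.
Proof.
move=> t1; have t0 : t != 0 by rewrite -nm_gt0 t1.
have tt : t * t^* = 1 by rewrite mulcJ t1 expr1n.
have -> : 1 - x * t^* = (t - x) / t.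
  by rewrite mulrBl mulfV // -[t^*](mulKf t0) tt mulr1.
by rewrite invf_div.
Qed.

Lemma Re_torus_quot (t x : C) : nm t = 1 -> nm x < 1 -> 1 / 2 < Re (t / (t - x)).
Proof.
by move=> t1 x1; rewrite torus_quot //; apply: Re_inv1B; rewrite nmM nmJ t1 mulr1.
Qed.

Lemma Re_sum (I : Type) (r : seq I) (F : I -> C) : Re (\sum_(i <- r) F i) = \sum_(i <- r) Re (F i).
Proof. by apply: (big_morph (@complex.Re R)) => //; exact: Re_add. Qed.

Definition log_deriv l t := \sum_(j < n) t / (t - l 0 j).

Lemma Re_log_deriv l t : (0 < n)%N -> polydisc R n l -> nm t = 1 ->
  n%:R / 2 < Re (log_deriv l t).
Proof.
move=> n0 /polydiscE lD t1; rewrite Re_sum.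
have -> : n%:R / 2 = \sum_(j < n) (1 / 2) :> R.
  by rewrite sumr_const card_ord -[RHS]mulr_natl mul1r.
apply: ltr_sum => [|j _]; last exact: Re_torus_quot.
by apply/hasP; exists (Ordinal n0); rewrite ?mem_index_enum.
Qed.

Lemma Re_log_deriv_ge l t (i : 'I_n) (r : R) : polydisc R n l -> nm t = 1 ->
  0 <= r -> l 0 i = r%:C * t -> (1 - r)^-1 <= Re (log_deriv l t).
Proof.
move=> /polydiscE lD t1 r0 li; rewrite Re_sum (bigD1 i) //=.
have r1 : r < 1 by have := lD i; rewrite li nmM t1 mulr1 nm_real ger0_norm.
have -> : Re (t / (t - l 0 i)) = (1 - r)^-1.
  rewrite torus_quot // li -mulrA mulcJ t1 expr1n mulr1 -[1 : C]/(1%:C) -realCB.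
  by rewrite -fmorphV.
rewrite lerDl; apply: sumr_ge0 => j _; apply: ltW; apply: lt_trans (Re_torus_quot t1 (lD j)).
by lra.
Qed.

Lemma torus_neq l t j : polydisc R n l -> nm t = 1 -> t != l 0 j.
Proof.
by move=> /polydiscE lD t1; apply: contraTneq (lD j) => <-; rewrite t1 ltxx.
Qed.

Lemma root_eval_torus l t : polydisc R n l -> nm t = 1 ->
  root_eval (symmetrization l) t != 0.
Proof.
move=> lD t1; rewrite root_eval_symm; apply/prodf_neq0 => j _.
by rewrite subr_eq0; exact: torus_neq.
Qed.

(** The bound does not depend on t. This matters because the direction in which it is used
    varies. *)
Lemma root_eval_torus_ge l t : polydisc R n l -> nm t = 1 ->
  \prod_(j < n) (1 - nm (l 0 j)) <= nm (root_eval (symmetrization l) t).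
Proof.
move=> /polydiscE lD t1; rewrite root_eval_symm.
rewrite nm_prod.
apply: ler_prod => j _; rewrite subr_ge0 (ltW (lD j)) /=.
by rewrite -t1 nm_sub_ge.
Qed.

(* The value at t of 1 - n p(t) / (t p'(t)), where p is the monic polynomial
   with root vector s. *)
Definition circle_test s t : C := 1 - n%:R * root_eval s t / root_deriv s t.

Lemma circle_test_symm l t : (0 < n)%N -> polydisc R n l -> nm t = 1 ->
  root_deriv (symmetrization l) t != 0 /\
  circle_test (symmetrization l) t = 1 - n%:R / log_deriv l t.
Proof.
move=> n0 lD t1; have q0 : log_deriv l t != 0.
  apply/eqP => q0; have := Re_log_deriv n0 lD t1; rewrite q0 /= ltNge divr_ge0 //.
have E := root_deriv_symm (fun j => torus_neq j lD t1).
have p0 := root_eval_torus lD t1.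
split; first by rewrite E mulf_neq0.
rewrite /circle_test E -/(log_deriv l t); congr (1 - _); field.
by rewrite p0 q0.
Qed.

(** For the logarithmic derivative q, the inequality |q - n| < |q| says exactly that Re q > n/2. *)
Lemma circle_test_lt1 l t : (0 < n)%N -> polydisc R n l -> nm t = 1 ->
  nm (circle_test (symmetrization l) t) < 1.
Proof.
move=> n0 lD t1; have [_ ->] := circle_test_symm n0 lD t1.
have h := Re_log_deriv n0 lD t1; set q := log_deriv l t in h *.
have n0' : 0 < n%:R :> R by rewrite ltr0n.
have q0 : 0 < nm q by apply: lt_le_trans (Re_le_nm q); lra.
have q0' : q != 0 by rewrite -nm_gt0.
have -> : 1 - n%:R / q = (q - n%:R) / q by field.
rewrite nm_div ltr_pdivrMr // mul1r -(ltr_pXn2r (n := 2)) ?nnegrE ?nm_ge0 //.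
have -> : n%:R = (n%:R)%:C :> C by rewrite rmorph_nat.
rewrite !nm_sqr Re_add Im_add Re_opp Im_opp /= oppr0 addr0.
have : 0 < n%:R * (Re q *+ 2 - n%:R) by rewrite mulr_gt0 // mulr2n; lra.
rewrite mulr2n; lra.
Qed.

(** The root r t contributes 1 / (1 - r) to Re q, and the other roots contribute positive
    amounts. *)
Lemma circle_test_near l t (i : 'I_n) (r : R) : polydisc R n l -> nm t = 1 ->
  0 <= r -> l 0 i = r%:C * t ->
  nm (1 - circle_test (symmetrization l) t) <= n%:R * (1 - r).
Proof.
move=> lD t1 r0 li; have n0 : (0 < n)%N := leq_ltn_trans (leq0n i) (ltn_ord i).
have [_ ->] := circle_test_symm n0 lD t1; rewrite subKr nm_div.
have h := Re_log_deriv_ge lD t1 r0 li.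
have r1 : r < 1.
  by move/polydiscE: lD => /(_ i); rewrite li nmM t1 mulr1 nm_real ger0_norm.
have p0 : 0 < 1 - r by rewrite subr_gt0.
have h2 := le_trans h (Re_le_nm _).
have -> : n%:R = (n%:R)%:C :> C by rewrite rmorph_nat.
rewrite nm_real ger0_norm // ler_wpM2l // -[leRHS]invrK lef_pV2 ?posrE ?invr_gt0 //.
by apply: lt_le_trans h2; rewrite invr_gt0.
Qed.

(** By the product rule there are n terms, each t times a product of n - 1 factors of modulus at
    most 2. The bound serves to pass from [circle_test] back to [root_eval]. *)
Lemma root_deriv_le l t : polydisc R n l -> nm t = 1 ->
  nm (root_deriv (symmetrization l) t) <= n%:R * 2 ^+ n.
Proof.
move=> lD t1; rewrite root_deriv_symm => [|j]; last exact: torus_neq.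
have lD' := (polydiscE l).1 lD.
rewrite mulr_sumr (_ : n%:R * _ = \sum_(j < n) 2 ^+ n); last first.
  by rewrite sumr_const card_ord mulr_natl.
apply: le_trans (nm_sum _ _ _) _; apply: ler_sum => j _.
have tj : t - l 0 j != 0 by rewrite subr_eq0; exact: torus_neq.
have -> : root_eval (symmetrization l) t * (t / (t - l 0 j)) = t * \prod_(i < n | i != j) (t - l 0 i).
  by rewrite root_eval_symm (bigD1 j) //=; field.
rewrite nmM t1 mul1r nm_prod.
have b2 (i : 'I_n) : 0 <= nm (t - l 0 i) <= 2.
  by rewrite nm_ge0 /=; apply: le_trans (nmBD _ _) _; rewrite t1; have := lD' i; lra.
apply: (@le_trans _ _ (\prod_(i < n | i != j) 2)); first by apply: ler_prod => i _; exact: b2.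
rewrite [leRHS](_ : _ = \prod_(i < n) 2); last by rewrite prodr_const card_ord.
rewrite [leRHS](bigD1 j) //= ler_peMl //; first by apply: prodr_ge0.
by lra.
Qed.

End SymmetrizedPoints.

(** * Holomorphy in several variables and along complex lines *)

Section SeveralVariables.
Variables (K : numFieldType) (V : normedModType K).
Implicit Types x : V.

Lemma differentiable_bigsum (I : Type) (r : seq I) (P : pred I) (f : I -> V -> K^o) x :
  (forall i, differentiable (f i) x) ->
  differentiable (fun v => \sum_(i <- r | P i) f i v : K^o) x.
Proof.
move=> df; elim: r => [|i r IH].
  rewrite (_ : (fun _ => _) = cst (0 : K^o)); first exact: differentiable_cst.
  by apply/funext => v; rewrite big_nil.
have [Pi|Pi] := boolP (P i); last first.
  by under eq_fun do rewrite big_cons (negbTE Pi).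
by under eq_fun do rewrite big_cons Pi; apply: differentiableD.
Qed.

Lemma differentiable_bigprod (I : Type) (r : seq I) (P : pred I) (f : I -> V -> K^o) x :
  (forall i, differentiable (f i) x) ->
  differentiable (fun v => \prod_(i <- r | P i) f i v : K^o) x.
Proof.
move=> df; elim: r => [|i r IH].
  rewrite (_ : (fun _ => _) = cst (1 : K^o)); first exact: differentiable_cst.
  by apply/funext => v; rewrite big_nil.
have [Pi|Pi] := boolP (P i); last first.
  by under eq_fun do rewrite big_cons (negbTE Pi).
by under eq_fun do rewrite big_cons Pi; apply: differentiableM.
Qed.

Lemma differentiable_row n (F : V -> 'rV[K]_n) x :
  (forall j, differentiable (fun v => F v 0 j : K^o) x) -> differentiable F x.
Proof.
move=> dF; rewrite (_ : F = \sum_(j < n) (fun v => F v 0 j *: (delta_mx 0 j : 'rV[K]_n))).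
  by apply: differentiable_sum => j; apply: differentiableZl.
apply/funext => v; rewrite fct_sumE; exact: row_sum_delta.
Qed.

Lemma differentiable_entry n (F : V -> 'rV[K]_n) x j :
  differentiable F x -> differentiable (fun v => F v 0 j : K^o) x.
Proof.
move=> dF; apply: (@differentiable_comp _ _ _ _ F (fun M : 'rV[K]_n => M 0 j : K^o)) => //.
exact: differentiable_coord.
Qed.

Lemma differentiable_elsym n (F : V -> 'rV[K]_n) x : differentiable F x ->
  differentiable (fun v => \row_(k < n) elsym k.+1 (F v 0)) x.
Proof.
move=> dF; apply: differentiable_row => k.
under eq_fun do rewrite mxE.
apply: differentiable_bigsum => A; apply: differentiable_bigprod => j.
exact: differentiable_entry.
Qed.

Lemma differentiable_line n (l u : 'rV[K]_n) (z : K^o) :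
  differentiable (fun t : K^o => l + t *: u) z.
Proof.
apply: differentiableD; first exact: differentiable_cst.
exact: (@differentiableZl _ _ _ (fun t : K^o => t)).
Qed.

End SeveralVariables.

Section Lines.
Variable R : realType.
Variable n : nat.
Local Notation C := R[i].
Implicit Types (l u : 'rV[C]_n) (z : C).

Lemma differentiable_symmetrization (V : normedModType C) (F : V -> 'rV[C]_n) (x : V) :
  differentiable F x -> differentiable (fun v => symmetrization (F v)) x.
Proof. exact: (@differentiable_elsym C V n F x). Qed.

Lemma holo_line (f : 'rV[C]_n -> 'rV[C]_n) l u z (k : 'I_n) :
  holomorphic_on (symmetrized_disc R n) f -> polydisc R n (l + z *: u) ->
  holo (fun t => f (symmetrization (l + t *: u)) 0 k) z.
Proof.
move=> hf lD; apply/holoE.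
apply: (@differentiable_entry C C^o n (fun t => f (symmetrization (l + t *: u)))).
apply: (@differentiable_comp C C^o 'rV[C]_n 'rV[C]_n (fun t => symmetrization (l + t *: u)) f).
  apply: differentiable_symmetrization; exact: (@differentiable_line C).
by apply: hf; exists (l + z *: u).
Qed.

End Lines.

(** * Compact sets of the symmetrized disc and properness on roots *)

Section Compactness.
Variable R : realType.
Variable n : nat.
Local Notation C := R[i].
Local Notation V := ('rV[C]_n : normedModType C).

Definition closed_polydisc (r : R) : set V := [set l | forall j, nm (l 0 j) <= r].

Lemma compact_closed_disc (r : R) : compact [set z : C^o | nm z <= r].
Proof.
pose g (p : R * R) : C^o := p.1 +i* p.2.
have cg : continuous g.
  move=> p; apply/cvgrPdist_lt => e /pos_complexP[-> e0].
  have e20 : 0 < Re e / 2 by rewrite divr_gt0.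
  exists (ball p.1 (Re e / 2), ball p.2 (Re e / 2)); first by split; exact: nbhsx_ballx.
  move=> q [/= h1 h2].
  rewrite nmE ltcR; apply: le_lt_trans (nm_le _) _.
  by rewrite Re_add Im_add Re_opp Im_opp /= [ltRHS]splitr ltrD.
have cK := compact_setX (@segment_compact R (- r) r) (@segment_compact R (- r) r).
have := continuous_compact (continuous_subspaceT cg) cK.
move=> K; apply: subclosed_compact K _; last first.
  move=> z /= zr; exists (Re z, Im z); last by rewrite /g; case: z zr.
  by split; rewrite /= in_itv /= -ler_norml; [apply: le_trans zr; exact: Re_abs_le
    |apply: le_trans zr; exact: Im_abs_le].
move=> z zcl /=; rewrite leNgt; apply/negP => rz.
have d0 : 0 < (nm z - r)%:C :> C by rewrite ltcR subr_gt0.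
have [w [/= wr]] := zcl _ (nbhsx_ballx z _ d0).
rewrite /ball /= nmE ltcR => zw; have := nm_sub_ge z w; lra.
Qed.

Lemma compact_closed_polydisc (r : R) : compact (closed_polydisc r).
Proof. exact: (@rV_compact C^o n (fun=> [set z : C^o | nm z <= r]) (fun=> @compact_closed_disc r)). Qed.

Lemma continuous_symmetrization : continuous (@symmetrization R n : V -> V).
Proof.
move=> l; apply: differentiable_continuous.
apply: (@differentiable_symmetrization R n 'rV[C]_n (fun v => v)).
exact: ex_diff.
Qed.

Lemma compact_symmetrized (r : R) : compact ((@symmetrization R n : V -> V) @` closed_polydisc r).
Proof.
apply: continuous_compact; last exact: compact_closed_polydisc.
exact/continuous_subspaceT/continuous_symmetrization.
Qed.

(** The preimage of K in the closed polydisc is compact, and it lies in the open one because a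
    symmetrized point determines its roots. A covering argument as r -> 1 from below then gives a
    single r. *)
Lemma compact_in_symmetrized_disc (K : set V) :
  K `<=` symmetrized_disc R n -> compact K ->
  exists2 r : R, 0 <= r < 1 & forall l, polydisc R n l -> K (symmetrization l) ->
    forall j, nm (l 0 j) <= r.
Proof.
move=> KG cK; pose E := closed_polydisc 1 `&` (@symmetrization R n : V -> V) @^-1` K.
have cE : compact E.
  apply: subclosed_compact (@compact_closed_polydisc 1) _; last by move=> l [].
  apply: closedI; first by apply: compact_closed (@compact_closed_polydisc 1); exact: norm_hausdorff.
  apply: closed_comp; first by move=> l _; exact: continuous_symmetrization.
  by apply: compact_closed cK; exact: norm_hausdorff.
have ED l : E l -> polydisc R n l.
  by move=> [_ /KG[l' l'D E']]; exact: symmetrization_polydisc E'.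
have /compact_near_coveringP cov := cE.
have {}cov : \forall r \near (1 : R)^'-, E `<=` (fun l => forall j, nm (l 0 j) <= r).
  apply: (cov R (at_left (1 : R)) (fun r l => forall j, nm (l 0 j) <= r)) => l /ED/polydiscE lD.
  have near_j (j : 'I_n) : \forall l' \near l & r \near (1 : R)^'-, nm ((l' : V) 0 j) <= r.
    pose d := (1 - nm (l 0 j)) / 2.
    have d0 : 0 < d by rewrite divr_gt0 // subr_gt0.
    have d0' : 0 < d%:C :> C by rewrite ltcR.
    have cj : {for l, continuous (fun M : V => M 0 j : C^o)} by exact: coord_continuous.
    exists ([set l' : V | nm (l' 0 j) < nm (l 0 j) + d], [set r | nm (l 0 j) + d < r]).
      split => /=.
        move/cvgrPdist_lt: cj => /(_ _ d0'); apply: filterS => l'.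
        rewrite nmE ltcR nmB => h /=; rewrite -ltrBlDl; exact: le_lt_trans (nm_sub_ge _ _) h.
      apply: nbhs_left_gt; rewrite -ltrBrDl /d.
      have m1 : 0 < 1 - nm (l 0 j) by rewrite subr_gt0.
      by rewrite ltr_pdivrMr // ltr_pMr // ltr1n.
    by move=> [l' r] [/= h1 h2]; exact/ltW/(lt_trans h1).
  exact: filter_forall near_j.
have [r [rE r01]] : exists r : R, E `<=` (fun l => forall j, nm (l 0 j) <= r) /\ 0 <= r < 1.
  apply: (@filter_ex _ (at_left (1 : R))); near=> r; split; first by near: r.
  apply/andP; split; near: r; last exact: nbhs_left_lt.
  exact: nbhs_left_ge.
exists r => // l lD Kl j; apply: (rE l); split => // i.
by apply/ltW/(polydiscE l).1.
Unshelve. all: by end_near. Qed.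


(** Properness is used on the compact set of points whose roots all have modulus at most rho: its
    preimage has roots of modulus at most some r < 1. *)
Lemma proper_roots (f : V -> V) :
  proper_map (symmetrized_disc R n) (symmetrized_disc R n) f ->
  forall rho : R, rho < 1 -> exists2 r : R, 0 <= r < 1 &
    forall l, polydisc R n l -> forall j, r < nm (l 0 j) ->
    forall m, symmetrization m = f (symmetrization l) -> exists i, rho < nm (m 0 i).
Proof.
move=> pf rho rho1.
have KG : (@symmetrization R n : V -> V) @` closed_polydisc rho `<=` symmetrized_disc R n.
  by move=> _ [l lr <-]; exists l => //; apply/polydiscE => j; exact: le_lt_trans (lr j) rho1.
have := pf _ KG (@compact_symmetrized rho).
have LG : symmetrized_disc R n `&` f @^-1` ((@symmetrization R n : V -> V) @` closed_polydisc rho)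
    `<=` symmetrized_disc R n by move=> l [].
move=> /(compact_in_symmetrized_disc LG)[r r01 Hr]; exists r => // l lD j rj m mE.
apply: contrapT => nex; have : nm (l 0 j) <= r; last by rewrite leNgt rj.
apply: Hr => //; split; first by exists l.
exists m => // i; rewrite leNgt; apply/negP => mi; apply: nex; exists i; exact: mi.
Qed.

(** A preimage is closed only relative to the domain. Here it lies in the compact set [L], so its
    closure stays in the domain, where [f] is continuous. *)
Lemma roots_proper (f : V -> V) :
  set_fun (symmetrized_disc R n) (symmetrized_disc R n) f ->
  holomorphic_on (symmetrized_disc R n) f ->
  (forall rho : R, rho < 1 -> exists2 r : R, 0 <= r < 1 &
    forall l, polydisc R n l -> forall j, r < nm (l 0 j) ->
    exists m i, [/\ polydisc R n m, symmetrization m = f (symmetrization l) & rho < nm (m 0 i)]) ->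
  proper_map (symmetrized_disc R n) (symmetrized_disc R n) f.
Proof.
move=> fG hf H K KG cK.
have [rho /andP[rho0 rho1] Hrho] := compact_in_symmetrized_disc KG cK.
have [r /andP[r0 r1] Hr] := H rho rho1.
have cL := @compact_symmetrized r; set L := _ @` _ in cL.
have LG : L `<=` symmetrized_disc R n.
  by move=> _ [l lr <-]; exists l => //; apply/polydiscE => j; exact: le_lt_trans (lr j) r1.
have AL : symmetrized_disc R n `&` f @^-1` K `<=` L.
  move=> _ [[l lD <-] Kl]; exists l => // j; rewrite leNgt; apply/negP => rj.
  have [m [i [mD mE mi]]] := Hr l lD j rj.
  by have := Hrho m mD; rewrite mE => /(_ Kl i); rewrite leNgt mi.
have clL : closed L by apply: compact_closed cL; exact: norm_hausdorff.
have clK : closed K by apply: compact_closed cK; exact: norm_hausdorff.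
apply: (subclosed_compact _ cL AL) => x xcl.
have xG : symmetrized_disc R n x.
  by apply/LG/clL => B /xcl[y [/AL yL yB]]; exists y.
split=> //; apply: clK => B fB.
have cf : {for x, continuous f} by apply: differentiable_continuous; exact: hf.
by have [y [[_ Ky] yB]] := xcl _ (cf _ fB); exists (f y).
Qed.

End Compactness.

(** * Root vectors of the image of a proper map *)

Section BoundedHolomorphic.
Variable R : realType.
Local Notation C := R[i].
Implicit Types g h : C -> C.

Lemma holo_sum (I : Type) (r : seq I) (P : pred I) (f : I -> C -> C) (z : C) :
  (forall i, holo (f i) z) -> holo (fun w => \sum_(i <- r | P i) f i w) z.
Proof.
move=> hf; elim: r => [|i r IH].
  by under eq_fun do rewrite big_nil; exact: holo_cst.
have [Pi|Pi] := boolP (P i); last first.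
  by under eq_fun do rewrite big_cons (negbTE Pi).
by under eq_fun do rewrite big_cons Pi; apply: holoD.
Qed.

Lemma holo_prod (I : Type) (r : seq I) (P : pred I) (f : I -> C -> C) (z : C) :
  (forall i, holo (f i) z) -> holo (fun w => \prod_(i <- r | P i) f i w) z.
Proof.
move=> hf; elim: r => [|i r IH].
  by under eq_fun do rewrite big_nil; exact: holo_cst.
have [Pi|Pi] := boolP (P i); last first.
  by under eq_fun do rewrite big_cons (negbTE Pi).
by under eq_fun do rewrite big_cons Pi; apply: holoM.
Qed.

Definition disc_bounded g := exists M : R, forall t, nm t < 1 -> nm (g t) <= M.

(** Boundedness is carried along because cofactors get multiplied by quantities that tend to 0 at
    the circle. *)
Definition disc_bholo g := disc_holo g /\ disc_bounded g.

Lemma bholo_cst (c : C) : disc_bholo (fun=> c).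
Proof. by split; [move=> t _; exact: holo_cst|exists (nm c)]. Qed.

Lemma bholoD g h : disc_bholo g -> disc_bholo h -> disc_bholo (fun t => g t + h t).
Proof.
move=> [hg [M HM]] [hh [N HN]]; split; first by move=> t t1; exact: holoD (hg t t1) (hh t t1).
exists (M + N) => t t1; apply: le_trans (nmD _ _) _.
by apply: lerD; [exact: HM|exact: HN].
Qed.

Lemma bholoM g h : disc_bholo g -> disc_bholo h -> disc_bholo (fun t => g t * h t).
Proof.
move=> [hg [M HM]] [hh [N HN]]; split; first by move=> t t1; exact: holoM (hg t t1) (hh t t1).
exists (M * N) => t t1; rewrite nmM.
by apply: ler_pM; rewrite ?nm_ge0 //; [exact: HM|exact: HN].
Qed.

Lemma bholo_sum (I : Type) (r : seq I) (P : pred I) (f : I -> C -> C) :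
  (forall i, disc_bholo (f i)) -> disc_bholo (fun w => \sum_(i <- r | P i) f i w).
Proof.
move=> hf; elim: r => [|i r IH].
  by under eq_fun do rewrite big_nil; exact: bholo_cst.
have [Pi|Pi] := boolP (P i); last first.
  by under eq_fun do rewrite big_cons (negbTE Pi).
by under eq_fun do rewrite big_cons Pi; apply: bholoD.
Qed.

Lemma bholo_prod (I : Type) (r : seq I) (P : pred I) (f : I -> C -> C) :
  (forall i, disc_bholo (f i)) -> disc_bholo (fun w => \prod_(i <- r | P i) f i w).
Proof.
move=> hf; elim: r => [|i r IH].
  by under eq_fun do rewrite big_nil; exact: bholo_cst.
have [Pi|Pi] := boolP (P i); last first.
  by under eq_fun do rewrite big_cons (negbTE Pi).
by under eq_fun do rewrite big_cons Pi; apply: bholoM.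
Qed.

Lemma bholo_det m (A : C -> 'M[C]_m) :
  (forall i j, disc_bholo (fun t => A t i j)) -> disc_bholo (fun t => \det (A t)).
Proof.
move=> hA; apply: bholo_sum => s; apply: bholoM; first exact: bholo_cst.
by apply: bholo_prod => i.
Qed.

Lemma bholo_cofactor m (A : C -> 'M[C]_m) i j :
  (forall i j, disc_bholo (fun t => A t i j)) -> disc_bholo (fun t => cofactor (A t) i j).
Proof.
move=> hA; apply: bholoM; first exact: bholo_cst.
by apply: bholo_det => i' j'; under eq_fun do rewrite !mxE.
Qed.

Lemma bholo_mulmx m n p (A : C -> 'M[C]_(m, n)) (B : 'M[C]_(n, p)) i k :
  (forall i j, disc_bholo (fun t => A t i j)) -> disc_bholo (fun t => (A t *m B) i k).
Proof.
move=> hA; under eq_fun do rewrite mxE; apply: bholo_sum => j.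
by apply: bholoM; last exact: bholo_cst.
Qed.

End BoundedHolomorphic.

Section UpdateCoordinate.
Variable R : realType.
Variable n : nat.
Local Notation C := R[i].
Implicit Types (l : 'rV[C]_n) (k : 'I_n) (t : C).

Definition upd l k t : 'rV[C]_n := \row_j (if j == k then t else l 0 j).

Lemma updE l k t j : upd l k t 0 j = if j == k then t else l 0 j.
Proof. by rewrite mxE. Qed.

Lemma upd_id l k : upd l k (l 0 k) = l.
Proof. by apply/rowP => j; rewrite updE; case: eqP => [->|]. Qed.

Lemma upd_line l k t : upd l k t = upd l k 0 + t *: delta_mx 0 k.
Proof.
apply/rowP => j; rewrite !mxE eqxx /=; case: eqP => _; first by rewrite mulr1 add0r.
by rewrite mulr0 addr0.
Qed.

Lemma upd_polydisc l k t : polydisc R n l -> nm t < 1 -> polydisc R n (upd l k t).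
Proof.
by move=> /polydiscE lD t1; apply/polydiscE => j; rewrite updE; case: eqP.
Qed.

Lemma polydisc0 : polydisc R n 0.
Proof. by apply/polydiscE => j; rewrite mxE nm0. Qed.

End UpdateCoordinate.

(** * Image polynomials near the boundary *)

Section RootSpan.
Variable R : realType.
Variable n : nat.
Local Notation C := R[i].
Variable f : 'rV[C]_n -> 'rV[C]_n.
Hypothesis f_maps : set_fun (symmetrized_disc R n) (symmetrized_disc R n) f.
Hypothesis f_holo : holomorphic_on (symmetrized_disc R n) f.
(* Properness of f, seen on the roots. *)
Hypothesis f_roots : forall rho : R, rho < 1 -> exists2 r : R, 0 <= r < 1 &
  forall l, polydisc R n l -> forall j, r < nm (l 0 j) ->
  forall m, symmetrization m = f (symmetrization l) -> exists i, rho < nm (m 0 i).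
Implicit Types (l m u : 'rV[C]_n) (k : 'I_n) (t x tau : C).

Local Notation F l := (f (symmetrization l)).

Definition image_coefs l : 'rV[C]_n.+1 := root_coefs (F l).

Local Notation v := image_coefs.

Definition moment x : 'cV[C]_n.+1 := \col_(i < n.+1) x ^+ (n - i).

Lemma image_coefs_moment l x : (v l *m moment x) 0 0 = root_eval (F l) x.
Proof. by rewrite mxE; apply: eq_bigr => k _; rewrite [moment x _ _]mxE. Qed.

Lemma image_roots l : polydisc R n l ->
  exists2 m, polydisc R n m & symmetrization m = F l.
Proof.
move=> lD; have [m mD mE] : symmetrized_disc R n (F l) by apply: f_maps; exists l.
by exists m.
Qed.

Lemma image_coefs_bounded : exists M : R, forall l, polydisc R n l ->
  forall i, nm (v l 0 i) <= M.
Proof.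
exists (\sum_(A : {set 'I_n}) 1) => l lD i.
have [m /polydiscE mD mE] := image_roots lD.
rewrite /image_coefs -mE root_coefs_symm nmM nmX nmN nm1 expr1n mul1r.
apply: le_trans (nm_sum _ _ _) _.
rewrite big_mkcond /=; apply: ler_sum => A _; case: ifP => // _.
rewrite nm_prod; apply: prodr_ile1 => j _.
by rewrite nm_ge0 ltW.
Qed.

Lemma image_coefs_line l u z (j : 'I_n.+1) : polydisc R n (l + z *: u) ->
  holo (fun t => v (l + t *: u) 0 j) z.
Proof.
move=> lD; have [i ->|->] := unliftP ord0 j; last first.
  by under eq_fun do rewrite /image_coefs root_coefs0; exact: holo_cst.
under eq_fun do rewrite /image_coefs root_coefsS.
by apply: holoM; [exact: holo_cst|exact: holo_line].
Qed.

Lemma image_coefs_upd l k (i : 'I_n.+1) : polydisc R n l -> disc_bholo (fun t => v (upd l k t) 0 i).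
Proof.
move=> lD; split=> [t t1|].
  under eq_fun do rewrite upd_line; apply: image_coefs_line.
  by rewrite -upd_line; exact: upd_polydisc.
have [M HM] := image_coefs_bounded; exists M => t t1; apply: HM.
exact: upd_polydisc.
Qed.

Lemma polydisc_radius l : polydisc R n l ->
  exists2 r : R, 0 < r < 1 & forall j, nm (l 0 j) <= r.
Proof.
move=> /polydiscE lD.
have [r [r0 r1 Hr]] : exists r : R, [/\ 0 < r, r < 1 & forall j, j \in enum 'I_n -> nm (l 0 j) <= r].
  elim: (enum 'I_n) => [|j s [r [r0 r1 Hr]]].
    by exists (1 / 2); split => //; lra.
  exists (Num.max r (nm (l 0 j))); split; first by rewrite lt_max r0.
    by rewrite gt_max r1 lD.
  move=> i; rewrite inE le_max => /orP[/eqP->|/Hr->//]; by rewrite lexx orbT.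
by exists r; [rewrite r0|move=> j; apply: Hr; rewrite mem_enum].
Qed.

(* Harnack's inequality for circle_test on the complex line joining the base
   point (0, .., t, .., 0) to the point (l_1, .., t, .., l_n). *)
Lemma root_eval_harnack l k : polydisc R n l -> exists2 K : R, 0 <= K &
  forall t tau (r : R) m i, nm t < 1 -> nm tau = 1 -> 0 <= r -> polydisc R n m ->
    symmetrization m = F (upd 0 k t) -> m 0 i = r%:C * tau ->
    nm (root_eval (F (upd l k t)) tau) <= K * (1 - r).
Proof.
move=> lD; have [r /andP[r0 r1] Hr] := polydisc_radius lD.
have n0 : (0 < n)%N := leq_ltn_trans (leq0n k) (ltn_ord k).
have q0 : 0 < 1 - r by rewrite subr_gt0.
(* Harnack gives (1 + r) / (1 - r), [circle_test_near] a factor n and [root_deriv_le] a factor n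
   2^n; one n cancels in 1 - [circle_test] = n P / (tau P'). *)
have K0 : 0 <= (1 + r) / (1 - r) * (n%:R * 2 ^+ n) :> R.
  by rewrite !mulr_ge0 ?invr_ge0 ?ler0n ?exprn_ge0 // ?(ltW q0) // addr_ge0 // ltW.
exists ((1 + r) / (1 - r) * (n%:R * 2 ^+ n)) => // t tau rho m i t1 tau1 rho0 mD mE mi.
(* Scaled so that the parameter r reaches the target point while the whole unit disc of parameters
   stays in the polydisc. *)
pose u := r%:C^-1 *: upd l k 0.
have rC0 : r%:C != 0 :> C by rewrite -nm_gt0 nm_real normr_gt0 gt_eqF.
have lineD z : nm z < 1 -> polydisc R n (upd 0 k t + z *: u).
  move=> z1; apply/polydiscE => j; rewrite !mxE.
  case: eqP => _; first by rewrite !mulr0 addr0.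
  rewrite add0r mulrA mulrAC -mulrA nmM nm_div nm_real ger0_norm ?(ltW r0) //.
  apply: le_lt_trans z1; rewrite ler_piMr ?nm_ge0 // ler_pdivrMr // mul1r; exact: Hr.
pose g z := circle_test (F (upd 0 k t + z *: u)) tau.
have sumholo z (c : 'I_n.+1 -> C) : nm z < 1 ->
    holo (fun z => \sum_(i < n.+1) v (upd 0 k t + z *: u) 0 i * c i) z.
  move=> z1; apply: holo_sum => j; apply: holoM; last exact: holo_cst.
  by apply: image_coefs_line; exact: lineD.
have hg : disc_holo g.
  move=> z z1; apply: holoB; first exact: holo_cst.
  apply: holoM; first by apply: holoM; [exact: holo_cst|exact: sumholo].
  apply: holoV; first exact: sumholo.
  have [m' m'D <-] := image_roots (lineD z z1).
  by case: (circle_test_symm n0 m'D tau1).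
have g1 z : nm z < 1 -> nm (g z) < 1.
  move=> z1; rewrite /g; have [m' m'D <-] := image_roots (lineD z z1).
  exact: circle_test_lt1.
have nr : nm r%:C = r by rewrite nm_real ger0_norm // ltW.
have nr1 : nm r%:C < 1 by rewrite nr.
have := harnack hg g1 nr1; rewrite nr.
have g0E : nm (1 - g 0) <= n%:R * (1 - rho).
  by rewrite /g scale0r addr0 -mE; exact: (circle_test_near mD tau1 rho0 mi).
have grE : upd 0 k t + r%:C *: u = upd l k t.
  apply/rowP => j; rewrite !mxE; case: eqP => _; first by rewrite !mulr0 addr0.
  by rewrite add0r mulVKf.
rewrite /g grE; have [m' m'D m'E] := image_roots (upd_polydisc k lD t1).
have := root_deriv_le m'D tau1; have [d0 _] := circle_test_symm n0 m'D tau1.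
rewrite m'E in d0 *; set P := root_eval _ _; set E := root_deriv _ _ in d0 * => E2.
have nC : n%:R = (n%:R)%:C :> C by rewrite rmorph_nat.
have nR0 : 0 < n%:R :> R by rewrite ltr0n.
have PE : nm P = nm (1 - circle_test (F (upd l k t)) tau) * nm E / n%:R.
  rewrite /circle_test subKr -/P -/E nm_div nmM {1}nC nm_real ger0_norm ?ler0n //.
  by field; rewrite gt_eqF //= nm0_eq0.
rewrite PE; set y := nm (1 - _) => hy.
have y0 : 0 <= y by exact: nm_ge0.
have hy2 : (1 - r) * y <= (1 + r) * (n%:R * (1 - rho)).
  by apply: le_trans hy _; rewrite ler_wpM2l // addr_ge0 // ltW.
have hy3 : y <= (1 + r) / (1 - r) * (n%:R * (1 - rho)).
  by rewrite -(ler_pM2l q0); apply: le_trans hy2 _; rewrite le_eqVlt; apply/orP; left;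
    apply/eqP; field; rewrite gt_eqF.
have : y * nm E <= (1 + r) / (1 - r) * (n%:R * (1 - rho)) * (n%:R * 2 ^+ n).
  by apply: ler_pM; rewrite ?nm_ge0.
rewrite ler_pdivrMr // => /le_trans; apply.
by rewrite le_eqVlt; apply/orP; left; apply/eqP; ring.
Qed.

(** tau is the direction of a root of large modulus at the base point. Capping e at 1/2 keeps that
    root away from 0. *)
Lemma boundary_direction k (e : R) : 0 < e -> near_circle (fun t => exists tau m i (r : R),
  [/\ nm tau = 1, 0 <= r, 1 - r <= e &
   [/\ polydisc R n m, symmetrization m = F (upd 0 k t) & m 0 i = r%:C * tau]]).
Proof.
move=> e0; pose d := Num.min (1 / 2) e.
have d0 : 0 < d by rewrite lt_min e0 divr_gt0.
have [d1 d2] : d <= 1 / 2 /\ d <= e by split; rewrite ge_min lexx ?orbT.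
have [|r r01 Hr] := f_roots (rho := 1 - d); first by lra.
exists r => // t /andP[rt t1].
have tD := upd_polydisc k (@polydisc0 R n) t1.
have [m mD mE] := image_roots tD.
have [|i mi] := Hr _ tD k _ m mE; first by rewrite updE eqxx.
have m0 : 0 < nm (m 0 i) by lra.
have m0' : (nm (m 0 i))%:C != 0 :> C by rewrite -nm_gt0 nm_real normr_gt0 gt_eqF.
exists (m 0 i / (nm (m 0 i))%:C), m, i, (nm (m 0 i)); split; [| exact: nm_ge0|lra|split => //].
  by rewrite nm_div nm_real ger0_norm ?nm_ge0 // divff // gt_eqF.
by rewrite mulrC divfK.
Qed.

(** One tau serves all the points: it is found at the base point whose only nonzero coordinate can
    be [k], and Harnack's inequality carries it to each of the finitely many [z i]. *)
Lemma boundary_small k (r : nat) (z : 'I_r -> 'rV[C]_n) (e : R) :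
  (forall i, polydisc R n (z i)) -> 0 < e ->
  near_circle (fun t => exists2 tau, nm tau = 1 &
    forall i, nm (root_eval (F (upd (z i) k t)) tau) <= e).
Proof.
move=> zD e0.
have /choice[K HK] : forall i, exists K : R, 0 <= K /\
  forall t tau (r : R) m j, nm t < 1 -> nm tau = 1 -> 0 <= r -> polydisc R n m ->
    symmetrization m = F (upd 0 k t) -> m 0 j = r%:C * tau ->
    nm (root_eval (F (upd (z i) k t)) tau) <= K * (1 - r).
  by move=> i; have [K K0 HK] := root_eval_harnack k (zD i); exists K.
pose S := \sum_i K i + 1.
have S0 : 0 < S by rewrite ltr_wpDl // sumr_ge0 // => i _; case: (HK i).
have KS i : K i <= S.
  rewrite /S (bigD1 i) //= -addrA lerDl addr_ge0 // sumr_ge0 // => j _; by case: (HK j).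
have eS : 0 < e / S by rewrite divr_gt0.
apply: near_circle_mono (boundary_direction k eS) => t t1.
move=> [tau [m [j [rho [tau1 rho0 rhoe [mD mE mj]]]]]]; exists tau => // i.
have [K0 HKi] := HK i; apply: le_trans (HKi _ _ _ _ _ t1 tau1 rho0 mD mE mj) _.
apply: le_trans (_ : S * (e / S) <= _); last by rewrite mulrCA mulfV ?gt_eqF // mulr1.
apply: le_trans (_ : K i * (e / S) <= _); first by rewrite ler_wpM2l.
by rewrite ler_wpM2r // ltW.
Qed.

End RootSpan.

(** * Dimension count by releasing coordinates *)

Section Chain.
Variable R : realType.
Variable n : nat.
Local Notation C := R[i].
Variable f : 'rV[C]_n -> 'rV[C]_n.
Hypothesis f_maps : set_fun (symmetrized_disc R n) (symmetrized_disc R n) f.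
Hypothesis f_holo : holomorphic_on (symmetrized_disc R n) f.
Hypothesis f_roots : forall rho : R, rho < 1 -> exists2 r : R, 0 <= r < 1 &
  forall l, polydisc R n l -> forall j, r < nm (l 0 j) ->
  forall m, symmetrization m = f (symmetrization l) -> exists i, rho < nm (m 0 i).
Implicit Types (l m u : 'rV[C]_n) (k : 'I_n) (t x tau : C).

Local Notation F l := (f (symmetrization l)).
Local Notation v := (image_coefs f).

Definition coefs_mx r (z : 'I_r -> 'rV[C]_n) : 'M[C]_(r, n.+1) := \matrix_(i < r) v (z i).

Lemma coefs_mx_moment r (z : 'I_r -> 'rV[C]_n) x i :
  (coefs_mx z *m moment n x) i 0 = root_eval (F (z i)) x.
Proof.
rewrite -image_coefs_moment !mxE; apply: eq_bigr => j _; by rewrite mxE.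
Qed.

Lemma coefs_mx_bholo r (z : 'I_r -> 'rV[C]_n) k i j : (forall i, polydisc R n (z i)) ->
  disc_bholo (fun t => coefs_mx (fun i => upd (z i) k t) i j).
Proof.
move=> zD; under eq_fun do rewrite mxE.
exact: (image_coefs_upd f_maps f_holo).
Qed.

Lemma bounded_family (I : finType) (g : I -> C -> C) : (forall i, disc_bounded (g i)) ->
  exists2 M : R, 0 < M & forall i t, nm t < 1 -> nm (g i t) <= M.
Proof.
move=> /choice[B HB]; exists (\sum_i `|B i| + 1) => [|i t t1].
  by rewrite ltr_wpDl // sumr_ge0.
apply: le_trans (HB i t t1) _; apply: le_trans (ler_norm _) _.
rewrite (bigD1 i) //= -addrA lerDl addr_ge0 // sumr_ge0 //.
Qed.

(* If adding points that only differ in the coordinate k never enlarged the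
   span, then the coefficients m(t) of the moved points in the basis would have
   determinant 1 at t = a but 0 in the limit |t| -> 1, where the moved points are
   orthogonal to the moment vector of a boundary root. *)
Lemma chain_step k r (z : 'I_r.+1 -> 'rV[C]_n) (a : C) :
  (forall i, polydisc R n (z i)) -> (forall i, z i 0 k = a) ->
  row_free (coefs_mx z) ->
  exists i t, nm t < 1 /\ ~~ (v (upd (z i) k t) <= coefs_mx z)%MS.
Proof.
move=> zD za zfree; apply: contrapT => nex; set S := coefs_mx z in zfree nex.
have inS i t : nm t < 1 -> (v (upd (z i) k t) <= S)%MS.
  by move=> t1; apply: contrapT => /negP h; apply: nex; exists i, t.
pose M t := coefs_mx (fun i => upd (z i) k t).
pose A t := M t *m pinvmx S.
have AS t : nm t < 1 -> A t *m S = M t.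
  by move=> t1; apply: mulmxKpV; apply/row_subP => i; rewrite rowK; exact: inS.
have a1 : nm a < 1 by rewrite -(za ord0); apply/(polydiscE _).1.
have Aa : A a = 1%:M.
  rewrite /A (_ : M a = S) ?mulmxVp //.
  by apply/row_matrixP => i; rewrite !rowK -(za i) upd_id.
have bA i j : disc_bholo (fun t => A t i j).
  by apply: bholo_mulmx => i' j'; exact: coefs_mx_bholo.
have [hdet _] := bholo_det bA.
have [B B0 HB] : exists2 B : R, 0 < B & forall j t, nm t < 1 -> nm (\adj (A t) ord0 j) <= B.
  apply: (@bounded_family 'I_r.+1 (fun j t => \adj (A t) ord0 j)) => j.
  have [_ [B HB]] := bholo_cofactor j ord0 bA.
  by exists B => t t1; rewrite mxE; exact: HB.
have [m mD mE] := image_roots f_maps (zD ord0).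
(* A lower bound, uniform over the unit circle, for the image polynomial at the fixed point
   [z ord0]; tau changes with t. *)
pose d := \prod_(j < n) (1 - nm (m 0 j)).
have d0 : 0 < d.
  by apply: prodr_gt0 => j _; rewrite subr_gt0; exact: (polydiscE m).1.
have : \det (A a) = 0.
  apply: (small_boundary_eq0 hdet) => // e e0.
  have e'0 : 0 < e * d / (r.+1%:R * B) by rewrite divr_gt0 ?mulr_gt0 // ltr0n.
  apply: near_circle_mono (boundary_small f_maps f_holo f_roots k zD e'0) => t t1.
  move=> [tau tau1 htau].
  (* Apply the adjugate of [A t] to [A t *m S = M t] and pair with the moment vector: the
     determinant, times a factor of modulus at least d, equals r + 1 terms bounded by B times small
     values. *)
  have E : \det (A t) * root_eval (F (z ord0)) tau =
      (\adj (A t) *m (M t *m moment n tau)) ord0 0.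
    rewrite -AS // mulmxA mulmxA mul_adj_mx -mulmxA mul_scalar_mx [RHS]mxE.
    by rewrite coefs_mx_moment.
  have h1 : nm (\det (A t)) * d <= nm (\det (A t) * root_eval (F (z ord0)) tau).
    by rewrite nmM ler_wpM2l ?nm_ge0 // -mE; exact: root_eval_torus_ge.
  rewrite -(ler_pM2r d0); apply: le_trans h1 _; rewrite E mxE.
  apply: le_trans (nm_sum _ _ _) _.
  have -> : e * d = \sum_(j < r.+1) B * (e * d / (r.+1%:R * B)).
    rewrite sumr_const card_ord -[RHS]mulr_natl; field.
    by rewrite gt_eqF //= -[1 + _](natrD _ 1 r) gt_eqF // ltr0n.
  apply: ler_sum => j _; rewrite nmM; apply: ler_pM; rewrite ?nm_ge0 //; first exact: HB.
  by rewrite coefs_mx_moment.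
by rewrite Aa det1 => /eqP; rewrite oner_eq0.
Qed.

(** The added point is a member of the family moved in coordinate [k] only, so the other shared
    coordinates stay shared and can be released later. *)
Lemma chain_extend k r (z : 'I_r.+1 -> 'rV[C]_n) (a : C) :
  (forall i, polydisc R n (z i)) -> (forall i, z i 0 k = a) ->
  row_free (coefs_mx z) ->
  exists z' : 'I_r.+2 -> 'rV[C]_n, [/\ forall i, polydisc R n (z' i),
    forall j b, j != k -> (forall i, z i 0 j = b) -> forall i, z' i 0 j = b &
    row_free (coefs_mx z')].
Proof.
move=> zD za zfree; have [i0 [t [t1 ht]]] := chain_step zD za zfree.
pose z' i := if unlift ord0 i is Some i' then z i' else upd (z i0) k t.
have z'0 : z' ord0 = upd (z i0) k t by rewrite /z' unlift_none.
have z'S i : z' (lift ord0 i) = z i by rewrite /z' liftK.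
exists z'; split.
- move=> i; have [i' ->|->] := unliftP ord0 i; first by rewrite z'S.
  by rewrite z'0; exact: upd_polydisc.
- move=> j b jk hb i; have [i' ->|->] := unliftP ord0 i; first by rewrite z'S.
  by rewrite z'0 updE (negbTE jk).
have sub : (coefs_mx z < coefs_mx z')%MS.
  rewrite ltmxE; apply/andP; split.
    apply/row_subP => i; rewrite rowK -z'S -[v _](rowK (fun i => v (z' i)) (lift ord0 i)).
    exact: row_sub.
  apply: contra ht => /row_subP/(_ ord0); by rewrite rowK z'0.
have := rank_ltmx sub; rewrite (eqP zfree) => h.
by rewrite /row_free eqn_leq rank_leq_row.
Qed.

(** Coordinates are released from the last to the first. The start is one vector, nonzero because
    its leading coefficient is 1; r = n - 1 keeps only the first coordinate fixed, and r = n gives a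
    basis. *)
Lemma chain l r : polydisc R n l -> (r <= n)%N ->
  exists z : 'I_r.+1 -> 'rV[C]_n, [/\ forall i, polydisc R n (z i),
    forall j : 'I_n, (j < n - r)%N -> forall i, z i 0 j = l 0 j &
    row_free (coefs_mx z)].
Proof.
move=> lD; elim: r => [_|r IH rn].
  exists (fun=> l); split => //.
  rewrite /row_free; apply/eqP; apply/eqP; rewrite eqn_leq rank_leq_row lt0n mxrank_eq0.
  apply/eqP => /matrixP/(_ ord0 ord0); rewrite !mxE unlift_none => /eqP.
  by rewrite oner_eq0.
have [z [zD zl zfree]] := IH (ltnW rn).
have kn : (n - r.+1 < n)%N by lia.
have kr : (n - r.+1 < n - r)%N by lia.
have [z' [z'D z'l z'free]] := chain_extend zD (zl (Ordinal kn) kr) zfree.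
exists z'; split => // j jn; apply: z'l; last by apply: zl; lia.
by apply/eqP => jk; move: jn; rewrite jk ltnn.
Qed.

End Chain.

(** * Normal vector of a hyperplane by maximal minors *)

Section MaximalMinors.
Variables (K : fieldType) (m : nat).
Implicit Types (V : 'M[K]_(m, m.+1)) (w : 'rV[K]_m.+1) (c : 'cV[K]_m.+1).

Definition add_row w V : 'M[K]_m.+1 :=
  \matrix_(i < m.+1) (if unlift ord0 i is Some i' then row i' V else w).

Lemma add_row0 w V j : add_row w V ord0 j = w 0 j.
Proof. by rewrite mxE unlift_none. Qed.

Lemma add_rowS w V i j : add_row w V (lift ord0 i) j = V i j.
Proof. by rewrite mxE liftK mxE. Qed.

(** The generalized cross product of the rows; the zero row is a placeholder that the cofactor
    deletes. *)
Definition max_minor V j := cofactor (add_row 0 V) ord0 j.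

Lemma cofactor_add_row w V j : cofactor (add_row w V) ord0 j = max_minor V j.
Proof.
congr (_ * \det _); apply/matrixP => i' j'.
by rewrite !mxE !liftK.
Qed.

Lemma det_add_row w V : \det (add_row w V) = \sum_j w 0 j * max_minor V j.
Proof.
rewrite (expand_det_row _ ord0); apply: eq_bigr => j _.
by rewrite add_row0 cofactor_add_row.
Qed.

(** Put the unit row e_j above V to get M and read entry i of adj M (M c) = det M c. For V c = 0 it
    says that c is proportional to the minors; the right-hand side measures the error when V c is
    merely small. *)
Lemma max_minor_adj V c i j :
  max_minor V j * c i 0 - max_minor V i * c j 0 =
  \sum_(k < m) \adj (add_row (delta_mx 0 j) V) i (lift ord0 k) * (V *m c) k 0.
Proof.
set M := add_row _ V.
have detM : \det M = max_minor V j.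
  rewrite det_add_row (bigD1 j) //= big1 ?addr0; first by rewrite mxE !eqxx mul1r.
  by move=> i' /negbTE ij; rewrite mxE ij andbF mul0r.
have : (\adj M *m (M *m c)) i 0 = max_minor V j * c i 0.
  by rewrite mulmxA mul_adj_mx mul_scalar_mx mxE detM.
move=> <-; rewrite mxE big_ord_recl.
have -> : \adj M i ord0 = max_minor V i by rewrite mxE cofactor_add_row.
have -> : (M *m c) ord0 0 = c j 0.
  rewrite mxE (bigD1 j) //= big1 ?addr0; first by rewrite add_row0 mxE !eqxx mul1r.
  by move=> i' /negbTE ij; rewrite add_row0 mxE ij andbF mul0r.
rewrite addrC addKr; apply: eq_bigr => k _; congr (_ * _).
by rewrite !mxE; apply: eq_bigr => j' _; rewrite add_rowS.
Qed.

(** If all minors vanished, no row could be added independently, so m rows would span a space of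
    dimension m + 1. *)
Lemma max_minor_neq0 V : row_free V -> exists j, max_minor V j != 0.
Proof.
move=> Vfree; apply: contrapT => nex.
have all0 j : max_minor V j = 0.
  by apply/eqP; apply: contrapT => /negP h; apply: nex; exists j.
have sub w : (w <= V)%MS.
  apply: contrapT => /negP wV; have : \det (add_row w V) == 0.
    by rewrite det_add_row big1 // => j _; rewrite all0 mulr0.
  apply/negP; rewrite -unitfE -[_ \is a _]/(add_row w V \in unitmx) -row_free_unit.
  have h : (V < add_row w V)%MS.
    rewrite ltmxE; apply/andP; split.
      apply/row_subP => i; have -> : row i V = row (lift ord0 i) (add_row w V).
        by apply/rowP => j; rewrite [LHS]mxE [RHS]mxE add_rowS.
      exact: row_sub.
    apply: contra wV => /row_subP/(_ ord0).
    by congr (_ <= _)%MS; apply/rowP => j; rewrite mxE add_row0.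
  by have := rank_ltmx h; rewrite (eqP Vfree) /row_free eqn_leq rank_leq_row.
have : (1%:M <= V)%MS by apply/row_subP => i; exact: sub.
by move=> /mxrankS; rewrite mxrank1 (eqP Vfree) ltnn.
Qed.

End MaximalMinors.

(** * The common root over a fixed first coordinate *)

Section BoundaryRoot.
Variable R : realType.
Variable p : nat.
Local Notation n := p.+1.
Local Notation C := R[i].
Variable f : 'rV[C]_n -> 'rV[C]_n.
Hypothesis f_maps : set_fun (symmetrized_disc R n) (symmetrized_disc R n) f.
Hypothesis f_holo : holomorphic_on (symmetrized_disc R n) f.
Hypothesis f_roots : forall rho : R, rho < 1 -> exists2 r : R, 0 <= r < 1 &
  forall l, polydisc R n l -> forall j, r < nm (l 0 j) ->
  forall m, symmetrization m = f (symmetrization l) -> exists i, rho < nm (m 0 i).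
Implicit Types (l m u : 'rV[C]_n) (t x tau : C).

Local Notation F l := (f (symmetrization l)).
Local Notation v := (image_coefs f).

Definition fiber_root t x :=
  forall l, polydisc R n l -> l 0 ord0 = t -> root_eval (F l) x = 0.

(** Releasing the first coordinate would yield n + 2 independent vectors in dimension n + 1. *)
Lemma no_full_fiber (z : 'I_p.+2 -> 'rV[C]_n) (a : C) :
  (forall i, polydisc R n (z i)) -> (forall i, z i 0 ord0 = a) ->
  ~~ row_free (coefs_mx f z).
Proof.
move=> zD za; apply/negP => zfree.
have [z' [_ _ /eqP z'free]] := chain_extend f_maps f_holo f_roots zD za zfree.
by have := rank_leq_col (coefs_mx f z'); rewrite z'free ltnn.
Qed.

Section Fiber.
Variable z : 'I_n -> 'rV[C]_n.
Hypothesis zD : forall i, polydisc R n (z i).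

Local Notation V t := (coefs_mx f (fun i => upd (z i) ord0 t)).

(* Locked, because unification would otherwise unfold the determinant. *)
Definition fiber_minor := locked (fun k t => max_minor (V t) (inord k)).

Local Notation a := fiber_minor.

Lemma fiber_minorE k t : a k t = max_minor (V t) (inord k).
Proof. by rewrite /fiber_minor -lock. Qed.

Lemma add_row_bholo (w : 'rV[C]_n.+1) i j : disc_bholo (fun t => add_row w (V t) i j).
Proof.
have [i' ->|->] := unliftP ord0 i.
  by under eq_fun do rewrite add_rowS; exact: coefs_mx_bholo.
by under eq_fun do rewrite add_row0; exact: bholo_cst.
Qed.

Lemma fiber_minor_bholo k : disc_bholo (a k).
Proof.
have -> : a k = (fun t => max_minor (V t) (inord k)).
  by apply/funext => t; exact: fiber_minorE.
by apply: bholo_cofactor => i j; exact: add_row_bholo.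
Qed.

(** The sum is a determinant; if it were nonzero, [l] and the moved points would contradict
    [no_full_fiber]. *)
Lemma fiber_minor_vanish t l : nm t < 1 -> polydisc R n l -> l 0 ord0 = t ->
  \sum_(j < n.+1) v l 0 j * max_minor (V t) j = 0.
Proof.
move=> t1 lD lt; rewrite -det_add_row; apply/eqP/negP => /negP.
rewrite -unitfE -[_ \is a _]/(add_row (v l) (V t) \in unitmx) -row_free_unit.
pose z' i := if unlift ord0 i is Some i' then upd (z i') ord0 t else l.
have -> : add_row (v l) (V t) = coefs_mx f z'.
  apply/row_matrixP => i; rewrite !rowK /z'; case: (unliftP ord0 i) => [i' _|_] //.
  by rewrite rowK.
apply/negP; apply: (@no_full_fiber _ t) => i; rewrite /z';
  case: (unliftP ord0 i) => [i' _|_] //; first exact: upd_polydisc.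
by rewrite updE eqxx.
Qed.

Lemma momentE x k : (k <= n)%N -> moment n x (inord k) 0 = x ^+ (n - k).
Proof. by move=> kn; rewrite mxE inordK. Qed.

(** All rows are nearly orthogonal to the moment vector of tau, so by [max_minor_adj] the minors are
    nearly proportional to it: a geometric progression of ratio tau. *)
Lemma fiber_minor_near (e : R) : 0 < e -> near_circle (fun t => exists2 tau, nm tau = 1 &
  forall k, (k <= p)%N -> nm (a k t - tau * a k.+1 t) <= e).
Proof.
move=> e0.
pose adj_entry (q : 'I_n.+1 * 'I_n.+1 * 'I_n) t :=
  \adj (add_row (delta_mx 0 q.1.1) (V t)) q.1.2 (lift ord0 q.2).
have [M M0 HM] : exists2 M : R, 0 < M & forall q t, nm t < 1 -> nm (adj_entry q t) <= M.
  apply: bounded_family => q.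
  have := bholo_cofactor (lift ord0 q.2) q.1.2 (add_row_bholo (delta_mx 0 q.1.1)).
  by move=> [_ [B HB]]; exists B => t t1; rewrite /adj_entry mxE; exact: HB.
have e'0 : 0 < e / (n%:R * M) by rewrite divr_gt0 // mulr_gt0 // ltr0n.
apply: near_circle_mono (boundary_small f_maps f_holo f_roots ord0 zD e'0) => t t1.
move=> [tau tau1 htau]; exists tau => // k kp.
have := max_minor_adj (V t) (moment n tau) (inord k.+1) (inord k).
rewrite !momentE ?ltnS //; last by rewrite (leq_trans kp).
rewrite (_ : (n - k = (n - k.+1).+1)%N); last by lia.
rewrite exprS; set y := tau ^+ _.
have y1 : nm y = 1 by rewrite nmX tau1 expr1n.
rewrite -!fiber_minorE => E.
have -> : nm (a k t - tau * a k.+1 t) = nm (a k t * y - a k.+1 t * (tau * y)).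
  rewrite -[LHS]mulr1 -y1 -nmM; congr nm.
  move: (a k t) (a k.+1 t) => b1 b2; ring.
rewrite E.
apply: le_trans (nm_sum _ _ _) _.
have -> : e = \sum_(j < n) M * (e / (n%:R * M)).
  rewrite sumr_const card_ord -[RHS]mulr_natl; field.
  by rewrite gt_eqF //= -[1 + _](natrD _ 1 p) gt_eqF // ltr0n.
apply: ler_sum => j _; rewrite nmM; apply: ler_pM; rewrite ?nm_ge0 //.
  exact: (HM (inord k, inord k.+1, j)).
by rewrite coefs_mx_moment.
Qed.

(** tau need not be holomorphic in t. Eliminating it between two approximate ratios leaves a
    holomorphic function that is small near the circle, hence zero. *)
Lemma fiber_minor_quadric (k q : nat) t : (k <= p)%N -> (q <= p)%N -> nm t < 1 ->
  a k t * a q.+1 t = a k.+1 t * a q t.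
Proof.
move=> kp qp t1; apply/eqP; rewrite -subr_eq0; apply/eqP.
pose g t := a k t * a q.+1 t - a k.+1 t * a q t.
have ha k' s : nm s < 1 -> holo (a k') s by case: (fiber_minor_bholo k') => h _ /h.
have hg : disc_holo g.
  by move=> s s1; apply: holoB; apply: holoM; exact: ha.
apply: (small_boundary_eq0 hg) t1 => e e0.
have [M M0 HM] : exists2 M : R, 0 < M & forall (i : 'I_n.+2) t, nm t < 1 -> nm (a i t) <= M.
  by apply: bounded_family => i; case: (fiber_minor_bholo i).
have e'0 : 0 < e / (2 * M) by rewrite divr_gt0 // mulr_gt0.
apply: near_circle_mono (fiber_minor_near e'0) => s s1 [tau tau1 H].
have -> : g s = (a k s - tau * a k.+1 s) * a q.+1 s - a k.+1 s * (a q s - tau * a q.+1 s).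
  rewrite /g; move: (a k s) (a k.+1 s) (a q s) (a q.+1 s) => b1 b2 b3 b4; ring.
have bd i : (i <= n)%N -> nm (a i s) <= M.
  by move=> iN; have := HM (inord i) s s1; rewrite inordK // ltnS (leq_trans iN).
have h1 : nm ((a k s - tau * a k.+1 s) * a q.+1 s) <= e / (2 * M) * M.
  by rewrite nmM; apply: ler_pM; rewrite ?nm_ge0 ?H ?bd // ltnS.
have h2 : nm (a k.+1 s * (a q s - tau * a q.+1 s)) <= M * (e / (2 * M)).
  by rewrite nmM; apply: ler_pM; rewrite ?nm_ge0 ?H ?bd // ltnS.
apply: le_trans (nmBD _ _) _; apply: le_trans (lerD h1 h2) _.
by rewrite le_eqVlt; apply/orP; left; apply/eqP; field; rewrite gt_eqF.
Qed.

(** The relations make the normal vector a_n(t) times the moment vector of x, so the vanishing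
    pairing is a_n(t) P_l(x) = 0. *)
Lemma fiber_minor_root t : nm t < 1 -> a n t != 0 -> fiber_root t (a p t / a n t).
Proof.
move=> t1 an0 l lD lt; set x := _ / _.
have ak j : (j <= n)%N -> a (n - j) t = x ^+ j * a n t.
  elim: j => [|j IH] jn; first by rewrite subn0 mul1r.
  have := fiber_minor_quadric (k := n - j.+1) (q := p) _ (leqnn p) t1.
  rewrite (_ : ((n - j.+1).+1 = n - j)%N); last by lia.
  rewrite IH ?(ltnW jn) // => /(_ _) h; have {}h := h ltac:(lia).
  apply: (mulIf an0); rewrite h exprS /x.
  by move: (a n t) (a p t) an0 => b c b0; rewrite -[in RHS]mulrA; field.
have := fiber_minor_vanish t1 lD lt.
have -> : \sum_(j < n.+1) v l 0 j * max_minor (V t) j = root_eval (F l) x * a n t.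
  rewrite /root_eval mulr_suml; apply: eq_bigr => j _; rewrite -mulrA; congr (_ * _).
  rewrite -(ak (n - j)%N (leq_subr _ _)) fiber_minorE; congr max_minor; apply: val_inj.
  have := ltn_ord j; rewrite ltnS => jn; by rewrite /= inordK; lia.
by move=> /eqP; rewrite mulf_eq0 (negbTE an0) orbF => /eqP.
Qed.

(** The rows kill the moment vector of x, so [max_minor_adj] has no error term. Where a_n(t) != 0
    the common root is thus unique, and it does not depend on the family [z]. *)
Lemma fiber_minor_unique t x : nm t < 1 -> fiber_root t x -> a n t * x = a p t.
Proof.
move=> t1 xroot; have := max_minor_adj (V t) (moment n x) (inord n) (inord p).
rewrite -!fiber_minorE (momentE x (leqnn n)) (momentE x (leqnSn p)) subnn expr0 subSnn expr1 mulr1.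
rewrite big1 => [/subr0_eq/esym //|k _].
rewrite coefs_mx_moment xroot ?mulr0 //; first exact: upd_polydisc.
by rewrite updE eqxx.
Qed.

(** If a_n = 0, the relations a_(j-1) a_(j+1) = a_j^2 propagate the zero down to index 1. The
    remaining minor a_0 vanishes too, because it is paired with the leading coefficient 1. *)
Lemma fiber_minor_neq0 t : nm t < 1 -> row_free (V t) -> a n t != 0.
Proof.
move=> t1 /max_minor_neq0[i0 hi0]; apply: contraNneq hi0 => an0.
have ak k : (k <= p)%N -> a (n - k) t = 0.
  elim: k => [|k IH] kp; first by rewrite subn0.
  have := fiber_minor_quadric (k := p - k.+1) (q := n - k.+1) _ _ t1.
  rewrite (_ : ((n - k.+1).+1 = n - k)%N); last by lia.
  rewrite (_ : ((p - k.+1).+1 = n - k.+1)%N); last by lia.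
  rewrite IH ?(ltnW kp) // mulr0 => h; have {}h := h ltac:(lia) ltac:(lia).
  by apply/eqP; move/esym/eqP: h; rewrite mulf_eq0 orbb.
have aj j : j != ord0 -> max_minor (V t) j = 0.
  move=> j0; have jn := ltn_ord j.
  have jpos : (0 < j)%N by rewrite lt0n; apply: contra j0 => /eqP jE; apply/eqP/val_inj.
  have := ak (n - j)%N; rewrite subKn // fiber_minorE inord_val; apply; lia.
apply/eqP; have [->|/aj //] := eqVneq i0 ord0.
have lD := upd_polydisc ord0 (zD ord0) t1.
have := fiber_minor_vanish t1 lD; rewrite updE eqxx => /(_ erefl).
rewrite (bigD1 ord0) //= big1 ?addr0 => [|j j0']; last by rewrite aj ?mulr0.
by rewrite /image_coefs root_coefs0 mul1r.
Qed.

End Fiber.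

Lemma local_fiber_root t0 : nm t0 < 1 -> exists al be : C -> C,
  [/\ disc_holo al, disc_holo be, be t0 != 0,
     forall t, nm t < 1 -> be t != 0 -> fiber_root t (al t / be t) &
     forall t x, nm t < 1 -> fiber_root t x -> be t * x = al t].
Proof.
move=> t01; have lD := upd_polydisc ord0 (@polydisc0 R n) t01.
have [z [zD zl zfree]] := chain f_maps f_holo f_roots lD (leqnSn p).
have zt i : z i 0 ord0 = t0.
  by rewrite zl ?updE ?eqxx // subSnn.
exists (fiber_minor z p), (fiber_minor z n); split.
- by case: (fiber_minor_bholo zD p).
- by case: (fiber_minor_bholo zD n).
- apply: fiber_minor_neq0 => //.
  rewrite (_ : coefs_mx _ _ = coefs_mx f z) //.
  by apply/row_matrixP => i; rewrite !rowK -(zt i) upd_id.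
- by move=> t t1 b0; exact: fiber_minor_root.
- by move=> t x t1 xr; exact: fiber_minor_unique.
Qed.

(** B is chosen point by point; near each t0 uniqueness identifies it with the holomorphic quotient
    of [local_fiber_root]. *)
Lemma fiber_root_exists : exists2 B : C -> C, disc_holo B &
  forall t, nm t < 1 -> fiber_root t (B t).
Proof.
have /choice[B HB] : forall t, exists x, nm t < 1 -> fiber_root t x.
  move=> t; have [t1|t1] := boolP (nm t < 1); last by exists 0.
  have [al [be [_ _ be0 hr _]]] := local_fiber_root t1.
  by exists (al t / be t) => _; exact: hr.
exists B => // t0 t01.
have [al [be [hal hbe be0 hr hu]]] := local_fiber_root t01.
have be0' : 0 < nm (be t0) by rewrite nm_gt0.
have [d d0 Hd] := (ccontP _ _).1 (holo_cont (hbe _ t01)) _ be0'.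
apply: (@holo_near_eq _ (fun t => al t / be t) _ _ (Num.min d (1 - nm t0))).
- by rewrite lt_min d0 subr_gt0.
- move=> t; rewrite lt_min => /andP[td t1].
  have {}t1 : nm t < 1 by have := nm_sub_ge t t0; lra.
  have bt0 : be t != 0.
    by apply/eqP => bt; have := Hd t td; rewrite bt sub0r nmN ltxx.
  by rewrite -(hu t _ t1 (HB t t1)) mulrC mulKf.
by apply: holoM; [exact: hal|apply: holoV; first exact: hbe].
Qed.

End BoundaryRoot.

(** * The formula for the map *)

Section ImageOfProper.
Variable R : realType.
Variable p : nat.
Local Notation n := p.+1.
Local Notation C := R[i].
Variable f : 'rV[C]_n -> 'rV[C]_n.
Hypothesis f_maps : set_fun (symmetrized_disc R n) (symmetrized_disc R n) f.
Hypothesis f_holo : holomorphic_on (symmetrized_disc R n) f.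
Hypothesis f_roots : forall rho : R, rho < 1 -> exists2 r : R, 0 <= r < 1 &
  forall l, polydisc R n l -> forall j, r < nm (l 0 j) ->
  forall m, symmetrization m = f (symmetrization l) -> exists i, rho < nm (m 0 i).
Variable B : C -> C.
Hypothesis B_holo : disc_holo B.
Hypothesis B_root : forall t, nm t < 1 -> fiber_root f t (B t).
Implicit Types (l m u : 'rV[C]_n) (t x tau : C).

Local Notation F l := (f (symmetrization l)).

(** A transposition brings coordinate j to the front without changing the symmetrized point. *)
Lemma image_root l j : polydisc R n l -> root_eval (F l) (B (l 0 j)) = 0.
Proof.
move=> lD; have lj : nm (l 0 j) < 1 by apply/(polydiscE l).1.
pose s := tperm ord0 j.
rewrite -(symmetrization_perm l (@perm_inj _ s)).
apply: (B_root lj); last by rewrite mxE tpermL.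
by move=> i; rewrite mxE.
Qed.

Lemma B_lt1 t : nm t < 1 -> nm (B t) < 1.
Proof.
move=> t1; have lD := upd_polydisc ord0 (@polydisc0 R n) t1.
have := image_root ord0 lD; rewrite updE eqxx.
have [m /polydiscE mD <-] := image_roots f_maps lD.
by move=> /root_eval_eq0[j <-].
Qed.

(** Otherwise all coefficient vectors would be orthogonal to one moment vector, nonzero because its
    last entry is 1, although they span the whole space. *)
Lemma B_nonconstant : ~ exists b, forall t, nm t < 1 -> B t = b.
Proof.
move=> [b Bb].
have [z [zD _ zfree]] := chain f_maps f_holo f_roots (@polydisc0 R n) (leqnn n).
have : coefs_mx f z *m moment n b = 0.
  apply/colP => i; rewrite coefs_mx_moment mxE -(Bb (z i 0 ord0)).
    exact: image_root.
  exact: (polydiscE _).1.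
rewrite row_free_unit in zfree.
move=> /(congr1 (mulmx (invmx (coefs_mx f z)))); rewrite mulKmx // mulmx0.
move=> /colP/(_ ord_max); rewrite !mxE subnn expr0 => /eqP.
by rewrite oner_eq0.
Qed.

Lemma symm_map_holo l (k i : 'I_n) : polydisc R n l ->
  disc_holo (fun t => symmetrization (map_mx B (upd l k t)) 0 i).
Proof.
move=> lD t t1; under eq_fun do rewrite mxE.
apply: holo_sum => A; apply: holo_prod => j.
under eq_fun do rewrite !mxE.
by case: eqP => _; [exact: B_holo|exact: holo_cst].
Qed.

(* Induction on q, moving the coordinates q - 1, .., 0 one at a time to values
   at which B separates them. *)
Lemma image_formula_distinct (q : nat) l : (q <= n)%N -> polydisc R n l ->
  (forall i j : 'I_n, i != j -> (q <= maxn i j)%N -> B (l 0 i) != B (l 0 j)) ->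
  F l = symmetrization (map_mx B l).
Proof.
elim: q l => [|q IH] l qn lD ldist.
  have [m mD mE] := image_roots f_maps lD.
  rewrite -mE (symmetrization_distinct (b := fun j => B (l 0 j))) //.
  - by congr symmetrization; apply/rowP => j; rewrite !mxE.
  - move=> i j Bij; apply/eqP; apply: contraT => ij.
    by have := ldist _ _ ij (leq0n _); rewrite Bij eqxx.
  by move=> j; rewrite mE; exact: image_root.
pose k : 'I_n := Ordinal qn.
apply/rowP => i; apply/eqP; rewrite -subr_eq0; apply/eqP.
pose h t := F (upd l k t) 0 i - symmetrization (map_mx B (upd l k t)) 0 i.
have lk : nm (l 0 k) < 1 by apply/(polydiscE l).1.
have hh : disc_holo h.
  move=> t t1; apply: holoB; last exact: symm_map_holo.
  under eq_fun do rewrite upd_line; apply: holo_line => //.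
  by rewrite -upd_line; exact: upd_polydisc.
have -> : F l 0 i - symmetrization (map_mx B l) 0 i = h (l 0 k) by rewrite /h upd_id.
have h0 t : nm t < 1 -> B t \notin [seq B (l 0 j) | j <- enum 'I_n] -> h t = 0.
  move=> t1 Bt; rewrite /h (IH (upd l k t)) ?subrr ?(ltnW qn) //; first exact: upd_polydisc.
  have neq j : B t != B (l 0 j).
    by apply: contra Bt => /eqP->; apply: map_f; rewrite mem_enum.
  move=> a b ab hm; rewrite !updE.
  have [ak|ak] := eqVneq a k; have [bk|bk] := eqVneq b k.
  - by rewrite ak bk eqxx in ab.
  - exact: neq.
  - by rewrite eq_sym; exact: neq.
  apply: ldist => //; have : (a : nat) != q by [].
  have : (b : nat) != q by [].
  by rewrite /= in hm *; move: hm; rewrite !leq_max; lia.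
(* [avoid_values] finds points arbitrarily close to l_k where h vanishes; continuity gives h = 0 at
   l_k. *)
apply: le_eps_eq0 => e e0.
have [d d0 Hd] := (ccontP _ _).1 (holo_cont (hh _ lk)) e e0.
have BD z : nm z < 1 -> nm (B z) <= 1 by move=> /B_lt1/ltW.
have [w [wd w1 wB]] := avoid_values [seq B (l 0 j) | j <- enum 'I_n] B_holo BD
  B_nonconstant lk d0.
by have := Hd w wd; rewrite h0 // sub0r nmN => /ltW.
Qed.

Lemma image_formula l : polydisc R n l -> F l = symmetrization (map_mx B l).
Proof.
move=> lD; apply: (@image_formula_distinct n) => // i j _.
by rewrite leq_max => /orP[]; rewrite leqNgt ltn_ord.
Qed.

(** On the diagonal (t, .., t) every root of the image is B(t), so properness on roots speaks of B
    itself. *)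
Lemma B_near_circle (e : R) : 0 < e -> near_circle (fun t => 1 - e < nm (B t)).
Proof.
move=> e0; have [|r r01 Hr] := f_roots (rho := 1 - e); first by rewrite gtrBl.
exists r => // t /andP[rt t1].
have lD : polydisc R n (const_mx t) by apply/polydiscE => j; rewrite mxE.
have [|i] := Hr _ lD ord0 _ (map_mx B (const_mx t)) (esym (image_formula lD)).
  by rewrite mxE.
by rewrite !mxE.
Qed.

End ImageOfProper.

(** * Finite Blaschke products and proper maps *)

Section Blaschke.
Variable R : realType.
Local Notation C := R[i].

Lemma unit_discE (z : C) : unit_disc R z <-> nm z < 1.
Proof. by rewrite /unit_disc /= nmE -[1 : C]/(1%:C) ltcR. Qed.

Lemma norm1E (z : C) : `|z| = 1 <-> nm z = 1.
Proof. by rewrite nmE; split=> [/complexI|->]. Qed.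

Lemma prod_mob_lt1 (N : nat) (a : 'I_N -> C) (z : C) : (0 < N)%N ->
  (forall j, nm (a j) < 1) -> nm z < 1 -> nm (\prod_(j < N) mob (a j) z) < 1.
Proof.
case: N a => // N a _ a1 z1; rewrite big_ord_recl nmM nm_prod.
apply: le_lt_trans (mob_lt1 (a1 ord0) z1); rewrite ler_piMr ?nm_ge0 //.
by apply: prodr_ile1 => j _; rewrite nm_ge0 ltW // mob_lt1.
Qed.

Lemma prod_mob_near1 (I : Type) (r : seq I) (a : I -> C) (e : R) :
  (forall j, nm (a j) < 1) -> 0 < e ->
  near_circle (fun z => 1 - e < nm (\prod_(j <- r) mob (a j) z)).
Proof.
move=> a1; elim: r e => [|j r IH] e e0.
  by exists 0; [rewrite lexx ltr01|move=> z _; rewrite big_nil nm1 gtrBl].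
pose d := Num.min (1 / 2) (e / 2).
have d0 : 0 < d by rewrite lt_min divr_gt0 //= divr_gt0.
have [d1 d2] : d <= 1 / 2 /\ d <= e / 2 by split; rewrite ge_min lexx ?orbT.
have m1 : near_circle (fun z => 1 - d < nm (mob (a j) z)) by apply: mob_near1.
apply: near_circle_mono (near_circle_and m1 (IH d d0)) => z z1 [h1 h2].
rewrite big_cons nmM; apply: le_lt_trans (_ : (1 - d) * (1 - d) < _); last first.
  by apply: ltr_pM => //; lra.
have : 0 <= d ^+ 2 by rewrite sqr_ge0.
lra.
Qed.

Lemma proper_disc_finite_blaschke (B : C -> C) : disc_holo B ->
  (forall z, nm z < 1 -> nm (B z) < 1) ->
  (forall e : R, 0 < e -> near_circle (fun z => 1 - e < nm (B z))) -> finite_blaschke B.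
Proof.
move=> hB B1 Bb; have [s [c [s0 c1 sD BE]]] := proper_disc_blaschke hB B1 Bb.
exists (size s), c, (fun j => nth 0 s j); split => //.
- exact/norm1E.
- by move=> j; apply/unit_discE/sD/mem_nth.
by move=> z /unit_discE z1; rewrite BE // (big_nth 0) big_mkord.
Qed.

Lemma blaschke_symmetrization_proper n (f : 'rV[C]_n -> 'rV[C]_n) (B : C -> C) :
  set_fun (symmetrized_disc R n) (symmetrized_disc R n) f ->
  holomorphic_on (symmetrized_disc R n) f -> finite_blaschke B ->
  (forall l, polydisc R n l -> f (symmetrization l) = symmetrization (map_mx B l)) ->
  proper_map (symmetrized_disc R n) (symmetrized_disc R n) f.
Proof.
move=> fG hf [N [c [a [N0 /norm1E c1 aD BE]]]] fE.
have a1 j : nm (a j) < 1 by apply/unit_discE.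
have BE' z : nm z < 1 -> B z = c * \prod_(j < N) mob (a j) z.
  by move=> /unit_discE/BE.
apply: roots_proper => // rho rho1.
have e0 : 0 < 1 - rho by rewrite subr_gt0.
have [r r01 Hr] := prod_mob_near1 (index_enum 'I_N) a1 e0.
exists r => // l /[dup] lD /polydiscE lD' j rj; exists (map_mx B l), j; split.
- apply/polydiscE => i; rewrite mxE BE' // nmM c1 mul1r; exact: prod_mob_lt1.
- by rewrite fE.
rewrite mxE BE' // nmM c1 mul1r; have := Hr (l 0 j).
by rewrite rj lD' subKr; apply.
Qed.

Lemma proper_symmetrized n (f : 'rV[C]_n -> 'rV[C]_n) : (0 < n)%N ->
  set_fun (symmetrized_disc R n) (symmetrized_disc R n) f ->
  holomorphic_on (symmetrized_disc R n) f ->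
  proper_map (symmetrized_disc R n) (symmetrized_disc R n) f ->
  exists B : C -> C, [/\ finite_blaschke B, disc_holo B,
    forall z, nm z < 1 -> nm (B z) < 1 &
    forall l, polydisc R n l -> f (symmetrization l) = symmetrization (map_mx B l)].
Proof.
case: n f => // p f _ fG hf /proper_roots f_roots.
have [B hB Broot] := fiber_root_exists fG hf f_roots.
exists B; split => //.
- apply: proper_disc_finite_blaschke => //; first exact: (B_lt1 fG Broot).
  exact: (B_near_circle fG hf f_roots hB Broot).
- exact: (B_lt1 fG Broot).
exact: (image_formula fG hf f_roots hB Broot).
Qed.

End Blaschke.

(** * Automorphisms *)

Section RationalMaps.
Variables (K : numFieldType) (n : nat).

(** [coef] copies the body of [root_coefs], so that each entry of [moebius_symm] has this shape. *)
Lemma differentiable_affine_ratio (a b : 'I_n.+1 -> K) (e : K) (s : 'rV[K]_n) :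
  let coef k (x : 'rV[K]_n) :=
    if unlift ord0 k is Some i then (-1) ^+ k * x 0 i else 1 : K in
  \sum_(k < n.+1) coef k s * b k != 0 ->
  differentiable (fun x : 'rV[K]_n => e * (\sum_(k < n.+1) coef k x * a k)
    / (\sum_(k < n.+1) coef k x * b k) : K^o) s.
Proof.
move=> coef b0.
have dcoef k : differentiable (fun x : 'rV[K]_n => coef k x : K^o) s.
  rewrite /coef; case: (unlift ord0 k) => [i|]; last exact: differentiable_cst.
  apply: (@differentiableM K _ (fun=> (-1) ^+ k) (fun x : 'rV[K]_n => x 0 i)).
    exact: differentiable_cst.
  exact: differentiable_coord.
have dsum (c : 'I_n.+1 -> K) :
    differentiable (fun x : 'rV[K]_n => \sum_(k < n.+1) coef k x * c k : K^o) s.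
  apply: differentiable_bigsum => k.
  by apply: (@differentiableM K _ (fun x => coef k x) (fun=> c k));
    [exact: dcoef|exact: differentiable_cst].
apply: (@differentiableM K _ (fun x => e * \sum_(k < n.+1) coef k x * a k)
  (fun x => (\sum_(k < n.+1) coef k x * b k)^-1)).
  by apply: (@differentiableM K _ (fun=> e) (fun x => \sum_(k < n.+1) coef k x * a k));
    [exact: differentiable_cst|exact: dsum].
by apply: differentiableV; [exact: dsum|exact: b0].
Qed.

End RationalMaps.

(** * Moebius maps acting on the symmetrized disc *)

Section MoebiusDescent.
Variable R : realType.
Variable n : nat.
Local Notation C := R[i].
Implicit Types (l s : 'rV[C]_n).

Lemma coef_root_poly s (k : 'I_n.+1) : (root_poly s)`_(n - k) = root_coefs s 0 k.
Proof.
rewrite /root_poly coef_sum (bigD1 k) //= big1 ?addr0 => [|j jk].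
  by rewrite coefCM coefXn eqxx mulr1.
rewrite coefCM coefXn; case: eqP => [E|_]; last by rewrite mulr0.
case/eqP: jk; apply: val_inj => /=; have := ltn_ord j; have := ltn_ord k; lia.
Qed.

Section Moebius.
Variables a c : C.
Hypothesis a1 : nm a < 1.
Hypothesis c1 : nm c = 1.

Local Notation h := (fun z => c * mob a z).

Definition moebius_den s : C := \sum_(k < n.+1) root_coefs s 0 k * a^* ^+ k.

Definition moebius_poly k : {poly C} :=
  (a^*%:P * 'X + c%:P) ^+ k * ('X + (c * a)%:P) ^+ (n - k).

(** A quotient of affine functions of s, so holomorphy is visible even where roots coincide. The
    sign turns a polynomial coefficient back into an elementary symmetric polynomial. *)
Definition moebius_symm s : 'rV[C]_n := \row_i ((-1) ^+ i.+1 *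
  (\sum_(k < n.+1) root_coefs s 0 k * (moebius_poly k)`_(n - i.+1)) / moebius_den s).

Lemma moebius_denE l : moebius_den (symmetrization l) = \prod_(j < n) (1 - a^* * l 0 j).
Proof.
rewrite prod_linear_elsym; apply: eq_bigr => k _.
by rewrite root_coefs_symm expr1n mulr1.
Qed.

Lemma moebius_den_neq0 l : polydisc R n l -> moebius_den (symmetrization l) != 0.
Proof.
move=> /polydiscE lD; rewrite moebius_denE; apply/prodf_neq0 => j _.
exact: mob_den.
Qed.

(* X - c (l - a) / (1 - a^* l) = ((X + c a) - (a^* X + c) l) / (1 - a^* l),
   so the product over the roots is a combination of elementary symmetric
   polynomials of l. *)
Lemma moebius_root_poly l : polydisc R n l ->
  root_poly (symmetrization (map_mx h l)) * (moebius_den (symmetrization l))%:P =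
  \sum_(k < n.+1) (root_coefs (symmetrization l) 0 k)%:P * moebius_poly k.
Proof.
move=> /polydiscE lD; rewrite root_poly_symm moebius_denE rmorph_prod -big_split /=.
transitivity (\prod_(j < n) (('X + (c * a)%:P) - (a^*%:P * 'X + c%:P) * (l 0 j)%:P)).
  apply: eq_bigr => j _; rewrite !mxE.
  have d0 := mob_den a1 (lD j).
  have E : c * mob a (l 0 j) * (1 - a^* * l 0 j) = c * (l 0 j - a).
    by rewrite /mob -mulrA divfK.
  rewrite mulrBl -polyCM E !(polyCM, polyCB, polyC1); ring.
rewrite prod_linear_elsym; apply: eq_bigr => k _.
rewrite root_coefs_symm /moebius_poly mulrA; congr (_ * _ * _).
rewrite rmorphM rmorphXn rmorphN1; congr (_ * _).
rewrite rmorph_sum; apply: eq_bigr => A _.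
by rewrite rmorph_prod.
Qed.

Lemma moebius_symmE l : polydisc R n l ->
  moebius_symm (symmetrization l) = symmetrization (map_mx h l).
Proof.
move=> lD; have d0 := moebius_den_neq0 lD; apply/rowP => i; rewrite mxE.
have := congr1 (fun q : {poly C} => q`_(n - i.+1)) (moebius_root_poly lD).
rewrite coefMC (_ : (n - i.+1)%N = (n - lift ord0 i)%N) // coef_root_poly coef_sum.
under eq_bigr do rewrite coefCM; move=> <-.
rewrite -mulrA mulfK // root_coefsS mulrA -expr2 sqrr_sign mul1r //.
Qed.

Lemma moebius_symm_holo : holomorphic_on (symmetrized_disc R n) moebius_symm.
Proof.
move=> s [l lD <-]; have d0 := moebius_den_neq0 lD.
apply: differentiable_row => j; under eq_fun do rewrite mxE.
have coefE (k : 'I_n.+1) (x : 'rV[C]_n) : root_coefs x 0 k =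
    if unlift ord0 k is Some i then (-1) ^+ k * x 0 i else 1 by rewrite mxE.
move: d0; rewrite /moebius_den; under eq_bigr do rewrite coefE.
move=> /(@differentiable_affine_ratio C n (fun k => (moebius_poly k)`_(n - j.+1))
  (fun k => a^* ^+ k) ((-1) ^+ j.+1)).
congr (differentiable _ _); apply/funext => x.
by congr (_ * _ / _); apply: eq_bigr => k _; rewrite coefE.
Qed.

End Moebius.

End MoebiusDescent.

Section Automorphisms.
Variable R : realType.
Local Notation C := R[i].

(** The preimage of K is its image under the continuous inverse. *)
Lemma automorphism_proper (V : normedModType C) (U : set V) (f : V -> V) :
  automorphism U f -> proper_map U U f.
Proof.
move=> [fU _ [g [gU hg gf fg]]] K KU cK.
have -> : U `&` f @^-1` K = g @` K.
  apply/seteqP; split=> [x [Ux Kfx]|_ [y Ky <-]]; first by exists (f x) => //; exact: gf.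
  by split; [exact/gU/KU|rewrite /preimage /= fg //; exact: KU].
apply: continuous_compact cK; apply: continuous_in_subspaceT => x.
by rewrite inE => /KU Ux; apply: differentiable_continuous; exact: hg.
Qed.

Lemma disc_automorphismP (h : C^o -> C^o) : automorphism (unit_disc R) h <->
  exists g : C -> C, [/\ disc_holo h, disc_holo g,
    (forall z, nm z < 1 -> nm (h z) < 1) /\ (forall z, nm z < 1 -> nm (g z) < 1),
    forall z, nm z < 1 -> g (h z) = z & forall z, nm z < 1 -> h (g z) = z].
Proof.
split=> [[hU hh [g [gU hg gh hgK]]]|[g [hh hg [h1 g1] gh hgK]]].
  exists g; split; last 2 first.
  - by move=> z /unit_discE; exact: gh.
  - by move=> z /unit_discE; exact: hgK.
  - by move=> z /unit_discE/hh/holoE.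
  - by move=> z /unit_discE/hg/holoE.
  by split=> z /unit_discE; [move=> /hU/unit_discE|move=> /gU/unit_discE].
split; first by move=> z /unit_discE/h1/unit_discE.
  by move=> z /unit_discE/hh/holoE.
exists g; split.
- by move=> z /unit_discE/g1/unit_discE.
- by move=> z /unit_discE/hg/holoE.
- by move=> z /unit_discE; exact: gh.
by move=> z /unit_discE; exact: hgK.
Qed.

(** Tested on the diagonal: D(B(z)) is a root of a polynomial whose only root is z. *)
Lemma symmetrized_inverse n (f g : 'rV[C]_n -> 'rV[C]_n) (B D : C -> C) : (0 < n)%N ->
  (forall s, symmetrized_disc R n s -> g (f s) = s) ->
  (forall l, polydisc R n l -> f (symmetrization l) = symmetrization (map_mx B l)) ->
  (forall l, polydisc R n l -> g (symmetrization l) = symmetrization (map_mx D l)) ->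
  (forall z, nm z < 1 -> nm (B z) < 1) ->
  forall z, nm z < 1 -> D (B z) = z.
Proof.
move=> n0 gf fB gD B1 z z1.
have zD : polydisc R n (const_mx z) by apply/polydiscE => j; rewrite mxE.
have BzD : polydisc R n (map_mx B (const_mx z)).
  by apply/polydiscE => j; rewrite !mxE; exact: B1.
have E : g (f (symmetrization (const_mx z))) = symmetrization (const_mx z).
  by apply: gf; exists (const_mx z).
rewrite (fB _ zD) (gD _ BzD) in E.
have := root_eval_root (map_mx D (map_mx B (const_mx z))) (Ordinal n0).
by rewrite E => /root_eval_eq0[j]; rewrite !mxE.
Qed.

Variable n : nat.
Variable f : 'rV[C]_n -> 'rV[C]_n.
Hypothesis f_maps : set_fun (symmetrized_disc R n) (symmetrized_disc R n) f.
Hypothesis f_holo : holomorphic_on (symmetrized_disc R n) f.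

Lemma automorphism_symmetrized : (0 < n)%N -> automorphism (symmetrized_disc R n) f ->
  exists h : C^o -> C^o, automorphism (unit_disc R) h /\
    forall l, polydisc R n l -> f (symmetrization l) = symmetrization (map_mx h l).
Proof.
move=> n0 af; have [_ _ [g [gG hg gf fg]]] := af.
have ag : automorphism (symmetrized_disc R n) g by split => //; exists f; split.
have [B [_ hB B1 fB]] := proper_symmetrized n0 f_maps f_holo (automorphism_proper af).
have [D [_ hD D1 gD]] := proper_symmetrized n0 gG hg (automorphism_proper ag).
exists B; split => //; apply/disc_automorphismP; exists D; split => //.
  exact: symmetrized_inverse gf fB gD B1.
exact: symmetrized_inverse fg gD fB D1.
Qed.

Lemma symmetrized_automorphism (h : C^o -> C^o) : automorphism (unit_disc R) h ->
  (forall l, polydisc R n l -> f (symmetrization l) = symmetrization (map_mx h l)) ->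
  automorphism (symmetrized_disc R n) f.
Proof.
move=> /disc_automorphismP[k [hh hk [h1 k1] kh hkK]] fh; split => //.
(* The inverse [k], not [h], is put in Moebius form, since it is the inverse of [f] that has to be
   constructed. *)
have [c [a [c1 a1 kE]]] := disc_automorphism_mob hk hh k1 h1 hkK kh.
have mapk l : polydisc R n l -> map_mx (fun z => c * mob a z) l = map_mx k l.
  by move=> /polydiscE lD; apply/rowP => j; rewrite !mxE kE.
have gE l : polydisc R n l -> moebius_symm a c (symmetrization l) = symmetrization (map_mx k l).
  by move=> lD; rewrite moebius_symmE // mapk.
have kD l : polydisc R n l -> polydisc R n (map_mx k l).
  by move=> /polydiscE lD; apply/polydiscE => j; rewrite mxE k1.
have hD l : polydisc R n l -> polydisc R n (map_mx h l).
  by move=> /polydiscE lD; apply/polydiscE => j; rewrite mxE h1.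
exists (moebius_symm a c); split.
- by move=> _ [l lD <-]; rewrite gE //; exists (map_mx k l) => //; exact: kD.
- exact: moebius_symm_holo.
- move=> _ [l lD <-]; rewrite fh // gE; last exact: hD.
  congr symmetrization; apply/rowP => j; rewrite !mxE kh //; exact: (polydiscE l).1.
move=> _ [l lD <-]; rewrite gE // fh; last exact: kD.
congr symmetrization; apply/rowP => j; rewrite !mxE hkK //; exact: (polydiscE l).1.
Qed.

End Automorphisms.

Theorem theorem1 (R : realType) (n : nat)
    (f : 'rV[R[i]]_n -> 'rV[R[i]]_n)
    (n_ge1 : (1 <= n)%N)
    (f_maps : set_fun (symmetrized_disc R n) (symmetrized_disc R n) f)
    (f_holo : holomorphic_on (symmetrized_disc R n) f) :
  (proper_map (symmetrized_disc R n) (symmetrized_disc R n) f <->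
     exists B : R[i] -> R[i], finite_blaschke B /\
       forall l : 'rV[R[i]]_n, polydisc R n l ->
         f (symmetrization l) = symmetrization (map_mx B l))
  /\
  (automorphism (symmetrized_disc R n) f <->
     exists h : R[i]^o -> R[i]^o, automorphism (unit_disc R) h /\
       forall l : 'rV[R[i]]_n, polydisc R n l ->
         f (symmetrization l) = symmetrization (map_mx h l)).
Proof.
split; split.
- by move=> /(proper_symmetrized n_ge1 f_maps f_holo)[B [bB _ _ fB]]; exists B.
- by move=> [B [bB fB]]; exact: blaschke_symmetrization_proper bB fB.
- exact: automorphism_symmetrized.
by move=> [h [ah fh]]; exact: symmetrized_automorphism ah fh.
Qed.
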